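(* Suppose that $u\in\dot H^{1/2}(\mathbb{R};\mathbb{S})$. Then $\|u\|_{\dot H^{1/2}(\mathbb{R})}^2\ge|\deg u|$. If equality holds, then $u$ or its complex conjugate $\bar u$ must be of the form $$\psi_{\vartheta,\vec\alpha}(x)=e^{\mathrm{i}\vartheta}\prod_{k=1}^{d}\frac{x-\alpha_k}{x-\bar\alpha_k},\qquad d=|\deg u|,$$ for some $\vartheta\in\mathbb{R}$ and $\vec\alpha=(\alpha_1,\dots,\alpha_d)\in\mathbb{H}^d$ (an empty product being $1$).
   Context: $\mathbb{S}\subset\mathbb{C}$ is the unit circle and $\mathbb{H}=\{z\in\mathbb{C}:\operatorname{Im}z>0\}$. $\|f\|_{\dot H^{1/2}(\mathbb{R})}^2=\frac1{4\pi^2}\iint_{\mathbb{R}\times\mathbb{R}}\frac{|f(x)-f(y)|^2}{|x-y|^2}dxdy$, and $\dot H^{1/2}(\mathbb{R};\mathbb{S})$ is the set of measurable $u:\mathbb{R}\to\mathbb{C}$ with $|u|=1$ a.e. and $\|u\|_{\dot H^{1/2}(\mathbb{R})}<\infty$. Degree: for $w:\mathbb{S}\to\mathbb{S}$ in $\dot H^{1/2}$ with Fourier expansion $w=\sum_{k\in\mathbb{Z}}c_kz^k$, $\deg w=\sum_{k\in\mathbb{Z}}k|c_k|^2$ (the winding number, an integer). For $u\in\dot H^{1/2}(\mathbb{R};\mathbb{S})$, $\deg u:=\deg(u\circ\mathcal{S}^{-1})$, with the stereographic projection $\mathcal{S}(x)=\big(\frac{2x}{x^2+1},\frac{x^2-1}{x^2+1}\big)$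 from $\mathbb{R}$ to $\mathbb{S}$. *)

(* Defs.v *)
From HB Require Import structures.
From mathcomp Require Import all_boot all_order all_algebra.
From mathcomp Require Import complex.
From mathcomp Require Import ring.
From mathcomp Require Import all_classical all_reals all_analysis.

Set Implicit Arguments.
Unset Strict Implicit.
Unset Printing Implicit Defensive.

Import Order.TTheory GRing.Theory Num.Theory.
Import numFieldNormedType.Exports.

Local Open Scope classical_set_scope.
Local Open Scope ring_scope.

(* The real line with the sigma-algebra of Lebesgue (not just Borel) measurable
   sets, which is the domain of [completed_lebesgue_measure]. *)
Notation lebesgueType R :=
  (caratheodory_type (measure_extension.mu_ext (@wlength R idfun))).

Section half_sobolev.
Context {R : realType}.

Local Notation leb := (@completed_lebesgue_measure R).

Definition measurable_complex (u : R -> R[i]) : Prop :=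
  measurable_fun [set: lebesgueType R] (fun x => complex.Re (u x)) /\
  measurable_fun [set: lebesgueType R] (fun x => complex.Im (u x)).

(* The value of the integrand on the diagonal, which is a null set, is
   irrelevant (it is 0, as 0^-1 = 0). *)
Definition sqnorm_Hhalf (u : R -> R[i]) : \bar R :=
  (((4 * pi ^+ 2)^-1)%:E *
   \int[leb \x leb]_p
     (Normc.normc (u p.1 - u p.2) ^+ 2 / `|p.1 - p.2| ^+ 2)%:E)%E.

Definition Hhalf_circle : set (R -> R[i]) :=
  [set u | [/\ measurable_complex u,
               {ae leb, forall x, Normc.normc (u x) = 1} &
               (sqnorm_Hhalf u < +oo)%E]].

Definition expi (t : R) : R[i] := (cos t +i* sin t)%C.

Definition cintegral (D : set R) (f : R -> R[i]) : R[i] :=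
  ((\int[leb]_(t in D) complex.Re (f t))
     +i* (\int[leb]_(t in D) complex.Im (f t)))%C.

(* Maps from the unit circle are represented by maps on the complex plane, of
   which only the values on the circle are used. *)
Definition fourier_coef (w : R[i] -> R[i]) (k : int) : R[i] :=
  ((2 * pi)^-1)%:C%C *
  cintegral `[0, 2 * pi] (fun t => w (expi t) * expi (- (k%:~R * t))).

(* Sum of an absolutely convergent family of real numbers indexed by Z. *)
Definition zsum (a : int -> R) : R :=
  fine (\esum_(k in [set: int]) (EFin \o a)^\+ k
        - \esum_(k in [set: int]) (EFin \o a)^\- k)%E.

Definition deg_circle (w : R[i] -> R[i]) : R :=
  zsum (fun k => k%:~R * Normc.normc (fourier_coef w k) ^+ 2).

Definition stereo (x : R) : R[i] :=
  ((2 * x / (x ^+ 2 + 1)) +i* ((x ^+ 2 - 1) / (x ^+ 2 + 1)))%C.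

(* The inverse of [stereo] on the circle deprived of the point 'i. *)
Definition stereo_inv (z : R[i]) : R := complex.Re z / (1 - complex.Im z).

Lemma normc_stereo x : Normc.normc (stereo x) = 1.
Proof.
have x1 : x ^+ 2 + 1 != 0 by rewrite gt_eqF// ltr_wpDl// sqr_ge0.
rewrite /= (_ : _ + _ = 1) ?sqrtr1//; by field.
Qed.

Lemma stereoK : cancel stereo stereo_inv.
Proof.
move=> x; rewrite /stereo_inv /=.
have x1 : x ^+ 2 + 1 != 0 by rewrite gt_eqF// ltr_wpDl// sqr_ge0.
have h : 1 - (x ^+ 2 - 1) / (x ^+ 2 + 1) = 2 / (x ^+ 2 + 1) by field.
by rewrite h; field.
Qed.

Lemma stereo_invK z : Normc.normc z = 1 -> z != 'i%C ->
  stereo (stereo_inv z) = z.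
Proof.
case: z => a b /= ab1 zi.
have {ab1}ab : a ^+ 2 + b ^+ 2 = 1.
  by rewrite -[LHS]sqr_sqrtr ?addr_ge0 ?sqr_ge0// ab1 expr1n.
have b1 : 1 - b != 0.
  apply: contra zi; rewrite subr_eq0 => /eqP b1; move: ab; rewrite -b1 expr1n.
  by move=> /(canRL (addrK _)); rewrite subrr => /eqP; rewrite sqrf_eq0 => /eqP->.
have a2 : a ^+ 2 = 1 - b ^+ 2 by rewrite -ab addrK.
have b2 : (1 - b) + (1 + b) = 2 :> R by ring.
rewrite /stereo /stereo_inv /= expr_div_n a2.
have -> : (1 - b ^+ 2) / (1 - b) ^+ 2 = (1 + b) / (1 - b) by field.
have h : (1 + b) / (1 - b) + 1 = 2 / (1 - b) by field.
by congr (_ +i* _)%C; rewrite h; field.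
Qed.

Definition deg (u : R -> R[i]) : R := deg_circle (u \o stereo_inv).

Definition upper_half_plane : set R[i] := [set z | 0 < complex.Im z].

Definition psi (d : nat) (theta : R) (alpha : 'I_d -> R[i]) (x : R) : R[i] :=
  expi theta * \prod_(k < d) ((x%:C%C - alpha k) / (x%:C%C - (alpha k)^*%C)).

(* Elements of [Hhalf_circle] are determined up to equality almost everywhere. *)
Definition ae_equal (u v : R -> R[i]) : Prop := {ae leb, forall x, u x = v x}.

End half_sobolev.

(* Main.v *)
Require Import Defs.
From HB Require Import structures.
From mathcomp Require Import all_boot all_order all_algebra.
From mathcomp Require Import complex ring lra zify.
From mathcomp Require Import all_classical all_reals all_analysis.
From mathcomp Require Import measurable_realfun.

(** The energy is conformally invariant, so everything happens on the circle,
    in the following disguise.  Let [nu] be the Cauchy distribution on the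
    line, of density 1 / (pi (1 + x^2)): it is the image of the normalised arc
    length under the inverse stereographic projection.  The map [z := stereo]
    is injective and of modulus one, and

      |z x - z y|^2 = 4 (x - y)^2 / ((1 + x^2) (1 + y^2))

    turns the squared seminorm of u into the integral [energy] of
    |u x - u y|^2 / |z x - z y|^2 with respect to nu x nu ([sqnorm_HhalfE]),
    while the Fourier coefficients of u transported to the circle become the
    integrals c_k of u z^-k ([fourier_coefE]).  From there on, z is known only
    through its being injective and of modulus one and through the vanishing
    of the integrals of z^n for n > 0.

    The inequality.  For real numbers a_0, ..., a_(N-1), expanding the squares
    gives ([kernel_integral])

      \iint |\sum_j a_j (z x / z y)^j|^2 |u x - u y|^2
        = 2 (|u|^2 \sum_j a_j^2 - \sum_(j, l) a_j a_l |c_(j - l)|^2),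

    and the left-hand side is at most C times the energy as soon as
    |\sum_j a_j zeta^j|^2 |zeta - 1|^2 <= C on the unit circle.  Taking a_j = 1
    yields Parseval's identity with a rate ([parseval_le]).  Taking a_j = r^j
    and letting N tend to infinity, then r to 1, yields the sharp bound
    \sum_k |k| |c_k|^2 <= energy u ([bisum_energy_le]), whose left-hand side is
    at least |\sum_k k |c_k|^2| = |deg u|.

    The case of equality.  Then c_k vanishes for all k < 0 or for all k > 0;
    after conjugation in the second case, u is an inner function such that
    D := \sum_k k |c_k|^2 is finite, and has to be recognised as a Blaschke
    product.  Orthonormality of the functions z^m u means that the Gram matrix
    of the backward shifts (c_(i + 1 + k))_k is an orthogonal projection; its
    trace is at most 2 energy u, so these shifts span a space of finite
    dimension.  If this space is not 0, the backward shift has an eigenvector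
    in it, a geometric sequence of ratio beta in the unit disc, orthogonal to
    (c_k)_k: the holomorphic extension of u vanishes at alpha, the conjugate
    of beta ([inner_sequence_zero]).  Dividing u by the Blaschke factor of
    alpha gives an inner function again and lowers D by exactly 1
    ([inner_divide]).  As D remains nonnegative, finitely many steps lead to a
    constant, and u is a Blaschke product of D factors ([inner_blaschke]).
    The Cayley transform converts these factors, evaluated at [stereo x], into
    those of [psi] ([moebius_stereo]). *)

Set Implicit Arguments.
Unset Strict Implicit.
Unset Printing Implicit Defensive.

Import Order.TTheory GRing.Theory Num.Theory.
Import numFieldNormedType.Exports.

Local Open Scope classical_set_scope.
Local Open Scope ring_scope.

Local Notation nc := Normc.normc.

(** * Moduli of complex numbers *)

Section complex_modulus.
Context {R : realType}.
Implicit Types (x y z : R[i]) (r : R).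

Lemma nc_sq z : nc z ^+ 2 = complex.Re z ^+ 2 + complex.Im z ^+ 2.
Proof. by case: z => a b /=; rewrite sqr_sqrtr// addr_ge0// sqr_ge0. Qed.

Lemma nc_ge0 z : 0 <= nc z.
Proof. by case: z => a b /=; exact: sqrtr_ge0. Qed.

Lemma ncM x y : nc (x * y) = nc x * nc y.
Proof. exact: Normc.normcM. Qed.

Lemma ncD x y : nc (x + y) <= nc x + nc y.
Proof. exact: (@le_normcD R x y). Qed.

Lemma ncN x : nc (- x) = nc x.
Proof. exact: (@normcN R x). Qed.

Lemma ncB x y : nc (x - y) <= nc x + nc y.
Proof. by rewrite -(ncN y) ncD. Qed.

Lemma ncJ x : nc x^*%C = nc x.
Proof. by case: x => a b /=; rewrite sqrrN. Qed.

Lemma ncV x : nc x^-1 = (nc x)^-1.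
Proof. exact: Normc.normcV. Qed.

Lemma ncX x n : nc (x ^+ n) = nc x ^+ n.
Proof.
elim: n => [|n ih]; first by rewrite !expr0 Normc.normc1.
by rewrite !exprS ncM ih.
Qed.

Lemma nc_real r : nc r%:C%C = `|r|.
Proof. by rewrite /= expr0n/= addr0 sqrtr_sqr. Qed.

Lemma nc_eq0 x : (nc x == 0) = (x == 0).
Proof.
apply/eqP/eqP => [/Normc.eq0_normc//|->]; exact: Normc.normc0.
Qed.

Lemma nc_gt0 x : (0 < nc x) = (x != 0).
Proof. by rewrite lt_neqAle nc_ge0 andbT eq_sym nc_eq0. Qed.

Lemma mulcJ x : x * x^*%C = (nc x ^+ 2)%:C%C.
Proof.
rewrite nc_sq; case: x => a b; apply/eqP; rewrite eq_complex /=.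
by apply/andP; split; apply/eqP; ring.
Qed.

Lemma unimod_neq0 z : nc z = 1 -> z != 0.
Proof. by move=> z1; rewrite -nc_eq0 z1 oner_neq0. Qed.

Lemma unimodV z : nc z = 1 -> z^-1 = z^*%C.
Proof.
move=> z1; have z0 := unimod_neq0 z1.
by apply: (mulfI z0); rewrite mulcJ z1 expr1n mulfV.
Qed.

Lemma unimod_expz z (k : int) : nc z = 1 -> nc (z ^ k) = 1.
Proof.
case: k => n z1; first by rewrite -exprnP ncX z1 expr1n.
by rewrite -[z ^ _]/((z ^+ n.+1)^-1) ncV ncX z1 expr1n invr1.
Qed.

Lemma unimod_expzJ z (k : int) : nc z = 1 -> (z ^ k)^*%C = z ^ (- k).
Proof.
by move=> z1; rewrite -(unimodV (unimod_expz k z1)) invr_expz.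
Qed.

Lemma norm_Re_le_nc z : `|complex.Re z| <= nc z.
Proof.
case: z => a b /=.
by rewrite -sqrtr_sqr ler_sqrt ?lerDl ?sqr_ge0// addr_ge0// sqr_ge0.
Qed.

Lemma norm_Im_le_nc z : `|complex.Im z| <= nc z.
Proof.
case: z => a b /=.
by rewrite -sqrtr_sqr ler_sqrt ?lerDr ?sqr_ge0// addr_ge0// sqr_ge0.
Qed.

Lemma nc_le_ReIm z : nc z <= `|complex.Re z| + `|complex.Im z|.
Proof.
rewrite -(@ler_pXn2r _ 2)// ?nnegrE ?nc_ge0 ?addr_ge0//.
rewrite nc_sq sqrrD !real_normK ?num_real//.
rewrite addrAC lerDl; by rewrite mulrn_wge0// mulr_ge0.
Qed.

Lemma cReD x y : complex.Re (x + y) = complex.Re x + complex.Re y.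
Proof. by case: x y => a b []. Qed.

Lemma cImD x y : complex.Im (x + y) = complex.Im x + complex.Im y.
Proof. by case: x y => a b []. Qed.

Lemma cReM x y : complex.Re (x * y) =
  complex.Re x * complex.Re y - complex.Im x * complex.Im y.
Proof. by case: x y => a b []. Qed.

Lemma cImM x y : complex.Im (x * y) =
  complex.Re x * complex.Im y + complex.Im x * complex.Re y.
Proof. by case: x y => a b []. Qed.

Lemma eqC_ReIm x y : complex.Re x = complex.Re y ->
  complex.Im x = complex.Im y -> x = y.
Proof. by case: x y => a b [c d] /= -> ->. Qed.

Lemma cRe_sum I (s : seq I) (P : pred I) (F : I -> R[i]) :
  complex.Re (\sum_(i <- s | P i) F i) = \sum_(i <- s | P i) complex.Re (F i).
Proof. exact: (big_morph _ cReD). Qed.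

Lemma cIm_sum I (s : seq I) (P : pred I) (F : I -> R[i]) :
  complex.Im (\sum_(i <- s | P i) F i) = \sum_(i <- s | P i) complex.Im (F i).
Proof. exact: (big_morph _ cImD). Qed.

Lemma conjD x y : (x + y)^*%C = x^*%C + y^*%C.
Proof. exact: rmorphD. Qed.

Lemma conjB x y : (x - y)^*%C = x^*%C - y^*%C.
Proof. exact: rmorphB. Qed.

Lemma conjM x y : (x * y)^*%C = x^*%C * y^*%C.
Proof. exact: rmorphM. Qed.

Lemma conjX x n : (x ^+ n)^*%C = x^*%C ^+ n.
Proof. exact: rmorphXn. Qed.

Lemma conj_sum I (s : seq I) (P : pred I) (F : I -> R[i]) :
  (\sum_(i <- s | P i) F i)^*%C = \sum_(i <- s | P i) (F i)^*%C.
Proof. exact: rmorph_sum. Qed.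

End complex_modulus.

(** * Bounded complex functions on a probability space *)

Section complex_integral.
Context {R : realType} {d : measure_display} {T : measurableType d}.
Variable nu : probability T R.
Implicit Types (f g : T -> R[i]) (c : R[i]).

Definition cmeas f := measurable_fun setT (fun x => complex.Re (f x)) /\
  measurable_fun setT (fun x => complex.Im (f x)).

(** On a probability space these functions form an algebra on which [cint] is
    linear, with no integrability condition to carry along. *)
Definition bmeas f := cmeas f /\ exists M : R, forall x, nc (f x) <= M.

Definition cint f : R[i] :=
  ((\int[nu]_x complex.Re (f x)) +i* (\int[nu]_x complex.Im (f x)))%C.

Lemma cmeas_cst c : cmeas (fun=> c).
Proof. by split. Qed.

Lemma cmeasD f g : cmeas f -> cmeas g -> cmeas (fun x => f x + g x).
Proof.
move=> [f1 f2] [g1 g2]; split.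
  by under eq_fun do rewrite cReD; exact: measurable_funD.
by under eq_fun do rewrite cImD; exact: measurable_funD.
Qed.

Lemma cmeasM f g : cmeas f -> cmeas g -> cmeas (fun x => f x * g x).
Proof.
move=> [f1 f2] [g1 g2]; split.
  under eq_fun do rewrite cReM.
  by apply: measurable_funB; apply: measurable_funM.
under eq_fun do rewrite cImM.
by apply: measurable_funD; apply: measurable_funM.
Qed.

Lemma cmeasJ f : cmeas f -> cmeas (fun x => (f x)^*%C).
Proof.
move=> [f1 f2]; split.
  by apply: (eq_measurable_fun _ _ f1) => x _; case: (f x).
apply: (eq_measurable_fun (fun x => - complex.Im (f x))).
  by move=> x _; case: (f x).
exact: measurable_funN.
Qed.

Lemma cmeasN f : cmeas f -> cmeas (fun x => - f x).
Proof.
move=> mf; rewrite (_ : (fun x => _) = (fun x => (-1) * f x)).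
  exact/cmeasM.
by apply/funext => x; rewrite mulN1r.
Qed.

Lemma cmeasB f g : cmeas f -> cmeas g -> cmeas (fun x => f x - g x).
Proof. by move=> mf mg; apply: cmeasD => //; exact: cmeasN. Qed.

Lemma cmeas_nc2 f : cmeas f -> measurable_fun setT (fun x => nc (f x) ^+ 2).
Proof.
move=> [f1 f2]; under eq_fun do rewrite nc_sq.
by apply: measurable_funD; exact: measurable_funX.
Qed.

Lemma bmeas_meas f : bmeas f -> cmeas f. Proof. by case. Qed.

Lemma bmeas_cst c : bmeas (fun=> c).
Proof. by split; [exact: cmeas_cst|exists (nc c)]. Qed.

Lemma bmeasD f g : bmeas f -> bmeas g -> bmeas (fun x => f x + g x).
Proof.
move=> [mf [M fM]] [mg [N gN]]; split; first exact: cmeasD.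
by exists (M + N) => x; rewrite (le_trans (ncD _ _))// lerD.
Qed.

Lemma bmeasM f g : bmeas f -> bmeas g -> bmeas (fun x => f x * g x).
Proof.
move=> [mf [M fM]] [mg [N gN]]; split; first exact: cmeasM.
by exists (M * N) => x; rewrite ncM ler_pM ?nc_ge0.
Qed.

Lemma bmeasJ f : bmeas f -> bmeas (fun x => (f x)^*%C).
Proof.
move=> [mf [M fM]]; split; first exact: cmeasJ.
by exists M => x; rewrite ncJ.
Qed.

Lemma bmeasN f : bmeas f -> bmeas (fun x => - f x).
Proof.
move=> [mf [M fM]]; split; first exact: cmeasN.
by exists M => x; rewrite ncN.
Qed.

Lemma bmeasB f g : bmeas f -> bmeas g -> bmeas (fun x => f x - g x).
Proof. by move=> mf mg; apply: bmeasD => //; exact: bmeasN. Qed.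

Lemma bmeas_sum I (s : seq I) (P : pred I) (F : I -> T -> R[i]) :
  (forall i, bmeas (F i)) -> bmeas (fun x => \sum_(i <- s | P i) F i x).
Proof.
move=> mF; elim: s => [|i s ih].
  by under eq_fun do rewrite big_nil; exact: bmeas_cst.
under eq_fun do rewrite big_cons.
by case: (P i) => //; exact: bmeasD.
Qed.

Lemma bmeasX f n : bmeas f -> bmeas (fun x => f x ^+ n).
Proof.
move=> mf; elim: n => [|n ih]; first exact: bmeas_cst.
by under eq_fun do rewrite exprS; exact: bmeasM.
Qed.

Lemma bmeas_unimod f : cmeas f -> (forall x, nc (f x) = 1) -> bmeas f.
Proof. by move=> mf f1; split => //; exists 1 => x; rewrite f1. Qed.

Lemma bmeas_expz f (k : int) : cmeas f -> (forall x, nc (f x) = 1) ->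
  bmeas (fun x => f x ^ k).
Proof.
move=> mf f1; have bf := bmeas_unimod mf f1.
case: k => n; first exact: bmeasX.
rewrite (_ : (fun x => _) = (fun x => ((f x)^*%C) ^+ n.+1)).
  by apply: bmeasX; exact: bmeasJ.
by apply/funext => x; rewrite -(unimodV (f1 x)) exprVn.
Qed.

Lemma bmeas_Re_integrable f :
  bmeas f -> nu.-integrable setT (EFin \o (fun x => complex.Re (f x))).
Proof.
move=> [[f1 _] [M fM]]; apply: measurable_bounded_integrable => //.
  by rewrite (le_lt_trans (probability_le1 _ _))// ltry.
exists M; split; first by rewrite num_real.
by move=> y My x _; apply: le_trans (norm_Re_le_nc (f x)) (le_trans (fM x) (ltW My)).
Qed.

Lemma bmeas_Im_integrable f :
  bmeas f -> nu.-integrable setT (EFin \o (fun x => complex.Im (f x))).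
Proof.
move=> [[_ f1] [M fM]]; apply: measurable_bounded_integrable => //.
  by rewrite (le_lt_trans (probability_le1 _ _))// ltry.
exists M; split; first by rewrite num_real.
by move=> y My x _; apply: le_trans (norm_Im_le_nc (f x)) (le_trans (fM x) (ltW My)).
Qed.

Hint Resolve bmeas_Re_integrable bmeas_Im_integrable : core.

Lemma cintD f g : bmeas f -> bmeas g ->
  cint (fun x => f x + g x) = cint f + cint g.
Proof.
move=> mf mg; apply: eqC_ReIm; rewrite ?cReD ?cImD /=.
  by under eq_Rintegral do rewrite cReD; rewrite RintegralD//; auto.
by under eq_Rintegral do rewrite cImD; rewrite RintegralD//; auto.
Qed.

Lemma cintZ c f : bmeas f -> cint (fun x => c * f x) = c * cint f.
Proof.
move=> mf; have [iR iI] := (bmeas_Re_integrable mf, bmeas_Im_integrable mf).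
have ZR r : nu.-integrable setT (EFin \o (fun x => r * complex.Re (f x))).
  by have := integrableZl measurableT r iR.
have ZI r : nu.-integrable setT (EFin \o (fun x => r * complex.Im (f x))).
  by have := integrableZl measurableT r iI.
apply: eqC_ReIm; rewrite ?cReM ?cImM /=.
  by under eq_Rintegral do rewrite cReM; rewrite RintegralB// !RintegralZl.
by under eq_Rintegral do rewrite cImM; rewrite RintegralD// !RintegralZl.
Qed.

Lemma cintN f : bmeas f -> cint (fun x => - f x) = - cint f.
Proof.
move=> mf; rewrite -[RHS]mulN1r -cintZ//.
by congr cint; apply/funext => x; rewrite mulN1r.
Qed.

Lemma cintB f g : bmeas f -> bmeas g ->
  cint (fun x => f x - g x) = cint f - cint g.
Proof. by move=> mf mg; rewrite cintD ?cintN//; exact: bmeasN. Qed.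

Lemma cint_sum I (s : seq I) (P : pred I) (F : I -> T -> R[i]) :
  (forall i, bmeas (F i)) ->
  cint (fun x => \sum_(i <- s | P i) F i x) = \sum_(i <- s | P i) cint (F i).
Proof.
move=> mF; elim: s => [|i s ih].
  rewrite big_nil; under [X in cint X]eq_fun do rewrite big_nil.
  by apply: eqC_ReIm => /=; rewrite Rintegral_cst//= mul0r.
rewrite big_cons; under [X in cint X]eq_fun do rewrite big_cons.
case: (P i) => //; rewrite cintD ?ih//; exact: bmeas_sum.
Qed.

Lemma cint_cst c : cint (fun=> c) = c.
Proof.
have n1 : fine (nu setT) = 1 by rewrite probability_setT.
by apply: eqC_ReIm => /=; rewrite Rintegral_cst// n1 mulr1.
Qed.

Lemma cintJ f : bmeas f -> cint (fun x => (f x)^*%C) = (cint f)^*%C.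
Proof.
move=> mf; apply: eqC_ReIm => /=.
  by apply: eq_Rintegral => x _; case: (f x).
rewrite -mulN1r -RintegralZl//; last exact: bmeas_Im_integrable.
by apply: eq_Rintegral => x _; rewrite mulN1r; case: (f x).
Qed.

Lemma nc_cint_le f M : bmeas f -> (forall x, nc (f x) <= M) ->
  nc (cint f) <= 2 * M.
Proof.
have n1 : fine (nu setT) = 1 by rewrite probability_setT.
move=> mf fM; apply: le_trans (nc_le_ReIm _) _.
have H h : nu.-integrable setT (EFin \o h) -> (forall x, `|h x| <= M) ->
    `|\int[nu]_x h x| <= M.
  move=> ih hM; apply: le_trans (le_normr_Rintegral _ ih) _ => //.
  rewrite [leRHS](_ : M = \int[nu]_x (cst M x)); last first.
    by rewrite Rintegral_cst// n1 mulr1.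
  apply: le_Rintegral => //.
    by have := integrable_norm ih.
  exact: (@bmeas_Re_integrable (fun=> M%:C%C) (bmeas_cst _)).
by rewrite mulr_natl mulr2n lerD// H//; auto => x;
  apply: le_trans (fM x); rewrite ?norm_Re_le_nc ?norm_Im_le_nc.
Qed.

Definition sqnorm f : R := \int[nu]_x (nc (f x) ^+ 2).

Lemma cint_mulJ f : bmeas f ->
  cint (fun x => f x * (f x)^*%C) = (sqnorm f)%:C%C.
Proof.
move=> mf; apply: eqC_ReIm => /=.
  by apply: eq_Rintegral => x _; rewrite mulcJ.
transitivity (\int[nu]_x (cst 0 x)); last by rewrite Rintegral_cst// mul0r.
by apply: eq_Rintegral => x _; rewrite mulcJ.
Qed.

Lemma sqnorm_eq0 f : bmeas f -> sqnorm f = 0 -> {ae nu, forall x, f x = 0}.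
Proof.
move=> mf f0.
have m2 := cmeas_nc2 (bmeas_meas mf).
have i2 : nu.-integrable setT (EFin \o (fun x => nc (f x) ^+ 2)).
  have := bmeas_Re_integrable (bmeasM mf (bmeasJ mf)).
  by apply: eq_integrable => // x _ /=; rewrite mulcJ.
have m2E : measurable_fun setT (fun x => (nc (f x) ^+ 2)%:E).
  exact/measurable_EFinP.
have /(ae_eq_integral_abs nu measurableT m2E) :
    (\int[nu]_x `|(nc (f x) ^+ 2)%:E|)%E = 0%E.
  under eq_integral do rewrite gee0_abs ?lee_fin ?sqr_ge0//.
  rewrite -[LHS]fineK; first by congr EFin; exact: f0.
  exact: integrable_fin_num.
apply: filterS => x /(_ Logic.I) [] /eqP.
by rewrite sqrf_eq0 nc_eq0 => /eqP.
Qed.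

End complex_integral.

(** * Double integrals and the kernel identity *)

Section double_integral.
Context {R : realType} {d : measure_display} {T : measurableType d}.
Variable nu : probability T R.
Implicit Types (f g : T -> R[i]) (c : R[i]) (H : T -> T -> R[i]).

(** An iterated integral, each step of which is the [cint] of a bounded
    function and therefore linear; [dint_tonelli] identifies it with an integral
    over the product space when the integrand is nonnegative. *)
Definition dint H (v : R[i]) : Prop :=
  [/\ cmeas (fun p : T * T => H p.1 p.2),
      forall x, bmeas (H x),
      bmeas (fun x => cint nu (H x)) &
      cint nu (fun x => cint nu (H x)) = v].

Lemma dint_mul f g : bmeas f -> bmeas g ->
  dint (fun x y => f x * g y) (cint nu f * cint nu g).
Proof.
move=> mf mg.
have E : (fun x => cint nu (fun y => f x * g y)) =
    (fun x => cint nu g * f x).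
  by apply/funext => x; rewrite cintZ// mulrC.
split.
- have [[f1 f2] _] := mf; have [[g1 g2] _] := mg.
  apply: cmeasM; split.
  + exact: (measurableT_comp f1).
  + exact: (measurableT_comp f2).
  + exact: (measurableT_comp g1).
  + exact: (measurableT_comp g2).
- by move=> x; apply: bmeasM => //; exact: bmeas_cst.
- by rewrite E; apply: bmeasM => //; exact: bmeas_cst.
- by rewrite E cintZ// mulrC.
Qed.

Lemma dintD H1 H2 v1 v2 : dint H1 v1 -> dint H2 v2 ->
  dint (fun x y => H1 x y + H2 x y) (v1 + v2).
Proof.
move=> [m1 b1 c1 e1] [m2 b2 c2 e2].
have E : (fun x => cint nu (fun y => H1 x y + H2 x y)) =
    (fun x => cint nu (H1 x) + cint nu (H2 x)).
  by apply/funext => x; rewrite cintD.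
split.
- exact: cmeasD.
- by move=> x; exact: bmeasD.
- by rewrite E; exact: bmeasD.
- by rewrite E cintD// e1 e2.
Qed.

Lemma dintZ c H v : dint H v -> dint (fun x y => c * H x y) (c * v).
Proof.
move=> [m b c' e].
have E : (fun x => cint nu (fun y => c * H x y)) =
    (fun x => c * cint nu (H x)).
  by apply/funext => x; rewrite cintZ.
split.
- by apply: cmeasM => //; exact: cmeas_cst.
- by move=> x; apply: bmeasM => //; exact: bmeas_cst.
- by rewrite E; apply: bmeasM => //; exact: bmeas_cst.
- by rewrite E cintZ// e.
Qed.

Lemma dint_sum I (s : seq I) (H : I -> T -> T -> R[i]) (v : I -> R[i]) :
  (forall i, dint (H i) (v i)) ->
  dint (fun x y => \sum_(i <- s) H i x y) (\sum_(i <- s) v i).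
Proof.
move=> mH; elim: s => [|i s ih].
  rewrite big_nil [X in dint X](_ : _ = fun x y => 0 * 0); last first.
    by apply/funext => x; apply/funext => y; rewrite big_nil mul0r.
  have := dint_mul (bmeas_cst 0) (bmeas_cst 0).
  by rewrite (cint_cst _ 0) mul0r.
rewrite big_cons [X in dint X](_ : _ =
    fun x y => H i x y + \sum_(j <- s) H j x y); last first.
  by apply/funext => x; apply/funext => y; rewrite big_cons.
exact: dintD.
Qed.

Lemma dint_tonelli H v : dint H v -> (forall x y, 0 <= complex.Re (H x y)) ->
  (\int[nu \x nu]_p (complex.Re (H p.1 p.2))%:E)%E = (complex.Re v)%:E.
Proof.
move=> [[m1 _] b c e] H0.
rewrite fubini_tonelli1//=; first last.
- by move=> p; rewrite lee_fin.
- exact/measurable_EFinP.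
rewrite /fubini_F/= -e /= -[LHS]fineK.
  congr (_%:E); congr fine; apply: eq_integral => x _ /=.
  rewrite fineK//; apply: integrable_fin_num => //.
  exact: (@bmeas_Re_integrable _ _ _ nu (H x)).
rewrite [X in X \is a _](_ : _ =
    \int[nu]_x (complex.Re (cint nu (H x)))%:E)%E; last first.
  apply: eq_integral => x _ /=.
  rewrite fineK//; apply: integrable_fin_num => //.
  exact: (@bmeas_Re_integrable _ _ _ nu (H x)).
apply: integrable_fin_num => //.
exact: (@bmeas_Re_integrable _ _ _ nu (fun x => cint nu (H x))).
Qed.

End double_integral.

(** The algebra behind [kernel_integral], where S is the squared norm of f and
    q m is |c_m|^2: the two sums containing q agree by symmetry. *)
Lemma toeplitz_sum {R : realType} (S : R) (a : nat -> R) (q : int -> R) N :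
  \sum_(j < N) \sum_(l < N) (a j * a l *
    ((j == l)%:R * (2 * S) - q (j%:Z - l%:Z) - q (l%:Z - j%:Z))) =
  2 * (S * \sum_(j < N) a j ^+ 2 -
    \sum_(j < N) \sum_(l < N) a j * a l * q (j%:Z - l%:Z)).
Proof.
under eq_bigr do under eq_bigr do rewrite !mulrBr.
under eq_bigr do rewrite !sumrB.
rewrite !sumrB.
set U := (X in _ = _ * (_ - X)).
have -> : 2 * (S * \sum_(j < N) a j ^+ 2 - U) =
  2 * (S * \sum_(j < N) a j ^+ 2) - U - U by ring.
congr (_ - _ - _); last first.
  rewrite exchange_big; apply: eq_bigr => j _; apply: eq_bigr => l _.
  by rewrite (mulrC (a l)).
rewrite mulrA mulr_sumr; apply: eq_bigr => j _.
rewrite (bigD1 j)//= big1 ?addr0 ?eqxx; first by rewrite mul1r mulrC expr2.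
by move=> l /negbTE; rewrite eq_sym => ->; rewrite mul0r mulr0.
Qed.

Section fourier.
Context {R : realType} {d : measure_display} {T : measurableType d}.
Variables (nu : probability T R) (z : T -> R[i]).
Hypothesis mz : cmeas z.
Hypothesis z1 : forall x, nc (z x) = 1.
(* The law of z has the moments of the normalised arc length. *)
Hypothesis cint_expz : forall n : nat, cint nu (fun x => z x ^+ n.+1) = 0.
Implicit Types (f g : T -> R[i]) (c : R[i]) (k : int).

Definition fcoef f k := cint nu (fun x => f x * z x ^ (- k)).

#[local] Arguments fcoef : simpl never.

(** For functions of z, this is the squared seminorm of H^(1/2) of the circle,
    normalised so that it equals \sum_k |k| |c_k|^2. *)
Definition energy f := (\int[nu \x nu]_p
  (nc (f p.1 - f p.2) ^+ 2 / nc (z p.1 - z p.2) ^+ 2)%:E)%E.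

Let zn0 x : z x != 0. Proof. exact: unimod_neq0. Qed.

Lemma bmeas_zexp k : bmeas (fun x => z x ^ k).
Proof. exact: bmeas_expz. Qed.
Hint Resolve bmeas_zexp : core.

Lemma cint_zexp k : cint nu (fun x => z x ^ k) = (k == 0)%:R.
Proof.
case: k => [[|n]|n].
- by rewrite -[RHS](cint_cst nu).
- exact: cint_expz.
- rewrite (_ : (fun x => _) = (fun x => (z x ^+ n.+1)^*%C)).
    rewrite cintJ; last by apply: bmeasX; exact: bmeas_unimod.
    by rewrite cint_expz conjc0.
  by apply/funext => x; rewrite (unimod_expzJ n.+1 (z1 x)).
Qed.

Lemma fcoefD f g k : bmeas f -> bmeas g ->
  fcoef (fun x => f x + g x) k = fcoef f k + fcoef g k.
Proof.
move=> mf mg; rewrite /fcoef -cintD; try exact: bmeasM.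
by congr cint; apply/funext => x; rewrite mulrDl.
Qed.

Lemma fcoefB f g k : bmeas f -> bmeas g ->
  fcoef (fun x => f x - g x) k = fcoef f k - fcoef g k.
Proof.
move=> mf mg; rewrite /fcoef -cintB; try exact: bmeasM.
by congr cint; apply/funext => x; rewrite mulrBl.
Qed.

Lemma fcoefZ c f k : bmeas f -> fcoef (fun x => c * f x) k = c * fcoef f k.
Proof.
move=> mf; rewrite /fcoef -cintZ; last exact: bmeasM.
by congr cint; apply/funext => x; rewrite mulrA.
Qed.

Lemma fcoef_cst c k : fcoef (fun=> c) k = c * (k == 0)%:R.
Proof. by rewrite /fcoef cintZ// cint_zexp oppr_eq0. Qed.

Lemma fcoef_zmul f n k : fcoef (fun x => z x ^ n * f x) k = fcoef f (k - n).
Proof.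
congr cint; apply/funext => x.
by rewrite mulrAC -expfzDr// opprB mulrC.
Qed.

Lemma fcoefJ f k : bmeas f -> fcoef (fun x => (f x)^*%C) k = (fcoef f (- k))^*%C.
Proof.
move=> mf; rewrite /fcoef -cintJ; last exact: bmeasM.
congr cint; apply/funext => x.
by rewrite rmorphM/= opprK unimod_expzJ.
Qed.

Lemma nc_fcoef_le f M k : bmeas f -> (forall x, nc (f x) <= M) ->
  nc (fcoef f k) <= 2 * M.
Proof.
move=> mf fM; apply: nc_cint_le; first exact: bmeasM.
by move=> x; rewrite ncM unimod_expz// mulr1.
Qed.

(** Expanding the square of the sum gives terms
    a_j a_l (z x / z y)^m |f x - f y|^2 with m := j - l.  In
    |f x - f y|^2 = |f x|^2 + |f y|^2 - f x (f y)^* - (f x)^* f y, the squares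
    contribute 2 |f|^2 if m = 0 and nothing otherwise, and the cross terms
    contribute - |c_(- m)|^2 - |c_m|^2. *)
Lemma kernel_integral (a : nat -> R) N f : bmeas f ->
  (\int[nu \x nu]_p
    (nc (\sum_(j < N) (a j)%:C%C * (z p.1 / z p.2) ^+ j) ^+ 2
     * nc (f p.1 - f p.2) ^+ 2)%:E)%E =
  (2 * (sqnorm nu f * \sum_(j < N) a j ^+ 2
    - \sum_(j < N) \sum_(l < N) a j * a l * nc (fcoef f (j%:Z - l%:Z)) ^+ 2))%:E.
Proof.
move=> mf; have mfJ := bmeasJ mf.
(* H1 m is the term of frequency m, and v1 m its integral. *)
pose H1 (m : int) x y := z x ^ m * z y ^ (- m) *
  ((f x - f y) * (f x - f y)^*%C).
pose v1 (m : int) : R[i] := (m == 0)%:R * (2 * (sqnorm nu f)%:C%C)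
  - (nc (fcoef f m) ^+ 2 + nc (fcoef f (- m)) ^+ 2)%:C%C.
have d1 m : dint nu (H1 m) (v1 m).
  have -> : H1 m = fun x y =>
      (z x ^ m * (f x * (f x)^*%C)) * z y ^ (- m) +
      z x ^ m * (z y ^ (- m) * (f y * (f y)^*%C)) +
      (-1) * ((f x * z x ^ m) * ((f y)^*%C * z y ^ (- m))) +
      (-1) * (((f x)^*%C * z x ^ m) * (f y * z y ^ (- m))).
    by apply/funext => x; apply/funext => y; rewrite /H1 rmorphB/=; ring.
  have mff : bmeas (fun x => f x * (f x)^*%C) by exact: bmeasM.
  have mzff k : bmeas (fun x => z x ^ k * (f x * (f x)^*%C)) by exact: bmeasM.
  have A : dint nu (fun x y => (z x ^ m * (f x * (f x)^*%C)) * z y ^ (- m))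
      ((m == 0)%:R * (sqnorm nu f)%:C%C).
    have := dint_mul nu (mzff m) (bmeas_zexp (- m)).
    rewrite cint_zexp oppr_eq0 mulrC; case: eqVneq => [->|_].
      rewrite !mul1r [X in dint _ _ (cint _ X) -> _](_ : _ =
         fun x => f x * (f x)^*%C); last first.
        by apply/funext => x; rewrite expr0z mul1r.
      by rewrite cint_mulJ.
    by rewrite !mul0r.
  have B : dint nu (fun x y => z x ^ m * (z y ^ (- m) * (f y * (f y)^*%C)))
      ((m == 0)%:R * (sqnorm nu f)%:C%C).
    have := dint_mul nu (bmeas_zexp m) (mzff (- m)).
    rewrite cint_zexp; case: eqVneq => [->|_].
      rewrite !mul1r [X in dint _ _ (cint _ X) -> _](_ : _ =
         fun x => f x * (f x)^*%C); last first.
        by apply/funext => x; rewrite expr0z mul1r.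
      by rewrite cint_mulJ.
    by rewrite !mul0r.
  have C : dint nu (fun x y => (f x * z x ^ m) * ((f y)^*%C * z y ^ (- m)))
      (nc (fcoef f (- m)) ^+ 2)%:C%C.
    rewrite (_ : (_)%:C%C = fcoef f (- m) * fcoef (fun x => (f x)^*%C) m).
      rewrite {1}/fcoef opprK.
      by apply: dint_mul; apply: bmeasM.
    by rewrite fcoefJ// mulcJ.
  have D : dint nu (fun x y => ((f x)^*%C * z x ^ m) * (f y * z y ^ (- m)))
      (nc (fcoef f m) ^+ 2)%:C%C.
    rewrite (_ : (_)%:C%C = fcoef (fun x => (f x)^*%C) (- m) * fcoef f m).
      rewrite {1}/fcoef opprK.
      by apply: dint_mul; apply: bmeasM.
    by rewrite fcoefJ// opprK mulrC mulcJ.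
  have := dintD (dintD (dintD A B) (dintZ (-1) C)) (dintZ (-1) D).
  set v := (X in dint _ _ X -> _); suff -> : v = v1 m by [].
  by rewrite /v /v1 rmorphD/=; ring.
pose H x y := \sum_(j < N) \sum_(l < N)
  (a j * a l)%:C%C * H1 (j%:Z - l%:Z) x y.
have dH : dint nu H (\sum_(j < N) \sum_(l < N)
    (a j * a l)%:C%C * v1 (j%:Z - l%:Z)).
  apply: dint_sum => j; apply: dint_sum => l; exact: dintZ.
have HE x y : H x y =
    (nc (\sum_(j < N) (a j)%:C%C * (z x / z y) ^+ j) ^+ 2
     * nc (f x - f y) ^+ 2)%:C%C.
  rewrite rmorphM/= -2!mulcJ conj_sum mulr_suml mulr_suml.
  apply: eq_bigr => j _; rewrite mulr_sumr mulr_suml; apply: eq_bigr => l _.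
  have -> : ((a l)%:C%C * (z x / z y) ^+ l)^*%C =
      (a l)%:C%C * (z x ^ (- l%:Z) * z y ^ l%:Z).
    rewrite conjM conjc_real exprMn exprVn conjM conjc_inv.
    rewrite (unimod_expzJ l%:Z (z1 x)) (unimod_expzJ l%:Z (z1 y)).
    by rewrite invr_expz opprK.
  have -> : (a j * a l)%:C%C = (a j)%:C%C * (a l)%:C%C by rewrite rmorphM.
  rewrite /H1 exprMn exprVn opprB !expfzDr// -exprnP.
  rewrite -[(z y ^+ j)^-1]/((z y ^ j%:Z)^-1) invr_expz; ring.
have H0 x y : 0 <= complex.Re (H x y).
  by rewrite HE /= mulr_ge0// sqr_ge0.
have := dint_tonelli dH H0.
under eq_integral do rewrite HE/=.
move=> ->; congr (_%:E).
rewrite cRe_sum.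
have -> : \sum_(j < N) complex.Re (\sum_(l < N)
      (a j * a l)%:C%C * v1 (j%:Z - l%:Z)) =
    \sum_(j < N) \sum_(l < N) (a j * a l *
      ((j == l)%:R * (2 * sqnorm nu f)
       - nc (fcoef f (j%:Z - l%:Z)) ^+ 2 - nc (fcoef f (l%:Z - j%:Z)) ^+ 2)).
  apply: eq_bigr => j _; rewrite cRe_sum; apply: eq_bigr => l _.
  rewrite /v1 subr_eq0 eqz_nat opprB -(inj_eq val_inj)/=.
  by case: eqP => _ /=; rewrite ?expr0n/=; ring.
exact: (toeplitz_sum _ _ (fun m => nc (fcoef f m) ^+ 2)).
Qed.

End fourier.

Arguments fcoef : simpl never.

(** * Lower bounds for the energy *)

Lemma measurable_inv_fun {R : realType} {d : measure_display}
  {T : measurableType d} (f : T -> R) :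
  measurable_fun setT f -> measurable_fun setT (fun x => (f x)^-1).
Proof.
move=> mf.
(* The power of exponent -1 is the inverse at nonnegative arguments only. *)
have -> : (fun x => (f x)^-1) = (fun x => f x * (f x ^+ 2) `^ (-1)).
  apply/funext => x; rewrite powR_inv1 ?sqr_ge0//.
  have [->|fx0] := eqVneq (f x) 0; first by rewrite invr0 mul0r.
  by rewrite expr2 invfM mulrA mulfV// mul1r.
apply: measurable_funM => //.
apply: (measurableT_comp (measurable_powR (-1 : R))).
exact: measurable_funX.
Qed.

(** The indices range from - N to N - 1, since [Negz k] is - k - 1. *)
Definition bisum {R : realType} (h : int -> R) N :=
  \sum_(k < N) h k%:Z + \sum_(k < N) h (Negz k).

Lemma bisum_mono {R : realType} (h : int -> R) n N :
  (forall k, 0 <= h k) -> (n <= N)%N -> bisum h n <= bisum h N.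
Proof.
move=> h0 nN; rewrite /bisum lerD//.
  rewrite -!(big_mkord xpredT (fun k => h k%:Z)) (big_cat_nat (leq0n n) nN)//= lerDl.
  by rewrite sumr_ge0.
rewrite -!(big_mkord xpredT (fun k => h (Negz k))) (big_cat_nat (leq0n n) nN)//= lerDl.
by rewrite sumr_ge0.
Qed.

(** The first row and the first column of the double sum contain each index of
    [bisum h N.+1] at most once, and the remaining terms are r times those of
    the sum of size N. *)
Lemma toeplitz_sum_le {R : realType} (r : R) (h : int -> R) N : 0 <= r ->
  (forall k, 0 <= h k) ->
  \sum_(j < N) \sum_(l < N) r ^+ (minn j l) * h (j%:Z - l%:Z) <=
  (\sum_(j < N) r ^+ j) * bisum h N.
Proof.
move=> r0 h0; elim: N => [|N ih]; first by rewrite !big_ord0 mul0r.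
rewrite big_ord_recl/=.
under [X in _ + X]eq_bigr do rewrite big_ord_recl/=.
rewrite big_split/= addrA.
have -> : \sum_(l < N.+1) r ^+ minn 0 l * h (0%:Z - l%:Z) +
    \sum_(j < N) r ^+ minn (bump 0 j) 0 * h ((bump 0 j)%:Z - 0%:Z) =
    \sum_(k < N.+1) h k%:Z + \sum_(k < N) h (Negz k).
  rewrite big_ord_recl/= minn0 expr0 mul1r subr0 addrAC big_ord_recl/=.
  congr (_ + _ + _); apply: eq_bigr => i _.
    by rewrite mul1r subr0.
  by rewrite ?min0n ?expr0 mul1r sub0r.
have -> : \sum_(j < N) \sum_(l < N) r ^+ minn (bump 0 j) (bump 0 l) *
      h ((bump 0 j)%:Z - (bump 0 l)%:Z) =
    r * \sum_(j < N) \sum_(l < N) r ^+ (minn j l) * h (j%:Z - l%:Z).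
  rewrite mulr_sumr; apply: eq_bigr => j _; rewrite mulr_sumr.
  apply: eq_bigr => l _; rewrite mulrA -exprS /bump !leq0n !add1n minnSS.
  by congr (_ * h _); lia.
rewrite [in leRHS]big_ord_recl/= mulrDl mul1r lerD//.
  by rewrite /bisum lerD// big_ord_recr/= lerDl.
have -> : \sum_(i < N) r ^+ bump 0 i = r * \sum_(i < N) r ^+ i.
  by rewrite mulr_sumr; apply: eq_bigr => i _; rewrite exprS.
rewrite -mulrA ler_wpM2l// (le_trans ih)// ler_wpM2l//.
  by rewrite sumr_ge0// => i _; rewrite exprn_ge0.
exact: bisum_mono.
Qed.

Section energy_bounds.
Context {R : realType} {d : measure_display} {T : measurableType d}.
Variables (nu : probability T R) (z : T -> R[i]).
Hypothesis mz : cmeas z.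
Hypothesis z1 : forall x, nc (z x) = 1.
Hypothesis zinj : injective z.
Hypothesis cint_expz : forall n : nat, cint nu (fun x => z x ^+ n.+1) = 0.
Implicit Types (f g : T -> R[i]) (c : R[i]) (k : int).

Local Notation fcoef := (fcoef nu z).
Local Notation energy := (energy nu z).
Local Notation sqn f k := (nc (fcoef f k) ^+ 2).

Lemma cmeas_diff f : cmeas f -> cmeas (fun p : T * T => f p.1 - f p.2).
Proof.
move=> [f1 f2]; apply: cmeasB; split.
- exact: (measurableT_comp f1).
- exact: (measurableT_comp f2).
- exact: (measurableT_comp f1).
- exact: (measurableT_comp f2).
Qed.

Lemma measurable_energy f : cmeas f -> measurable_fun setT (fun p : T * T =>
  (nc (f p.1 - f p.2) ^+ 2 / nc (z p.1 - z p.2) ^+ 2)%:E).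
Proof.
move=> mf; apply/measurable_EFinP; apply: measurable_funM.
  exact: (cmeas_nc2 (cmeas_diff mf)).
by apply: measurable_inv_fun; exact: (cmeas_nc2 (cmeas_diff mz)).
Qed.

Lemma energy_ge0 f : (0 <= energy f)%E.
Proof.
by apply: integral_ge0 => p _; rewrite lee_fin divr_ge0// sqr_ge0.
Qed.

(** At zeta = z x / z y one has |zeta - 1| = |z x - z y|, so that the kernel of
    [kernel_integral] is at most C / |z x - z y|^2. *)
Lemma kernel_energy_le (a : nat -> R) N (C : R) f : bmeas f ->
  (energy f < +oo)%E -> 0 <= C ->
  (forall zeta : R[i], nc zeta = 1 ->
    nc (\sum_(j < N) (a j)%:C%C * zeta ^+ j) ^+ 2 * nc (zeta - 1) ^+ 2 <= C) ->
  2 * (sqnorm nu f * \sum_(j < N) a j ^+ 2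
    - \sum_(j < N) \sum_(l < N) a j * a l * sqn f (j%:Z - l%:Z)) <=
  C * fine (energy f).
Proof.
move=> mf Ef C0 aC.
rewrite -lee_fin [leRHS]EFinM fineK; last by rewrite ge0_fin_numE// energy_ge0.
rewrite -(kernel_integral mz z1 cint_expz a N mf).
rewrite -ge0_integralZl//=.
- apply: ge0_le_integral => //=.
  + by move=> p _; rewrite lee_fin mulr_ge0// sqr_ge0.
  + have mzq : cmeas (fun p : T * T => z p.1 / z p.2).
      rewrite (_ : (fun _ => _) = (fun p => z p.1 * (z p.2)^*%C)).
        have [h1 h2] := mz.
        apply: cmeasM; [|apply: cmeasJ]; split.
        * exact: (measurableT_comp h1).
        * exact: (measurableT_comp h2).
        * exact: (measurableT_comp h1).
        * exact: (measurableT_comp h2).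
      by apply/funext => p; rewrite unimodV.
    apply/measurable_EFinP; apply: measurable_funM.
      apply: cmeas_nc2; apply: bmeas_meas; apply: bmeas_sum => j.
      apply: bmeasM; first exact: bmeas_cst.
      apply: bmeasX; apply: bmeas_unimod => // p.
      by rewrite ncM ncV !z1 invr1 mulr1.
    by apply: cmeas_nc2; apply: cmeas_diff; exact: bmeas_meas.
  + apply: measurable_funeM => /=; exact: (measurable_energy (bmeas_meas mf)).
  + move=> [x y] _ /=; rewrite -EFinM lee_fin.
    have [->|xy] := eqVneq x y.
      by rewrite !subrr Normc.normc0 expr0n/= !mul0r !mulr0.
    have zxy : 0 < nc (z x - z y) ^+ 2.
      rewrite exprn_gt0// nc_gt0 subr_eq0; apply: contra xy.
      by move=> /eqP/zinj ->.
    have zq : nc (z x / z y - 1) = nc (z x - z y).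
      have y0 := unimod_neq0 (z1 y).
      have -> : z x / z y - 1 = (z x - z y) / z y by rewrite mulrBl mulfV.
      by rewrite ncM ncV z1 invr1 mulr1.
    rewrite [leRHS]mulrA ler_pdivlMr// mulrAC ler_wpM2r ?sqr_ge0//.
    by rewrite -zq; apply: aC; rewrite ncM ncV !z1 invr1 mulr1.
- exact: (measurable_energy (bmeas_meas mf)).
- by move=> p _; rewrite lee_fin divr_ge0// sqr_ge0.
Qed.

(** The residual h of f is orthogonal to the z^k with k in s, so that its
    squared norm is the difference of the two sides. *)
Lemma bessel (s : seq int) f : bmeas f -> uniq s ->
  \sum_(k <- s) sqn f k <= sqnorm nu f.
Proof.
move=> mf us.
have mzk k : bmeas (fun x => z x ^ k) by exact: bmeas_zexp.
have mck k : bmeas (fun x => fcoef f k * z x ^ k).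
  by apply: bmeasM => //; exact: bmeas_cst.
pose h x := f x - \sum_(k <- s) fcoef f k * z x ^ k.
have mh : bmeas h by apply: bmeasB => //; exact: bmeas_sum.
have h0 k : k \in s -> fcoef h k = 0.
  move=> ks; rewrite fcoefB//; last exact: bmeas_sum.
  rewrite {2}/fcoef; under [X in cint _ X]eq_fun do rewrite mulr_suml.
  rewrite cint_sum; last by move=> j; exact: bmeasM.
  rewrite (bigD1_seq k)//= big1 ?addr0 => [|j jk].
    under [X in cint _ X]eq_fun do
      rewrite -mulrA -expfzDr ?unimod_neq0// subrr expr0z mulr1.
    by rewrite cint_cst subrr.
  under [X in cint _ X]eq_fun do rewrite -mulrA -expfzDr ?unimod_neq0//.
  by rewrite cintZ// cint_zexp// subr_eq0 (negbTE jk) mulr0.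
suff : (sqnorm nu h)%:C%C = (sqnorm nu f - \sum_(k <- s) sqn f k)%:C%C.
  move=> [] E; rewrite -subr_ge0 -E.
  by apply: Rintegral_ge0 => x _; exact: sqr_ge0.
rewrite -cint_mulJ//.
transitivity (cint nu (fun x => h x * (f x)^*%C) -
    \sum_(k <- s) (fcoef f k)^*%C * fcoef h k).
  rewrite [X in _ - X](_ : _ = cint nu (fun x =>
      \sum_(k <- s) (fcoef f k)^*%C * (h x * z x ^ (- k)))); last first.
    rewrite cint_sum.
      apply: eq_bigr => k _; rewrite cintZ//; exact: bmeasM.
    by move=> k; apply: bmeasM; [exact: bmeas_cst|exact: bmeasM].
  rewrite -cintB.
  - congr cint; apply/funext => x.
    rewrite {2}/h conjB mulrBr conj_sum; congr (_ - _).
    rewrite mulr_sumr; apply: eq_bigr => k _.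
    by rewrite conjM unimod_expzJ// mulrCA.
  - by apply: bmeasM => //; exact: bmeasJ.
  - apply: bmeas_sum => k.
    by apply: bmeasM; [exact: bmeas_cst|exact: bmeasM].
rewrite [X in _ - X]big_seq_cond big1; last first.
  by move=> k /andP[ks _]; rewrite h0// mulr0.
rewrite subr0 (_ : (_ - _)%:C%C =
    (sqnorm nu f)%:C%C - \sum_(k <- s) (sqn f k)%:C%C); last first.
  by rewrite rmorphB rmorph_sum.
rewrite -cint_mulJ//.
under [X in cint _ X]eq_fun do rewrite /h mulrBl mulr_suml.
rewrite cintB.
- congr (_ - _); rewrite cint_sum; last first.
    by move=> k; apply: bmeasM => //; exact: bmeasJ.
  apply: eq_bigr => k _; rewrite -mulcJ.
  under [X in cint _ X]eq_fun do rewrite -mulrA.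
  rewrite cintZ; last by apply: bmeasM => //; exact: bmeasJ.
  congr (_ * _); rewrite -cintJ; last exact: bmeasM.
  congr cint; apply/funext => x.
  by rewrite conjM unimod_expzJ// opprK mulrC.
- by apply: bmeasM => //; exact: bmeasJ.
- by apply: bmeas_sum => k; apply: bmeasM => //; exact: bmeasJ.
Qed.

Lemma bessel_bisum f N : bmeas f ->
  bisum (fun k => sqn f k) N <= sqnorm nu f.
Proof.
move=> mf.
have := @bessel ([seq i%:Z | i <- index_iota 0 N] ++ [seq Negz i | i <- index_iota 0 N])
  f mf.
rewrite big_cat/= !big_map !big_mkord; apply.
rewrite cat_uniq !map_inj_uniq ?iota_uniq/= ?andbT.
- by apply/hasPn => k /mapP[i _ ->]; apply/mapP => -[].
- by move=> i j [].
- by move=> i j [].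
Qed.

(** The case a_j = 1: the sum of the zeta^j times zeta - 1 is zeta^N - 1, whose
    modulus is at most 2. *)
Lemma toeplitz_energy_le f N : bmeas f -> (energy f < +oo)%E ->
  N%:R * sqnorm nu f - \sum_(j < N) \sum_(l < N) sqn f (j%:Z - l%:Z) <=
  2 * fine (energy f).
Proof.
move=> mf Ef; have := @kernel_energy_le (fun=> 1) N 4 f mf Ef.
have -> : \sum_(j < N) (1 : R) ^+ 2 = N%:R.
  by under eq_bigr do rewrite expr1n; rewrite sumr_const card_ord.
have -> : \sum_(j < N) \sum_(l < N) 1 * 1 * sqn f (j%:Z - l%:Z) =
    \sum_(j < N) \sum_(l < N) sqn f (j%:Z - l%:Z).
  by apply: eq_bigr => j _; apply: eq_bigr => l _; rewrite !mul1r.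
move=> H; rewrite -(ler_pM2l (ltr0Sn R 1)) mulrA -natrM (mulrC N%:R) H//.
move=> zeta zeta1; rewrite -exprMn -ncM.
under eq_bigr do rewrite mul1r.
rewrite mulrC -subrX1.
rewrite (_ : 4 = 2 ^+ 2) ?ler_pXn2r ?nnegrE ?nc_ge0// -?natrX//.
by rewrite (le_trans (ncB _ _))// ncX zeta1 expr1n Normc.normc1.
Qed.

(** Each diagonal of the sum in [toeplitz_energy_le] has at most N terms.
    Together with [bessel] this is Parseval's identity for functions of finite
    energy, without any density argument. *)
Lemma parseval_le f N : bmeas f -> (energy f < +oo)%E -> (0 < N)%N ->
  sqnorm nu f - bisum (fun k => sqn f k) N <= 2 * fine (energy f) / N%:R.
Proof.
move=> mf Ef N0; rewrite ler_pdivlMr ?ltr0n//.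
apply: le_trans (toeplitz_energy_le N mf Ef).
rewrite mulrBl mulrC lerB//.
have := @toeplitz_sum_le R 1 (fun k => sqn f k) N ler01 (fun k => sqr_ge0 _).
under eq_bigr do under eq_bigr do rewrite expr1n mul1r.
move=> /le_trans; apply; rewrite mulrC.
by under eq_bigr do rewrite expr1n; rewrite sumr_const card_ord.
Qed.

(** The case a_j = r^j: since r |zeta - 1|^2 <= |1 - r zeta|^2, the geometric
    sum is controlled with C = (1 + r^N)^2 / r, which loses nothing in the limit
    where N tends to infinity and r to 1. *)
Lemma poisson_energy_le f N r : bmeas f -> (energy f < +oo)%E ->
  0 < r < 1 ->
  (1 - r ^+ 2 ^+ N) * bisum (fun k => (1 - r ^+ `|k|) * sqn f k) N <=
  (1 - r ^+ 2) * ((1 + r ^+ N) ^+ 2 * fine (energy f) / (2 * r)).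
Proof.
move=> mf Ef /andP[r0 r1].
have r20 : 0 < 1 - r ^+ 2 by rewrite subr_gt0 expr_lt1// ltW.
pose A := \sum_(j < N) (r ^+ 2) ^+ j.
have A0 : 0 <= A by rewrite sumr_ge0// => i _; rewrite exprn_ge0 ?sqr_ge0.
have AE : (1 - r ^+ 2) * A = 1 - r ^+ 2 ^+ N.
  by rewrite -[1 - r ^+ 2]opprB mulNr -subrX1 opprB.
rewrite -AE -mulrA ler_pM2l// ler_pdivlMr ?mulr_gt0//.
have rN0 : 0 <= (1 + r ^+ N) ^+ 2 / r by rewrite divr_ge0 ?sqr_ge0// ltW.
have := @kernel_energy_le (fun j => r ^+ j) N _ f mf Ef rN0.
have -> : \sum_(j < N) (r ^+ j) ^+ 2 = A.
  by apply: eq_bigr => j _; rewrite -!exprM mulnC.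
move=> H; have {H} := H _.
have -> : \sum_(j < N) \sum_(l < N) r ^+ j * r ^+ l * sqn f (j%:Z - l%:Z) =
    \sum_(j < N) \sum_(l < N) (r ^+ 2) ^+ minn j l *
      (r ^+ `|j%:Z - l%:Z| * sqn f (j%:Z - l%:Z)).
  apply: eq_bigr => j _; apply: eq_bigr => l _; rewrite mulrA; congr (_ * _).
  by rewrite -exprM -!exprD; congr (r ^+ _); lia.
have := @toeplitz_sum_le R (r ^+ 2) (fun k => r ^+ `|k| * sqn f k) N
  (sqr_ge0 _).
move=> H; have {H} := H _; set S := \sum_(j < N) _ => H1 H2.
have {}H1 : S <= A * bisum (fun k => r ^+ `|k| * sqn f k) N.
  by apply: H1 => k; rewrite mulr_ge0 ?sqr_ge0// exprn_ge0// ltW.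
have {}H2 : 2 * (sqnorm nu f * A - S) <= (1 + r ^+ N) ^+ 2 / r * fine (energy f).
  apply: H2 => zeta zeta1; rewrite ler_pdivlMr//.
  set G := \sum_(j < N) _.
  have G1 : G * (1 - r%:C%C * zeta) = 1 - (r%:C%C * zeta) ^+ N.
    rewrite -opprB mulrN mulrC (_ : G = \sum_(j < N) (r%:C%C * zeta) ^+ j).
      by rewrite -subrX1 opprB.
    by apply: eq_bigr => j _; rewrite exprMn rmorphXn.
  have le1 : r * nc (zeta - 1) ^+ 2 <= nc (1 - r%:C%C * zeta) ^+ 2.
    have := nc_sq zeta; rewrite zeta1 expr1n !nc_sq.
    case: zeta {zeta1 G G1} => a b /= E.
    have Eb : b ^+ 2 = 1 - a ^+ 2 by rewrite E; ring.
    rewrite -subr_ge0 (_ : _ - _ = (1 - r) ^+ 2) ?sqr_ge0//.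
    by ring: Eb.
  rewrite -mulrA (mulrC _ r); apply: le_trans (_ : nc G ^+ 2 *
      nc (1 - r%:C%C * zeta) ^+ 2 <= _).
    by rewrite ler_wpM2l// sqr_ge0.
  rewrite -exprMn -ncM G1 ler_pXn2r ?nnegrE ?nc_ge0//; last first.
    by rewrite addr_ge0// exprn_ge0// ltW.
  rewrite (le_trans (ncB _ _))// Normc.normc1 lerD2l.
  by rewrite ncX ncM nc_real zeta1 mulr1 ger0_norm// ltW.
have HB := bessel_bisum N mf.
have -> : bisum (fun k => (1 - r ^+ `|k|) * sqn f k) N =
    bisum (fun k => sqn f k) N - bisum (fun k => r ^+ `|k| * sqn f k) N.
  rewrite /bisum opprD addrACA -!sumrB.
  by congr (_ + _); apply: eq_bigr => k _; rewrite mulrBl mul1r.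
move: H2; rewrite mulrAC ler_pdivlMr//; apply: le_trans.
rewrite mulrCA mulrA ler_pM2r// ler_pM2l//.
rewrite mulrBr lerB// mulrC; last first.
by rewrite ler_wpM2r.
Qed.

(** In [poisson_energy_le], N tends to infinity, and then r tends to 1 after a
    division by 1 - r. *)
Lemma bisum_energy_le f n : bmeas f -> (energy f < +oo)%E ->
  bisum (fun k => `|k|%:R * sqn f k) n <= fine (energy f).
Proof.
move=> mf Ef; set e := fine _.
have e0 : 0 <= e by rewrite fine_ge0// energy_ge0.
have P1 r : 0 < r < 1 ->
    bisum (fun k => (1 - r ^+ `|k|) * sqn f k) n <=
    (1 - r ^+ 2) * (e / (2 * r)).
  move=> r01; have /andP[r0 r1] := r01.
  have r20 : 0 < 1 - r ^+ 2 by rewrite subr_gt0 expr_lt1// ltW.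
  have cN : r ^+ N @[N --> \oo] --> 0.
    by apply: cvg_expr; rewrite ger0_norm// ltW.
  have c2N : r ^+ 2 ^+ N @[N --> \oo] --> 0.
    by apply: cvg_expr; rewrite ger0_norm ?sqr_ge0// expr_lt1// ltW.
  set B := bisum _ _.
  have L : (1 - r ^+ 2 ^+ N) * B @[N --> \oo] --> (1 - 0) * B.
    by apply: cvgM; [apply: cvgB; [exact: cvg_cst|]|exact: cvg_cst].
  have L' : (1 - r ^+ 2) * ((1 + r ^+ N) ^+ 2 * e / (2 * r)) @[N --> \oo] -->
      (1 - r ^+ 2) * ((1 + 0) ^+ 2 * e / (2 * r)).
    apply: cvgM; first exact: cvg_cst.
    apply: cvgM; last exact: cvg_cst.
    apply: cvgM; last exact: cvg_cst.
    by under eq_fun do rewrite expr2; apply: cvgM;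
      apply: cvgD => //; exact: cvg_cst.
  have := ler_cvg_to L L'.
  rewrite subr0 mul1r addr0 expr1n mul1r; apply.
  near=> N.
  have nN : (n <= N)%N by near: N; exact: nbhs_infty_ge.
  apply: le_trans (poisson_energy_le N mf Ef r01).
  rewrite ler_wpM2l//.
    by rewrite subr_ge0 exprn_ile1 ?sqr_ge0// expr_le1// ltW.
  apply: bisum_mono => // k; rewrite mulr_ge0 ?sqr_ge0// subr_ge0.
  by rewrite exprn_ile1// ltW.
(* Division by 1 - r, as (1 - r) r^n m <= 1 - r^m for m <= n. *)
have P2 r : 0 < r < 1 ->
    2 * r ^+ n.+1 * bisum (fun k => `|k|%:R * sqn f k) n <= (1 + r) * e.
  move=> r01; have /andP[r0 r1] := r01.
  set S := bisum _ _.
  have pw m : (m <= n)%N -> (1 - r) * r ^+ n * m%:R <= 1 - r ^+ m.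
    move=> mn; rewrite -[leRHS]opprB subrX1 -mulNr opprB -mulrA ler_pM2l ?subr_gt0//.
    rewrite mulr_natr -[X in _ *+ X]card_ord -sumr_const ler_sum// => i _.
    by apply: ler_wiXn2l; [exact: ltW|exact: ltW|exact: leq_trans (ltnW (ltn_ord i)) mn].
  have : (1 - r) * r ^+ n * S <= (1 - r ^+ 2) * (e / (2 * r)).
    apply: le_trans (P1 r r01); rewrite /S /bisum mulrDr !mulr_sumr lerD//.
      apply: ler_sum => k _; rewrite mulrA ler_wpM2r ?sqr_ge0//.
      exact: (pw k (ltnW (ltn_ord k))).
    apply: ler_sum => k _; rewrite mulrA ler_wpM2r ?sqr_ge0//.
    exact: (pw k.+1 (ltn_ord k)).
  rewrite (_ : 1 - r ^+ 2 = (1 - r) * (1 + r)); last by ring.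
  rewrite -!mulrA ler_pM2l ?subr_gt0// [leRHS]mulrA ler_pdivlMr ?mulr_gt0//.
  by apply: le_trans; rewrite exprS; nra.
set S := bisum _ _ in P2 *.
pose r (j : nat) : R := 1 - j.+2%:R^-1.
have r1 : r j @[j --> \oo] --> (1 : R).
  rewrite -[X in _ --> X]subr0; apply: cvgB; first exact: cvg_cst.
  have := @cvg_harmonic R; rewrite -cvg_shiftS; exact.
have L : 2 * r j ^+ n.+1 * S @[j --> \oo] --> 2 * 1 ^+ n.+1 * S.
  apply: cvgM; last exact: cvg_cst.
  apply: cvgM; first exact: cvg_cst.
  exact: (continuous_cvg _ (@exprn_continuous R n.+1 1)).
have L' : (1 + r j) * e @[j --> \oo] --> (1 + 1) * e.
  by apply: cvgM; [apply: cvgD => //; exact: cvg_cst|exact: cvg_cst].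
have : 2 * 1 ^+ n.+1 * S <= (1 + 1) * e.
  apply: (ler_cvg_to L L'); near=> j; apply: P2.
  rewrite subr_gt0 invf_lt1 ?ltr1n ?ltr0n//=.
  by rewrite ltrBlDr ltrDl invr_gt0 ltr0n.
by rewrite expr1n mulr1 -natr1 ler_pM2l.
Unshelve. all: by end_near. Qed.

End energy_bounds.

(** * Limits of complex sequences *)

Section complex_limits.
Context {R : realType}.
Implicit Types (s t : nat -> R[i]) (l c : R[i]).

Definition ccvg s l :=
  complex.Re (s n) @[n --> \oo] --> complex.Re l /\
  complex.Im (s n) @[n --> \oo] --> complex.Im l.

Lemma ccvg_cst c : ccvg (fun=> c) c.
Proof. by split; exact: cvg_cst. Qed.

Lemma ccvg_ext s t l : s =1 t -> ccvg s l -> ccvg t l.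
Proof. by move=> /funext ->. Qed.

Lemma ccvgD s t l m : ccvg s l -> ccvg t m -> ccvg (fun n => s n + t n) (l + m).
Proof.
move=> [s1 s2] [t1 t2]; split.
  by under eq_fun do rewrite cReD; rewrite cReD; exact: cvgD.
by under eq_fun do rewrite cImD; rewrite cImD; exact: cvgD.
Qed.

Lemma ccvgM s t l m : ccvg s l -> ccvg t m -> ccvg (fun n => s n * t n) (l * m).
Proof.
move=> [s1 s2] [t1 t2]; split.
  under eq_fun do rewrite cReM; rewrite cReM.
  by apply: cvgB; apply: cvgM.
under eq_fun do rewrite cImM; rewrite cImM.
by apply: cvgD; apply: cvgM.
Qed.

Lemma ccvgZ c s l : ccvg s l -> ccvg (fun n => c * s n) (c * l).
Proof. by move=> sl; apply: ccvgM => //; exact: ccvg_cst. Qed.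

Lemma ccvgN s l : ccvg s l -> ccvg (fun n => - s n) (- l).
Proof.
move=> sl; rewrite -mulN1r; apply: ccvg_ext (ccvgZ (-1) sl) => n.
by rewrite mulN1r.
Qed.

Lemma ccvgB s t l m : ccvg s l -> ccvg t m -> ccvg (fun n => s n - t n) (l - m).
Proof. by move=> sl tm; apply: ccvgD => //; exact: ccvgN. Qed.

Lemma ccvgJ s l : ccvg s l -> ccvg (fun n => (s n)^*%C) l^*%C.
Proof.
have ReJ (x : R[i]) : complex.Re x^*%C = complex.Re x by case: x.
have ImJ (x : R[i]) : complex.Im x^*%C = - complex.Im x by case: x.
move=> [s1 s2]; split.
  by under eq_fun do rewrite ReJ; rewrite ReJ.
by under eq_fun do rewrite ImJ; rewrite ImJ; exact: cvgN.
Qed.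

Lemma ccvg_sum I (r : seq I) (s : I -> nat -> R[i]) (l : I -> R[i]) :
  (forall i, ccvg (s i) (l i)) ->
  ccvg (fun n => \sum_(i <- r) s i n) (\sum_(i <- r) l i).
Proof.
move=> sl; elim: r => [|i r ih].
  by rewrite big_nil; under [X in ccvg X _]eq_fun do rewrite big_nil;
    exact: ccvg_cst.
by rewrite big_cons; under [X in ccvg X _]eq_fun do rewrite big_cons;
  exact: ccvgD.
Qed.

Lemma ccvg_shift k s l : ccvg s l -> ccvg (fun n => s (k + n)%N) l.
Proof.
under [X in _ -> ccvg X _]eq_fun do rewrite addnC.
by move=> [s1 s2]; split; [rewrite (cvg_shiftn k (fun n => complex.Re (s n)))|
  rewrite (cvg_shiftn k (fun n => complex.Im (s n)))].
Qed.

Lemma ccvg_unique s l m : ccvg s l -> ccvg s m -> l = m.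
Proof.
move=> [s1 s2] [t1 t2]; apply: eqC_ReIm.
  exact: (cvg_unique _ s1 t1).
exact: (cvg_unique _ s2 t2).
Qed.

Lemma ccvg_near s t l : (\forall n \near \oo, s n = t n) ->
  ccvg s l -> ccvg t l.
Proof.
move=> st [s1 s2]; split.
  apply: cvg_trans s1; apply: near_eq_cvg.
  by apply: filterS st => n ->.
apply: cvg_trans s2; apply: near_eq_cvg.
by apply: filterS st => n ->.
Qed.

Lemma ccvg0_le s (b : nat -> R) : (forall n, nc (s n) <= b n) ->
  b n @[n --> \oo] --> 0 -> ccvg s 0.
Proof.
move=> sb b0.
have nb0 : - b n @[n --> \oo] --> 0 by rewrite -oppr0; exact: cvgN.
split; apply: (squeeze_cvgr _ nb0 b0); apply: nearW => n; rewrite -ler_norml.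
  by rewrite (le_trans (norm_Re_le_nc _)).
by rewrite (le_trans (norm_Im_le_nc _)).
Qed.

Lemma ccvg_delta (x : nat -> R[i]) (i : nat) :
  ccvg (fun N => \sum_(l < N) (i == l)%:R * x l) (x i).
Proof.
apply: (@ccvg_near (fun=> x i)); last exact: ccvg_cst.
near=> N.
have iN : (i < N)%N by near: N; exact: nbhs_infty_gt.
rewrite (bigD1 (Ordinal iN))//= eqxx mul1r big1 ?addr0// => l.
by rewrite -val_eqE/= eq_sym => /negbTE ->; rewrite mul0r.
Unshelve. all: by end_near. Qed.

Lemma ccvg_sqr_le (v : nat -> R[i]) l :
  ccvg (fun N => \sum_(k < N) v k * (v k)^*%C) l ->
  forall N, \sum_(k < N) nc (v k) ^+ 2 <= complex.Re l.
Proof.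
move=> [vl _] N.
have {}vl : \sum_(k < n) nc (v k) ^+ 2 @[n --> \oo] --> complex.Re l.
  apply: cvg_trans vl; apply: near_eq_cvg; apply: nearW => n.
  by rewrite cRe_sum; apply: eq_bigr => k _; rewrite mulcJ.
apply: (ler_cvg_to (cvg_cst (\sum_(k < N) nc (v k) ^+ 2)) vl).
near=> n.
have Nn : (N <= n)%N by near: n; exact: nbhs_infty_ge.
rewrite -!(big_mkord xpredT (fun k => nc (v k) ^+ 2)).
rewrite [leRHS](big_cat_nat (leq0n N) Nn)//= lerDl.
by rewrite sumr_ge0// => i _; exact: sqr_ge0.
Unshelve. all: by end_near. Qed.

End complex_limits.

(** * A zero from a projection of finite trace *)

Section inner_sequence.
Context {R : realType}.
(* For the coefficients c of an inner function, [orth] says that the functions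
   z^m w are orthonormal, and [cB] bounds the trace of the projection g. *)
Variables (c : int -> R[i]) (B : R).
Hypothesis cneg : forall n : nat, c (Negz n) = 0.
Hypothesis orth : forall m p : nat,
  ccvg (fun N => \sum_(l < N) c (l%:Z - m%:Z) * (c (l%:Z - p%:Z))^*%C)
       (m == p)%:R.
Hypothesis cB : forall N,
  N%:R - \sum_(j < N) \sum_(l < N) nc (c (j%:Z - l%:Z)) ^+ 2 <= B.

Let h (i k : nat) := c (i.+1 + k)%N.

(* With S the matrix of multiplication by the inner function, g is 1 - S S^*;
   the terms with m > min (i, j) vanish, so that i + j is a harmless bound. *)
Let g (i j : nat) : R[i] := (i == j)%:R -
  \sum_(m < (i + j).+1) c (i%:Z - m%:Z) * (c (j%:Z - m%:Z))^*%C.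

Let cneg' (i m : nat) : (i < m)%N -> c (i%:Z - m%:Z) = 0.
Proof.
move=> im; rewrite (_ : _ - _ = Negz (m - i).-1) ?cneg//; lia.
Qed.

Let sum_widen (f : nat -> R[i]) n M : (n <= M)%N ->
  (forall m, (n <= m)%N -> f m = 0) -> \sum_(m < M) f m = \sum_(m < n) f m.
Proof.
move=> nM f0; rewrite -!(big_mkord xpredT f) (big_cat_nat (leq0n n) nM)//=.
rewrite [X in _ + X]big_nat_cond [X in _ + X]big1 ?addr0// => m /andP[/andP[+ _] _].
exact: f0.
Qed.

Let gE i j M : (i < M)%N || (j < M)%N -> g i j = (i == j)%:R -
  \sum_(m < M) c (i%:Z - m%:Z) * (c (j%:Z - m%:Z))^*%C.
Proof.
pose f m := c (i%:Z - m%:Z) * (c (j%:Z - m%:Z))^*%C.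
have H n n' : (minn i j < n)%N -> (n <= n')%N ->
    \sum_(m < n') f m = \sum_(m < n) f m.
  move=> mn nn; apply: sum_widen => // m nm; rewrite /f.
  have : (i < m)%N || (j < m)%N by lia.
  by move=> /orP[]/cneg' ->; rewrite ?conjc0 ?mulr0 ?mul0r.
move=> ijM; rewrite /g; congr (_ - _).
rewrite -/(f _).
have [le1|/ltnW le1] := leqP M (i + j).+1; first by apply: H => //; lia.
by apply/esym; apply: H => //; lia.
Qed.

(** By [orth], the full inner product of the shifts of c by j and i is the
    Kronecker symbol; its first i + j + 1 terms, read backwards, are the sum in
    g i j, and the remaining ones are the inner product of h i and h j. *)
Let gram i j : ccvg (fun N => \sum_(k < N) h i k * (h j k)^*%C) (g i j).
Proof.
pose F l := c (l%:Z - j%:Z) * (c (l%:Z - i%:Z))^*%C.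
have E N : \sum_(k < N) h i k * (h j k)^*%C =
    \sum_(l < (i + j).+1 + N) F l - \sum_(m < (i + j).+1) F m.
  rewrite big_split_ord/= addrAC subrr add0r; apply: eq_bigr => k _.
  by rewrite /F /h; congr (c _ * (c _)^*%C); lia.
have -> : g i j = (j == i)%:R - \sum_(m < (i + j).+1) F m.
  rewrite /g eq_sym; congr (_ - _).
  rewrite (reindex_inj rev_ord_inj)/=; apply: eq_bigr => m _.
  rewrite /F; have := ltn_ord m; move: (m : nat) => {}m mm.
  by congr (c _ * (c _)^*%C); lia.
apply: ccvg_ext (fun N => esym (E N)) _.
apply: ccvgB; last exact: ccvg_cst.
exact: (ccvg_shift (i + j).+1 (orth j i)).
Qed.

(** By [orth], S^* S = 1; hence P := S S^* is a projection, and so is g = 1 - P. *)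
Let gproj i j : ccvg (fun N => \sum_(l < N) g i l * g l j) (g i j).
Proof.
set M := (i + j).+1.
pose A l := \sum_(m < M) c (i%:Z - m%:Z) * (c (l%:Z - m%:Z))^*%C.
pose B' l := \sum_(m < M) c (l%:Z - m%:Z) * (c (j%:Z - m%:Z))^*%C.
have E l : g i l * g l j = (i == l)%:R * ((l == j)%:R - B' l)
    - (j == l)%:R * A l + A l * B' l.
  rewrite (@gE i l M) ?(@gE l j M) -/(A l) -/(B' l) /M ?ltnS ?leq_addr ?leq_addl ?orbT//.
  by rewrite (eq_sym j l); ring.
have -> : g i j = ((i == j)%:R - B' i) - A j + B' i.
  rewrite (@gE i j M) ?/M ?ltnS ?leq_addr// -/(A j).
  have -> : B' i = A j by [].
  by ring.
apply: (@ccvg_ext _ (fun N =>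
   \sum_(l < N) (i == l)%:R * ((nat_of_ord l == j)%:R - B' l)
   - \sum_(l < N) (j == l)%:R * A l + \sum_(l < N) A l * B' l)).
  by move=> N; rewrite -sumrB -big_split; apply: eq_bigr => l _; rewrite E.
apply: ccvgD; first apply: ccvgB.
- exact: (ccvg_delta (fun l => (l == j)%:R - B' l)).
- exact: ccvg_delta.
have E2 N : \sum_(l < N) A l * B' l = \sum_(m < M) \sum_(p < M)
    (c (i%:Z - m%:Z) * (c (j%:Z - p%:Z))^*%C) *
    \sum_(l < N) c (l%:Z - p%:Z) * (c (l%:Z - m%:Z))^*%C.
  under [RHS]eq_bigr do under eq_bigr do rewrite mulr_sumr.
  under [RHS]eq_bigr do rewrite exchange_big.
  rewrite [RHS]exchange_big; apply: eq_bigr => l _.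
  rewrite /A /B' mulr_suml; apply: eq_bigr => m _.
  by rewrite mulr_sumr; apply: eq_bigr => p _; ring.
apply: ccvg_ext (fun N => esym (E2 N)) _.
have -> : B' i = \sum_(m < M) \sum_(p < M)
    (c (i%:Z - m%:Z) * (c (j%:Z - p%:Z))^*%C) * (p == m :> nat)%:R.
  apply: eq_bigr => m _; rewrite (bigD1 m)//= eqxx mulr1 big1 ?addr0// => p.
  by rewrite -val_eqE/= => /negbTE ->; rewrite mulr0.
apply: ccvg_sum => m; apply: ccvg_sum => p.
by apply: ccvgZ; exact: orth.
Qed.

Let gll N l : (l < N)%N ->
  complex.Re (g l l) = 1 - \sum_(m < N) nc (c (l%:Z - m%:Z)) ^+ 2.
Proof.
move=> lN; rewrite (@gE l l N) ?lN// eqxx.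
rewrite -[X in complex.Re X]/(1 + - _) cReD; congr (_ + _).
rewrite (_ : forall x : R[i], complex.Re (- x) = - complex.Re x); last by case.
by rewrite cRe_sum; congr (- _); apply: eq_bigr => m _; rewrite mulcJ.
Qed.

Let gram_comb n (x : nat -> R[i]) :
  ccvg (fun N => \sum_(k < N) (\sum_(i < n) x i * h i k) *
                   (\sum_(i < n) x i * h i k)^*%C)
       (\sum_(j < n) (\sum_(i < n) x i * g i j) * (x j)^*%C).
Proof.
have E N : \sum_(k < N) (\sum_(i < n) x i * h i k) *
                   (\sum_(i < n) x i * h i k)^*%C =
    \sum_(j < n) (\sum_(i < n) x i * \sum_(k < N) h i k * (h j k)^*%C)
      * (x j)^*%C.
  under [RHS]eq_bigr do rewrite mulr_suml.
  under [RHS]eq_bigr do under eq_bigr do rewrite mulr_sumr mulr_suml.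
  under [RHS]eq_bigr do rewrite exchange_big.
  rewrite [RHS]exchange_big; apply: eq_bigr => k _.
  rewrite conj_sum mulr_sumr; apply: eq_bigr => j _.
  by rewrite mulr_suml; apply: eq_bigr => i _; rewrite conjM; ring.
apply: ccvg_ext (fun N => esym (E N)) _.
apply: ccvg_sum => j; apply: ccvgM; last exact: ccvg_cst.
by apply: ccvg_sum => i; apply: ccvgZ.
Qed.

(** The number t l below is the squared norm of the projection of h l on the
    span of h 0, ..., h (n - 1), hence at most |h l|^2 = g l l.  As g is a
    projection, the t l add up to n, while the g l l add up to at most B. *)
Let invertible_gram_le n :
  (\matrix_(i < n, j < n) g i j) \in unitmx -> n%:R <= B.
Proof.
set G := \matrix_(i, j) _ => Gu.
pose V i j := (invmx G) i j.
have VG (i j : 'I_n) : \sum_(k < n) V i k * g k j = (i == j)%:R.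
  have := mulVmx Gu => /matrixP/(_ i j); rewrite !mxE => <-.
  by apply: eq_bigr => k _; rewrite mxE.
pose t l := \sum_(j < n) (\sum_(i < n) g l i * V i j) * g j l.
have tlim : ccvg (fun N => \sum_(l < N) t l) n%:R.
  have E N : \sum_(l < N) t l = \sum_(j < n) \sum_(i < n) V i j *
      \sum_(l < N) g j l * g l i.
    under [RHS]eq_bigr do under eq_bigr do rewrite mulr_sumr.
    under [RHS]eq_bigr do rewrite exchange_big.
    rewrite [RHS]exchange_big; apply: eq_bigr => l _.
    apply: eq_bigr => j _; rewrite mulr_suml; apply: eq_bigr => i _; ring.
  apply: ccvg_ext (fun N => esym (E N)) _.
  have -> : n%:R = \sum_(j < n) \sum_(i < n) V i j * g j i.
    rewrite exchange_big/=; under eq_bigr do rewrite VG eqxx.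
    by rewrite sumr_const card_ord.
  by apply: ccvg_sum => j; apply: ccvg_sum => i; apply: ccvgZ; exact: gproj.
have tle l : complex.Re (t l) <= complex.Re (g l l).
  pose a (j : 'I_n) := \sum_(i < n) g l i * V i j.
  have ag (j : 'I_n) : \sum_(i < n) a i * g i j = g l j.
    under eq_bigr do rewrite mulr_suml.
    rewrite exchange_big/=.
    under eq_bigr do under eq_bigr do rewrite -mulrA.
    under eq_bigr do rewrite -mulr_sumr VG.
    rewrite (bigD1 j)//= eqxx mulr1 big1 ?addr0// => i /negbTE ->.
    by rewrite mulr0.
  (* The component of h l orthogonal to the span. *)
  pose D k := h l k - \sum_(j < n) a j * h j k.
  have DE N : \sum_(k < N) D k * (D k)^*%C =
      \sum_(k < N) h l k * (h l k)^*%C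
      - \sum_(j < n) a j * \sum_(k < N) h j k * (h l k)^*%C
      - \sum_(j < n) (\sum_(k < N) h l k * (h j k)^*%C) * (a j)^*%C
      + \sum_(j < n) (\sum_(i < n) a i * \sum_(k < N) h i k * (h j k)^*%C)
          * (a j)^*%C.
    have E1 : \sum_(j < n) a j * \sum_(k < N) h j k * (h l k)^*%C =
        \sum_(k < N) (\sum_(j < n) a j * h j k) * (h l k)^*%C.
      under eq_bigr do rewrite mulr_sumr.
      rewrite exchange_big; apply: eq_bigr => k _; rewrite mulr_suml.
      by apply: eq_bigr => j _; rewrite mulrA.
    have E2 : \sum_(j < n) (\sum_(k < N) h l k * (h j k)^*%C) * (a j)^*%C =
        \sum_(k < N) h l k * (\sum_(j < n) a j * h j k)^*%C.
      under eq_bigr do rewrite mulr_suml.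
      rewrite exchange_big; apply: eq_bigr => k _.
      rewrite conj_sum mulr_sumr; apply: eq_bigr => j _; rewrite conjM; ring.
    have E3 : \sum_(j < n) (\sum_(i < n) a i * \sum_(k < N) h i k * (h j k)^*%C)
          * (a j)^*%C =
        \sum_(k < N) (\sum_(j < n) a j * h j k) *
          (\sum_(j < n) a j * h j k)^*%C.
      under eq_bigr do rewrite mulr_suml.
      under eq_bigr do under eq_bigr do rewrite mulr_sumr mulr_suml.
      under eq_bigr do rewrite exchange_big.
      rewrite exchange_big; apply: eq_bigr => k _.
      rewrite conj_sum mulr_sumr; apply: eq_bigr => j _.
      by rewrite mulr_suml; apply: eq_bigr => i _; rewrite conjM; ring.
    rewrite E1 E2 E3 -!sumrB -big_split; apply: eq_bigr => k _.
    rewrite /D /= conjB; move: (\sum_(j < n) a j * h j k) => S; ring.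
  have Dlim : ccvg (fun N => \sum_(k < N) D k * (D k)^*%C) (g l l - t l).
    apply: ccvg_ext (fun N => esym (DE N)) _.
    have -> : g l l - t l = g l l - t l
        - \sum_(j < n) g l j * (a j)^*%C
        + \sum_(j < n) (\sum_(i < n) a i * g i j) * (a j)^*%C.
      have -> : \sum_(j < n) (\sum_(i < n) a i * g i j) * (a j)^*%C =
          \sum_(j < n) g l j * (a j)^*%C.
        by apply: eq_bigr => j _; rewrite ag.
      by rewrite subrK.
    apply: ccvgD; first apply: ccvgB; first apply: ccvgB.
    - exact: gram.
    - by apply: ccvg_sum => j; apply: ccvgZ; exact: gram.
    - by apply: ccvg_sum => j; apply: ccvgM; [exact: gram|exact: ccvg_cst].
    - apply: ccvg_sum => j; apply: ccvgM; last exact: ccvg_cst.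
      by apply: ccvg_sum => i; apply: ccvgZ; exact: gram.
  have := ccvg_sqr_le Dlim 0; rewrite big_ord0.
  by case: (g l l) (t l) => p q [p' q'] /=; rewrite subr_ge0.
have [tR _] := tlim.
have nE : complex.Re (n%:R : R[i]) = n%:R.
  by rewrite (_ : n%:R = (n%:R)%:C%C)//; rewrite rmorph_nat.
rewrite nE in tR.
apply: (ler_cvg_to tR (cvg_cst B)); apply: nearW => N.
apply: le_trans (cB N).
rewrite cRe_sum -[X in X%:R]card_ord -sumr_const -sumrB.
by apply: ler_sum => l _; rewrite (le_trans (tle l))// (@gll N).
Qed.

(** By [invertible_gram_le], the Gram matrix of more than B shifts is singular. *)
Let dependent : exists2 p : {poly R[i]}, p != 0 &
  forall k N, (size p <= N)%N -> \sum_(i < N) p`_i * h i k = 0.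
Proof.
pose n := (Num.truncn B).+1.
have nB : B < n%:R by exact: truncnS_gt.
have /negP : ~~ ((\matrix_(i < n, j < n) g i j) \in unitmx).
  by apply/negP => /invertible_gram_le; rewrite leNgt nB.
set G := \matrix_(i, j) _; rewrite unitmxE unitfE => /negP; rewrite negbK.
move=> /det0P[v v0 vG].
pose x i := if insub i is Some i' then v 0 i' else 0 : R[i].
have xE (i : 'I_n) : x i = v 0 i.
  by rewrite /x valK.
pose p := \poly_(i < n) x i.
exists p.
  apply: contra v0 => /eqP p0; apply/eqP/matrixP => a i; rewrite ord1 !mxE -xE.
  by have := coef_poly n x i; rewrite -/p p0 coef0 ltn_ord.
have x0 k : \sum_(i < n) x i * h i k = 0.
  have := gram_comb n x.
  rewrite [X in ccvg _ X](_ : _ = 0); last first.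
    rewrite big1// => j _.
    have /matrixP/(_ 0 j) := vG; rewrite !mxE => vGj.
    rewrite (_ : \sum_(i < n) _ = 0) ?mul0r//; apply: etrans vGj.
    by apply: eq_bigr => i _; rewrite xE mxE.
  move=> /(@ccvg_sqr_le _ (fun k => \sum_(i < n) x i * h i k))/(_ k.+1); rewrite big_ord_recr/= => H.
  have : nc (\sum_(i < n) x i * h i k) ^+ 2 <= 0.
    by apply: le_trans H; rewrite lerDr sumr_ge0// => i _; exact: sqr_ge0.
  by rewrite le_eqVlt ltNge sqr_ge0 orbF sqrf_eq0 nc_eq0 => /eqP.
have pE i : p`_i = if (i < n)%N then x i else 0 by rewrite coef_poly.
move=> k N pN.
have W M : (size p <= M)%N -> \sum_(i < M) p`_i * h i k =
    \sum_(i < size p) p`_i * h i k.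
  move=> pM; apply: (sum_widen (f := fun i => p`_i * h i k)) => // m pm.
  by rewrite nth_default// mul0r.
have pn : (size p <= n)%N by exact: size_poly.
rewrite (W _ pN) -(W _ pn); apply: etrans (x0 k).
by apply: eq_bigr => i _; rewrite pE ltn_ord.
Qed.

Let lim_h i : ccvg (fun N => \sum_(k < N) h i k * (c k)^*%C) 0.
Proof.
have := ccvg_shift i.+1 (orth 0 i.+1); apply: ccvg_ext => N.
rewrite big_split_ord/= big1 ?add0r => [|l _].
  by apply: eq_bigr => k _; rewrite /h; congr (c _ * (c _)^*%C); lia.
by rewrite [X in _ * X^*%C]cneg' ?conjc0 ?mulr0// ltn_ord.
Qed.

(** Let p be a nonzero polynomial such that \sum_i p_i h i = 0 and beta be a
    root of it, p = b (X - beta).  The combination v := \sum_i b_i h i satisfies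
    v (k + 1) = beta v k.  If v = 0, then b replaces p, which can occur only
    finitely often.  Otherwise v is geometric; being square summable it has
    |beta| < 1, and it is orthogonal to c because each h i is. *)
Lemma inner_sequence_zero : (forall k : nat, c k.+1 = 0) \/
  exists2 alpha, nc alpha < 1 &
    ccvg (fun N => \sum_(k < N) alpha ^+ k * c k) 0.
Proof.
have [p p0 pr] := dependent.
have [s] := ubnP (size p); elim: s p p0 pr => // s ih p p0 pr; rewrite ltnS => ps.
have [p1|p1] := eqVneq (size p) 1%N.
  left=> k; have /eqP : \sum_(i < 1) p`_i * h i k = 0 by apply: pr; rewrite p1.
  rewrite big_ord1 mulf_eq0 => /orP[|/eqP].
    have : lead_coef p != 0 by rewrite lead_coef_eq0.
    by rewrite lead_coefE p1 => /negbTE ->.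
  by rewrite /h add1n.
have /closed_rootP[beta /factor_theorem[b pE]] := p1.
have b0 : b != 0 by apply: contra p0 => /eqP b0; rewrite pE b0 mul0r.
have sb : size p = (size b).+1 by rewrite pE size_Mmonic ?monicXsubC// size_XsubC addn2.
pose v k := \sum_(i < size b) b`_i * h i k.
have vW k N : (size b <= N)%N -> \sum_(i < N) b`_i * h i k = v k.
  move=> bN; apply: (sum_widen (f := fun i => b`_i * h i k)) => // m pm.
  by rewrite nth_default// mul0r.
have vS k : v k.+1 = beta * v k.
  have pb i : p`_i = (if i == 0%N then 0 else b`_i.-1) - b`_i * beta.
    by rewrite pE mulrBr coefB coefMX coefMC.
  have := pr k (size b).+1; rewrite sb => /(_ (leqnn _)) H.
  apply/eqP; rewrite -subr_eq0; apply/eqP; apply: etrans H.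
  have -> : beta * v k = \sum_(i < (size b).+1) b`_i * beta * h i k.
    rewrite -(vW k (size b).+1)// mulr_sumr; apply: eq_bigr => i _.
    by rewrite mulrA (mulrC beta).
  have -> : v k.+1 = \sum_(i < (size b).+1)
      (if i == 0%N :> nat then 0 else b`_i.-1) * h i k.
    rewrite big_ord_recl/= mul0r add0r; apply: eq_bigr => i _.
    by rewrite /bump/= add1n /h addSn addnS.
  by rewrite -sumrB; apply: eq_bigr => i _; rewrite pb mulrBl.
(* As v is geometric, it vanishes if its first term does. *)
have [v0|v0] := eqVneq (v 0%N) 0.
  apply: (ih b) => //; last by rewrite -sb.
  have vk k : v k = 0 by elim: k => // k; rewrite vS => ->; rewrite mulr0.
  by move=> k N bN; rewrite vW.
right.
have vk k : v k = beta ^+ k * v 0%N.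
  by elim: k => [|k ihk]; rewrite ?mul1r// vS ihk exprS mulrA.
exists beta^*%C.
  rewrite ncJ ltNge; apply/negP => beta1.
  have := gram_comb (size b) (fun i => b`_i).
  move=> /(@ccvg_sqr_le _ v); set L := complex.Re _ => H.
  have v02 : 0 < nc (v 0%N) ^+ 2 by rewrite exprn_gt0// nc_gt0.
  have := H (Num.truncn (L / nc (v 0%N) ^+ 2)).+1.
  apply/negP; rewrite -ltNge.
  set N := _.+1.
  have : L / nc (v 0%N) ^+ 2 < N%:R by exact: truncnS_gt.
  rewrite ltr_pdivrMr// => /lt_le_trans; apply.
  rewrite mulr_natl -[X in _ *+ X]card_ord -sumr_const; apply: ler_sum => k _.
  rewrite (vk k) ncM exprMn ler_peMl ?sqr_ge0//.
  by rewrite exprn_ege1// ncX exprn_ege1.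
have : ccvg (fun N => \sum_(k < N) v k * (c k)^*%C) 0.
  suff : ccvg (fun N => \sum_(k < N) v k * (c k)^*%C)
      (\sum_(i < size b) b`_i * 0).
    by rewrite big1// => i _; rewrite mulr0.
  apply: (@ccvg_ext _ (fun N => \sum_(i < size b) b`_i *
    \sum_(k < N) h i k * (c k)^*%C)).
    move=> N; under eq_bigr do rewrite mulr_sumr.
    rewrite exchange_big; apply: eq_bigr => k _; rewrite mulr_suml.
    by apply: eq_bigr => i _; rewrite mulrA.
  by apply: ccvg_sum => i; apply: ccvgZ; exact: lim_h.
move=> /(ccvgZ (v 0%N)^-1)/ccvgJ; rewrite mulr0 conjc0; apply: ccvg_ext => N.
rewrite mulr_sumr conj_sum; apply: eq_bigr => k _.
by rewrite (vk k) -mulrA mulrCA mulKf// conjM conjcK conjX.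
Qed.

End inner_sequence.

(** * Bounded analytic functions of finite energy *)

Section hardy.
Context {R : realType} {d : measure_display} {T : measurableType d}.
Variables (nu : probability T R) (z : T -> R[i]).
Hypothesis mz : cmeas z.
Hypothesis z1 : forall x, nc (z x) = 1.
Hypothesis zinj : injective z.
Hypothesis cint_expz : forall n : nat, cint nu (fun x => z x ^+ n.+1) = 0.
Implicit Types (f g w : T -> R[i]) (c alpha : R[i]).

Local Notation fcoef := (fcoef nu z).
Local Notation energy := (energy nu z).
Local Notation sqn f k := (nc (fcoef f k) ^+ 2).

Lemma energy_fin_le f g h (M C : R) : cmeas f -> cmeas g -> cmeas h ->
  (energy g < +oo)%E -> (energy h < +oo)%E -> 0 <= M -> 0 <= C ->
  (forall x y, nc (f x - f y) ^+ 2 <= M * nc (g x - g y) ^+ 2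
     + M * nc (h x - h y) ^+ 2 + C * nc (z x - z y) ^+ 2) ->
  (energy f < +oo)%E.
Proof.
move=> mf mg mh Eg Eh M0 C0 H.
pose k f := fun p : T * T => (nc (f p.1 - f p.2) ^+ 2 / nc (z p.1 - z p.2) ^+ 2)%:E.
have k0 f' p : (0 <= k f' p)%E by rewrite lee_fin divr_ge0// sqr_ge0.
have mk f' : cmeas f' -> measurable_fun setT (k f').
  by move=> mf'; exact: (measurable_energy mz mf').
apply: (@le_lt_trans _ _ (\int[nu \x nu]_p
    (M%:E * k g p + M%:E * k h p + C%:E))%E).
  apply: ge0_le_integral => //.
  - by move=> p _; exact: k0.
  - exact: mk.
  - apply: emeasurable_funD => //.
    by apply: emeasurable_funD; apply: measurable_funeM; exact: mk.
  - move=> [x y] _; rewrite /k /= -!EFinM -!EFinD lee_fin.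
    have [->|xy] := eqVneq x y.
      by rewrite !subrr Normc.normc0 expr0n/= !mul0r !mulr0 !add0r.
    have zxy : 0 < nc (z x - z y) ^+ 2.
      rewrite exprn_gt0// nc_gt0 subr_eq0; apply: contra xy.
      by move=> /eqP/zinj ->.
    by rewrite ler_pdivrMr// !mulrDl -!mulrA mulVf ?mulr1 ?gt_eqF//.
rewrite ge0_integralD//=; first last.
- by apply: emeasurable_funD; apply: measurable_funeM; exact: mk.
- by move=> p _; rewrite adde_ge0// mule_ge0// lee_fin.
rewrite ge0_integralD//=; first last.
- by apply: measurable_funeM; exact: mk.
- by move=> p _; rewrite mule_ge0.
- by apply: measurable_funeM; exact: mk.
- by move=> p _; rewrite mule_ge0.
rewrite !ge0_integralZl//; [|exact: mk|exact: mk].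
rewrite integral_cst//.
have pT : (nu \x nu)%E [set: T * T] = 1%E.
  have := product_measure1E nu nu measurableT measurableT.
  rewrite setXTT => E; apply: etrans E _.
  transitivity (nu [set: T] * nu [set: T])%E; first by [].
  by rewrite probability_setT mule1.
rewrite [X in (C%:E * X)%E](_ : _ = 1%E); last exact: pT.
by rewrite mule1 lte_add_pinfty ?ltry// lte_add_pinfty//
  lte_mul_pinfty// lee_fin.
Qed.

Lemma nc_sqrD (x y : R[i]) : nc (x + y) ^+ 2 <= 2 * nc x ^+ 2 + 2 * nc y ^+ 2.
Proof.
apply: (@le_trans _ _ ((nc x + nc y) ^+ 2)).
  by rewrite ler_pXn2r ?nnegrE ?addr_ge0 ?nc_ge0// ncD.
rewrite -subr_ge0 (_ : _ - _ = (nc x - nc y) ^+ 2) ?sqr_ge0//; ring.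
Qed.

Lemma energyD f g : cmeas f -> cmeas g -> (energy f < +oo)%E ->
  (energy g < +oo)%E -> (energy (fun x => f x + g x)%R < +oo)%E.
Proof.
move=> mf mg Ef Eg; apply: (energy_fin_le (M := 2) (C := 0) _ mf mg) => //.
  exact: cmeasD.
move=> x y; rewrite mul0r addr0.
by rewrite [X in nc X](_ : _ = f x - f y + (g x - g y)) ?nc_sqrD//; ring.
Qed.

Lemma energy_cst c : (energy (fun=> c) < +oo)%E.
Proof.
rewrite /energy; under eq_integral do
  rewrite subrr Normc.normc0 expr0n/= mul0r.
by rewrite integral0 ltry.
Qed.

(** The difference of phi f at x and y is
    phi x (f x - f y) + f y (phi x - phi y), where the Lipschitz condition
    cancels the singularity of the kernel in the second term. *)
Lemma energy_mul f phi (L : R) : bmeas f -> bmeas phi ->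
  (energy f < +oo)%E -> (forall x y, nc (phi x - phi y) <= L * nc (z x - z y)) ->
  (energy (fun x => phi x * f x)%R < +oo)%E.
Proof.
move=> mf mphi Ef phiL.
have [[cf [A fA]] [cphi [M phiM]]] := (mf, mphi).
apply: (energy_fin_le (g := f) (h := f) (M := 2 * M ^+ 2)
    (C := 2 * (A * L) ^+ 2)) => //.
- exact: cmeasM.
- by rewrite mulr_ge0// sqr_ge0.
- by rewrite mulr_ge0// sqr_ge0.
move=> x y.
have -> : phi x * f x - phi y * f y =
  phi x * (f x - f y) + f y * (phi x - phi y) by ring.
apply: le_trans (nc_sqrD _ _) _; rewrite !ncM !exprMn.
have s0 : 0 <= nc (f x - f y) ^+ 2 by exact: sqr_ge0.
have h1 : nc (phi x) ^+ 2 <= M ^+ 2.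
  by rewrite ler_pXn2r ?nnegrE ?nc_ge0// (le_trans _ (phiM x))// nc_ge0.
have h2 : nc (f y) ^+ 2 * nc (phi x - phi y) ^+ 2 <=
    A ^+ 2 * L ^+ 2 * nc (z x - z y) ^+ 2.
  have P0 : 0 <= L * nc (z x - z y) by rewrite (le_trans _ (phiL x y))// nc_ge0.
  have A0 : 0 <= A by rewrite (le_trans _ (fA y))// nc_ge0.
  rewrite -mulrA -(exprMn 2 L) -!exprMn.
  rewrite ler_pXn2r ?nnegrE ?(mulr_ge0 A0 P0) ?mulr_ge0 ?nc_ge0//.
  by rewrite ler_pM ?nc_ge0.
have h3 : nc (phi x) ^+ 2 * nc (f x - f y) ^+ 2 <= M ^+ 2 * nc (f x - f y) ^+ 2.
  by rewrite ler_wpM2r.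
have h4 : 0 <= M ^+ 2 * nc (f x - f y) ^+ 2 by rewrite mulr_ge0// sqr_ge0.
lra.
Qed.

(** The functions of the Hardy space which are moreover bounded and of finite
    energy; the last condition gives access to [parseval_le]. *)
Definition hardy f := [/\ bmeas f, (energy f < +oo)%E &
  forall n : nat, fcoef f (Negz n) = 0].

Lemma hardyD f g : hardy f -> hardy g -> hardy (fun x => f x + g x).
Proof.
move=> [mf Ef f0] [mg Eg g0]; split.
- exact: bmeasD.
- by apply: energyD => //; exact: bmeas_meas.
- by move=> n; rewrite fcoefD// f0 g0 addr0.
Qed.

Lemma hardyZ c f : hardy f -> hardy (fun x => c * f x).
Proof.
move=> [mf Ef f0]; split.
- by apply: bmeasM => //; exact: bmeas_cst.
- apply: (@energy_mul f (fun=> c) 0) => //; first exact: bmeas_cst.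
  by move=> x y; rewrite subrr Normc.normc0 mul0r.
- by move=> n; rewrite fcoefZ// f0 mulr0.
Qed.

Lemma hardy_cst c : hardy (fun=> c).
Proof.
by split; [exact: bmeas_cst|exact: energy_cst|move=> n; rewrite fcoef_cst ?mulr0].
Qed.

Lemma hardy_zM f : hardy f -> hardy (fun x => z x * f x).
Proof.
move=> [mf Ef f0]; split.
- by apply: bmeasM => //; exact: bmeas_unimod.
- apply: (@energy_mul f z 1) => //; first exact: bmeas_unimod.
  by move=> x y; rewrite mul1r.
- move=> n; rewrite (fcoef_zmul nu z1 f 1) (_ : Negz n - 1 = Negz n.+1) ?f0//; lia.
Qed.

Lemma hardy_zX n f : hardy f -> hardy (fun x => z x ^ n%:Z * f x).
Proof.
move=> hf; elim: n => [|n ih]; first by under eq_fun do rewrite expr0z mul1r.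
have := hardy_zM ih; congr hardy; apply/funext => x.
by rewrite mulrA -exprSz.
Qed.

(** The partial sums are squeezed between [bessel_bisum] and [parseval_le]. *)
Lemma parseval f : hardy f ->
  ccvg (fun N => \sum_(k < N) fcoef f k%:Z * (fcoef f k%:Z)^*%C)
       (sqnorm nu f)%:C%C.
Proof.
move=> [mf Ef f0].
have bE N : bisum (fun k => sqn f k) N = \sum_(k < N) sqn f k%:Z.
  rewrite /bisum [X in _ + X]big1 ?addr0// => k _.
  by rewrite f0 Normc.normc0 expr0n.
pose e := 2 * fine (energy f).
have L : \sum_(k < N) sqn f k%:Z @[N --> \oo] --> sqnorm nu f.
  have Lh : sqnorm nu f - e * harmonic N @[N --> \oo] --> sqnorm nu f - e * 0.
    apply: cvgB; first exact: cvg_cst.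
    by apply: cvgM; [exact: cvg_cst|exact: cvg_harmonic].
  rewrite mulr0 subr0 in Lh.
  rewrite -cvg_shiftS.
  apply: (squeeze_cvgr _ Lh (cvg_cst (sqnorm nu f))).
  apply: nearW => N /=; rewrite -bE (bessel_bisum mz z1 cint_expz)// andbT.
  have := parseval_le mz z1 zinj cint_expz mf Ef (ltn0Sn N).
  by rewrite lerBlDr addrC -lerBlDr.
split => /=.
  apply: cvg_trans L; apply: near_eq_cvg; apply: nearW => N.
  by rewrite cRe_sum; apply: eq_bigr => k _; rewrite mulcJ.
rewrite [X in X @ _](_ : _ = fun=> 0); first exact: cvg_cst.
by apply/funext => N; rewrite cIm_sum big1// => k _; rewrite mulcJ.
Qed.

(** Polarisation: both sides are the same combination of squared norms of
    f + g, f + i g, f and g. *)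
Lemma parseval_polar f g : hardy f -> hardy g ->
  ccvg (fun N => \sum_(k < N) fcoef f k%:Z * (fcoef g k%:Z)^*%C)
       (cint nu (fun x => f x * (g x)^*%C)).
Proof.
move=> hf hg; have [[mf _ _] [mg _ _]] := (hf, hg).
pose I : R[i] := 'i%C.
have II : I * I = -1 by rewrite /I; apply/eqP; rewrite eq_complex /=;
  apply/andP; split; apply/eqP; ring.
have IJ : I^*%C = - I by rewrite /I; apply/eqP; rewrite eq_complex /= oppr0 !eqxx.
have pol (a b : R[i]) : a * b^*%C = 2^-1 * ((a + b) * (a + b)^*%C
    + I * ((a + I * b) * (a + I * b)^*%C)
    - (1 + I) * (a * a^*%C + b * b^*%C)).
  rewrite !conjD conjM IJ.
  have -> : I * ((a + I * b) * (a^*%C + - I * b^*%C)) =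
     I * (a * a^*%C) - (I * I) * (a * b^*%C) + (I * I) * (b * a^*%C)
     - (I * I) * I * (b * b^*%C) by ring.
  by rewrite II; field.
have hfg := hardyD hf hg; have hIg := hardyZ I hg; have hfIg := hardyD hf hIg.
have [mfg _ _] := hfg; have [mIg _ _] := hIg; have [mfIg _ _] := hfIg.
have -> : cint nu (fun x => f x * (g x)^*%C) =
    2^-1 * ((sqnorm nu (fun x => f x + g x))%:C%C
    + I * (sqnorm nu (fun x => f x + I * g x))%:C%C
    - (1 + I) * ((sqnorm nu f)%:C%C + (sqnorm nu g)%:C%C)).
  under [X in cint _ X]eq_fun do rewrite pol.
  have m2 (h : T -> R[i]) : bmeas h -> bmeas (fun x => h x * (h x)^*%C).
    by move=> mh; apply: bmeasM => //; exact: bmeasJ.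
  have mZ c (h : T -> R[i]) : bmeas h -> bmeas (fun x => c * h x).
    by move=> mh; apply: bmeasM => //; exact: bmeas_cst.
  have ffg := m2 _ mfg; have ffIg := m2 _ mfIg; have ff := m2 _ mf.
  have gg := m2 _ mg.
  have A1 := bmeasD ffg (mZ I _ ffIg).
  have A2 := mZ (1 + I) _ (bmeasD ff gg).
  rewrite cintZ; last exact: (bmeasB A1 A2).
  rewrite (cintB _ A1 A2) (cintD _ ffg (mZ I _ ffIg)) (cintZ _ I ffIg).
  by rewrite (cintZ _ (1 + I) (bmeasD ff gg)) (cintD _ ff gg) !cint_mulJ.
apply: (@ccvg_ext _ (fun N => 2^-1 * (
    \sum_(k < N) fcoef (fun x => f x + g x) k%:Z
      * (fcoef (fun x => f x + g x) k%:Z)^*%C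
    + I * (\sum_(k < N) fcoef (fun x => f x + I * g x) k%:Z
      * (fcoef (fun x => f x + I * g x) k%:Z)^*%C)
    - (1 + I) * (\sum_(k < N) fcoef f k%:Z * (fcoef f k%:Z)^*%C
      + \sum_(k < N) fcoef g k%:Z * (fcoef g k%:Z)^*%C)))).
  move=> N; rewrite -big_split !mulr_sumr -sumrN -!big_split mulr_sumr.
  apply: eq_bigr => k _; rewrite [RHS](pol (fcoef f k) (fcoef g k)).
  by rewrite (fcoefD nu mz z1 k mf mg) (fcoefD nu mz z1 k mf mIg) (fcoefZ nu mz z1 I k mg).
apply: ccvgZ; apply: ccvgB; first apply: ccvgD.
- exact: parseval.
- by apply: ccvgZ; exact: parseval.
- by apply: ccvgZ; apply: ccvgD; exact: parseval.
Qed.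

End hardy.

(** * Inner functions of finite energy are finite Blaschke products *)

Section inner.
Context {R : realType} {d : measure_display} {T : measurableType d}.
Variables (nu : probability T R) (z : T -> R[i]).
Hypothesis mz : cmeas z.
Hypothesis z1 : forall x, nc (z x) = 1.
Hypothesis zinj : injective z.
Hypothesis cint_expz : forall n : nat, cint nu (fun x => z x ^+ n.+1) = 0.
Implicit Types (f g w : T -> R[i]) (c alpha : R[i]).

Local Notation fcoef := (fcoef nu z).
Local Notation energy := (energy nu z).
Local Notation hardy := (hardy nu z).
Local Notation sqn f k := (nc (fcoef f k) ^+ 2).

Let bz : bmeas z. Proof. exact: bmeas_unimod. Qed.

Definition inner w := hardy w /\ forall x, nc (w x) = 1.

Lemma inner_sqnorm w : (forall x, nc (w x) = 1) -> sqnorm nu w = 1.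
Proof.
move=> w1; have n1 : fine (nu setT) = 1 by rewrite probability_setT.
rewrite /sqnorm; under eq_Rintegral do rewrite w1 expr1n.
by rewrite Rintegral_cst// n1 mulr1.
Qed.

(** The products z^m w are orthonormal because |w| = 1; by polarised Parseval
    this is the orthogonality of the shifted coefficient sequences. *)
Lemma inner_zero w : inner w ->
  (forall k : nat, fcoef w k.+1 = 0) \/
  exists2 alpha, nc alpha < 1 &
    ccvg (fun N => \sum_(k < N) alpha ^+ k * fcoef w k) 0.
Proof.
move=> [hw w1]; have [mw Ew w0] := hw.
apply: (@inner_sequence_zero _ (fcoef w) (2 * fine (energy w))) => //.
  move=> m p.
  have := parseval_polar mz z1 zinj cint_expz (hardy_zX mz z1 zinj m hw)
    (hardy_zX mz z1 zinj p hw).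
  rewrite [X in ccvg _ X](_ : _ = (m == p)%:R).
    by apply: ccvg_ext => N; apply: eq_bigr => k _; rewrite !fcoef_zmul.
  rewrite [X in cint _ X](_ : _ = fun x => z x ^ (m%:Z - p%:Z)).
    by rewrite cint_zexp// subr_eq0.
  apply/funext => x; rewrite conjM unimod_expzJ// mulrACA mulcJ w1 expr1n mulr1.
  by rewrite -expfzDr// unimod_neq0.
move=> N; have := toeplitz_energy_le mz z1 zinj cint_expz N mw Ew.
by rewrite inner_sqnorm// mulr1.
Qed.

Lemma cmeasV f : cmeas f -> cmeas (fun x => (f x)^-1).
Proof.
move=> mf; rewrite (_ : (fun x => _) =
    (fun x => (f x)^*%C * ((nc (f x) ^+ 2)^-1)%:C%C)).
  apply: cmeasM; first exact: cmeasJ.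
  by split => //=; apply: measurable_inv_fun; exact: cmeas_nc2.
apply/funext => x.
have [->|fx0] := eqVneq (f x) 0; first by rewrite invr0 conjc0 mul0r.
by apply: (mulfI fx0); rewrite mulfV// mulrA mulcJ -rmorphM/= mulfV// expf_neq0// nc_eq0.
Qed.

Section cauchy.
Variable alpha : R[i].
Hypothesis a1 : nc alpha < 1.

Let za x : 1 - nc alpha <= nc (z x - alpha).
Proof.
rewrite lerBlDr -(z1 x); apply: le_trans (ncD _ _).
by rewrite subrK.
Qed.

Let a1' : 0 < 1 - nc alpha. Proof. by rewrite subr_gt0. Qed.

Lemma zsub_neq0 x : z x - alpha != 0.
Proof. by rewrite -nc_gt0 (lt_le_trans a1' (za x)). Qed.

Lemma bmeas_cauchy : bmeas (fun x => (z x - alpha)^-1).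
Proof.
split.
  by apply: cmeasV; apply: cmeasB => //; exact: cmeas_cst.
exists (1 - nc alpha)^-1 => x.
by rewrite ncV lef_pV2 ?posrE ?nc_gt0 ?zsub_neq0.
Qed.

Lemma cauchy_lip x y : nc ((z x - alpha)^-1 - (z y - alpha)^-1) <=
  (1 - nc alpha) ^- 2 * nc (z x - z y).
Proof.
have -> : (z x - alpha)^-1 - (z y - alpha)^-1 =
    (z x - alpha)^-1 * (z y - alpha)^-1 * (z y - z x).
  by field; rewrite !zsub_neq0.
have b t : nc (z t - alpha)^-1 <= (1 - nc alpha)^-1.
  by rewrite ncV lef_pV2 ?posrE ?nc_gt0 ?zsub_neq0.
rewrite !ncM -(ncN (z y - z x)) opprB -exprVn expr2.
by rewrite ler_wpM2r ?nc_ge0// ler_pM ?nc_ge0.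
Qed.

Section divide.
Variables (w : T -> R[i]) (L : R[i]).
Hypothesis hw : hardy w.
Hypothesis wL : ccvg (fun N => \sum_(k < N) alpha ^+ k * fcoef w k) L.

(* F is w / (z - alpha), and L is the value at alpha of the extension of w. *)
Let F x := (z x - alpha)^-1 * w x.

Let mF : bmeas F.
Proof. by case: hw => mw _ _; apply: bmeasM => //; exact: bmeas_cauchy. Qed.

Let rec (k : int) : fcoef F (k - 1) - alpha * fcoef F k = fcoef w k.
Proof.
rewrite -(fcoef_zmul nu z1 F 1) -(fcoefZ nu mz z1 alpha k mF) -fcoefB//.
- congr (cint _ _); apply/funext => x; rewrite /F; congr (_ * _).
  by rewrite expr1z -mulrBl mulrA mulfV ?zsub_neq0// mul1r.
- by apply: bmeasM => //; exact: bmeas_zexp.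
- by apply: bmeasM => //; exact: bmeas_cst.
Qed.

(** Cauchy's formula, obtained by unrolling the recurrence
    F_(k - 1) = w_k + alpha F_k upwards from k = 0. *)
Lemma divide_coefN1 : fcoef F (-1) = L.
Proof.
have E N : fcoef F (-1) = \sum_(k < N) alpha ^+ k * fcoef w k
    + alpha ^+ N * fcoef F (N%:Z - 1).
  elim: N => [|N ih]; first by rewrite big_ord0 add0r mul1r sub0r.
  rewrite ih big_ord_recr/= -addrA; congr (_ + _).
  by rewrite -rec exprS (_ : N.+1%:Z - 1 = N)//; [ring|lia].
apply: (@ccvg_unique _ (fun=> fcoef F (-1))); first exact: ccvg_cst.
apply: ccvg_ext (fun N => esym (E N)) _.
rewrite -[L]addr0; apply: ccvgD => //.
have [_ [M FM]] := mF.
have lim0 : nc alpha ^+ N * (2 * M) @[N --> \oo] --> (0 : R).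
  rewrite -[X in _ --> X](mul0r (2 * M)); apply: cvgM; last exact: cvg_cst.
  by apply: cvg_expr; rewrite ger0_norm// nc_ge0.
have bnd N : nc (alpha ^+ N * fcoef F (N%:Z - 1)) <= nc alpha ^+ N * (2 * M).
  rewrite ncM ncX ler_wpM2l ?exprn_ge0 ?nc_ge0//.
  exact: nc_fcoef_le.
exact: ccvg0_le bnd lim0.
Qed.

Hypothesis L0 : L = 0.

(** The coefficient F_(- 1) vanishes by [divide_coefN1], and the recurrence
    F_(k - 1) = w_k + alpha F_k propagates this to all negative indices. *)
Lemma divide_hardy : hardy F.
Proof.
have [mw Ew w0] := hw; split => //.
  apply: (energy_mul mz zinj mw bmeas_cauchy Ew); exact: cauchy_lip.
elim=> [|n ih].
  by rewrite -L0 -divide_coefN1; congr fcoef.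
have := rec (Negz n); rewrite ih mulr0 subr0 w0.
by rewrite (_ : Negz n - 1 = Negz n.+1)//; lia.
Qed.

Let g x := (1 - alpha^*%C * z x) * F x.

Lemma divide_blaschke_hardy : hardy g.
Proof.
have := hardyD mz z1 zinj divide_hardy
  (hardyZ mz z1 zinj (- alpha^*%C) (hardy_zM mz z1 zinj divide_hardy)).
by congr (hardy _); apply/funext => x; rewrite /g; ring.
Qed.

Lemma nc_mobius x : nc (1 - alpha^*%C * z x) = nc (z x - alpha).
Proof.
have -> : 1 - alpha^*%C * z x = z x * (z x - alpha)^*%C.
  by rewrite conjB mulrBr mulcJ z1 expr1n mulrC.
by rewrite ncM z1 mul1r ncJ.
Qed.

Lemma divide_nc x : nc (g x) = nc (w x).
Proof.
rewrite /g /F !ncM ncV nc_mobius mulrA mulfV ?mul1r//.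
by rewrite nc_eq0 zsub_neq0.
Qed.

Lemma divideK x : w x = (z x - alpha) / (1 - alpha^*%C * z x) * g x.
Proof.
have g0 : 1 - alpha^*%C * z x != 0 by rewrite -nc_eq0 nc_mobius nc_eq0 zsub_neq0.
by rewrite /g mulrA divfK// /F mulrA mulfV ?mul1r ?zsub_neq0.
Qed.

Let coef_g k : fcoef g k = fcoef F k - alpha^*%C * fcoef F (k - 1).
Proof.
rewrite -(fcoef_zmul nu z1 F 1) -(fcoefZ nu mz z1); last first.
  by apply: bmeasM => //; exact: bmeas_zexp.
rewrite -(fcoefB nu mz z1)//; last first.
  by apply: bmeasM; [exact: bmeas_cst|apply: bmeasM => //; exact: bmeas_zexp].
by congr (cint _ _); apply/funext => x; rewrite /g expr1z; ring.
Qed.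

(** As w = (z - alpha) F and g = (1 - alpha^* z) F, one has
    |w_k|^2 - |g_k|^2 = (1 - |alpha|^2) (|F_(k - 1)|^2 - |F_k|^2), and the
    identity follows by summation by parts. *)
Lemma divide_dirichlet N :
  \sum_(k < N.+1) k%:R * sqn w k%:Z - \sum_(k < N.+1) k%:R * sqn g k%:Z =
  (1 - nc alpha ^+ 2) * (\sum_(k < N) sqn F k%:Z - N%:R * sqn F N%:Z).
Proof.
have E (k : nat) : sqn w k%:Z - sqn g k%:Z =
    (1 - nc alpha ^+ 2) * (sqn F (k%:Z - 1) - sqn F k%:Z).
  rewrite -rec coef_g !nc_sq !(cReD, cImD, cReM, cImM).
  move: (fcoef F (k%:Z - 1)) (fcoef F k%:Z) alpha => [a b] [a' b'] [p q] /=.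
  ring.
elim: N => [|N ih].
  by rewrite !big_ord_recl !big_ord0/= !mul0r !addr0 subr0 mulr0.
rewrite big_ord_recr [X in _ - X]big_ord_recr/= opprD addrACA ih -mulrBr E.
rewrite [in RHS]big_ord_recr/= (_ : N.+1%:Z - 1 = N)//; last by lia.
rewrite -natr1; ring.
Qed.

End divide.

(** With q := z / (z - alpha), on the unit circle
    (1 - |alpha|^2) / |z - alpha|^2 = q + q^* - 1, and the mean of q is 1 by
    Cauchy's formula for the constant 1. *)
Lemma cauchy_sqnorm : (1 - nc alpha ^+ 2) *
  sqnorm nu (fun x => (z x - alpha)^-1) = 1.
Proof.
have mc := bmeas_cauchy; have mcc := bmeasM mc (bmeasJ mc).
have mq : bmeas (fun x => (z x - alpha)^-1 * z x) by exact: bmeasM.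
have q1 : cint nu (fun x => (z x - alpha)^-1 * z x) = 1.
  have H : ccvg (fun N => \sum_(k < N) alpha ^+ k * fcoef (fun=> 1) k) 1.
    have := ccvg_delta (fun k => alpha ^+ k) 0; rewrite expr0.
    apply: ccvg_ext => N; apply: eq_bigr => k _.
    by rewrite fcoef_cst// mul1r mulrC eq_sym.
  have := divide_coefN1 (hardy_cst mz z1 cint_expz 1) H.
  rewrite /fcoef => <-; congr cint; apply/funext => x.
  by rewrite opprK expr1z mulr1.
suff : (((1 - nc alpha ^+ 2) *
  sqnorm nu (fun x => (z x - alpha)^-1))%:C%C : R[i]) = 1%:C%C by case.
rewrite rmorphM/= -cint_mulJ// -cintZ//.
transitivity (cint nu (fun x => (z x - alpha)^-1 * z x
    + ((z x - alpha)^-1 * z x)^*%C - 1)).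
  congr cint; apply/funext => x.
  have z0 := zsub_neq0 x; have zJ0 : (z x)^*%C - alpha^*%C != 0.
    by rewrite -conjB conjc_eq0.
  have zz : z x * (z x)^*%C = 1 by rewrite mulcJ z1 expr1n.
  have -> : (1 - nc alpha ^+ 2)%:C%C = 1 - alpha * alpha^*%C.
    by rewrite mulcJ rmorphB.
  rewrite conjc_inv conjM conjc_inv conjB.
  apply: (mulfI z0); apply: (mulfI zJ0).
  transitivity (z x * (z x)^*%C - alpha * alpha^*%C).
    by rewrite zz; field; rewrite zJ0.
  by field; rewrite zJ0.
rewrite cintB; [|by apply: bmeasD => //; exact: bmeasJ|exact: bmeas_cst].
by rewrite cintD ?cintJ ?q1 ?conjc1 ?cint_cst ?addrK//; exact: bmeasJ.
Qed.

End cauchy.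

(** By [divide_dirichlet], the loss is (1 - |alpha|^2) |w / (z - alpha)|^2,
    which is 1 by [cauchy_sqnorm] since |w| = 1.  The boundary term N |F_N|^2
    disappears because it is the general term of a convergent series, F having
    finite energy. *)
Lemma inner_divide w D alpha : inner w ->
  \sum_(k < N) k%:R * sqn w k%:Z @[N --> \oo] --> D ->
  nc alpha < 1 -> ccvg (fun N => \sum_(k < N) alpha ^+ k * fcoef w k) 0 ->
  exists g, [/\ inner g,
    \sum_(k < N) k%:R * sqn g k%:Z @[N --> \oo] --> D - 1 &
    forall x, w x = (z x - alpha) / (1 - alpha^*%C * z x) * g x].
Proof.
move=> [hw w1] wD a1 wa.
have hF := divide_hardy a1 hw wa erefl.
pose F x := (z x - alpha)^-1 * w x.
exists (fun x => (1 - alpha^*%C * z x) * F x); split.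
- split; first exact: divide_blaschke_hardy hw wa erefl.
  by move=> x; rewrite divide_nc.
- have [mF EF F0] := hF.
  have FS : (1 - nc alpha ^+ 2) * sqnorm nu F = 1.
    rewrite -[RHS](cauchy_sqnorm a1); congr (_ * _).
    by apply: eq_Rintegral => x _; rewrite /F ncM w1 mulr1.
  have L1 : \sum_(k < N) sqn F k%:Z @[N --> \oo] --> sqnorm nu F.
    have [L1 _] := parseval mz z1 zinj cint_expz hF.
    apply: cvg_trans L1; apply: near_eq_cvg; apply: nearW => N.
    by rewrite cRe_sum; apply: eq_bigr => k _; rewrite mulcJ.
  have L2 : N%:R * sqn F N%:Z @[N --> \oo] --> (0 : R).
    apply: (@cvg_series_cvg_0 _ R^o); apply: nondecreasing_is_cvgn.
      by apply: nondecreasing_series => n _ _; rewrite mulr_ge0// sqr_ge0.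
    exists (fine (energy F)) => _ [N _ <-].
    apply: le_trans (bisum_energy_le mz z1 zinj cint_expz N mF EF).
    rewrite /series/= big_mkord /bisum lerDl.
    by rewrite sumr_ge0// => k _; rewrite mulr_ge0// sqr_ge0.
  rewrite -cvg_shiftS/=.
  have -> : (fun N => \sum_(k < N.+1) k%:R *
      sqn (fun x => (1 - alpha^*%C * z x) * F x) k%:Z) =
    (fun N => \sum_(k < N.+1) k%:R * sqn w k%:Z -
      (1 - nc alpha ^+ 2) * (\sum_(k < N) sqn F k%:Z - N%:R * sqn F N%:Z)).
    by apply/funext => N; rewrite -(divide_dirichlet a1 hw)// opprB addrCA subrr addr0.
  rewrite -[X in _ --> D - X]FS -[X in _ --> D - _ * X]subr0.
  apply: cvgB.
    by rewrite (cvg_shiftS (fun N => \sum_(k < N) k%:R * sqn w k%:Z)).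
  by apply: cvgM; [exact: cvg_cst|exact: cvgB].
- by move=> x; rewrite [LHS](divideK a1 w).
Qed.

(** Parseval's identity for w and for w - c_0. *)
Lemma inner_const w : inner w -> (forall k : nat, fcoef w k.+1 = 0) ->
  nc (fcoef w 0) = 1 /\ {ae nu, forall x, w x = fcoef w 0}.
Proof.
move=> [hw w1] w0; have [mw Ew wn] := hw.
split.
  have [L1 _] := parseval mz z1 zinj cint_expz hw.
  rewrite inner_sqnorm// -cvg_shiftS/= in L1.
  have L2 : complex.Re (\sum_(k < N.+1) fcoef w k%:Z * (fcoef w k%:Z)^*%C)
      @[N --> \oo] --> nc (fcoef w 0) ^+ 2.
    rewrite [X in X @ _](_ : _ = fun=> nc (fcoef w 0) ^+ 2).
      exact: cvg_cst.
    apply/funext => N; rewrite big_ord_recl big1 ?addr0 => [|k _]; first by rewrite mulcJ.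
    by rewrite w0 mul0r.
  have /eqP : nc (fcoef w 0) ^+ 2 = 1 by exact: (cvg_unique _ L2 L1).
  by rewrite sqrf_eq1 => /orP[/eqP//|/eqP E]; have := nc_ge0 (fcoef w 0);
    rewrite E oppr_ge0 ler10.
have hc := hardyD mz z1 zinj hw (hardy_cst mz z1 cint_expz (- fcoef w 0)).
have [mc _ _] := hc.
have c0 (k : nat) : fcoef (fun x => w x + - fcoef w 0) k = 0.
  rewrite (fcoefD nu mz z1)//; last exact: bmeas_cst.
  rewrite fcoef_cst//; case: k => [|k]; first by rewrite mulr1 subrr.
  by rewrite w0 mulr0 addr0.
have : sqnorm nu (fun x => w x + - fcoef w 0) = 0.
  have [L1 _] := parseval mz z1 zinj cint_expz hc.
  apply: (cvg_unique _ L1) => //=.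
  rewrite [X in X @ _](_ : _ = fun=> 0); first exact: cvg_cst.
  by apply/funext => N; rewrite big1// => k _; rewrite c0 mul0r.
move=> /(sqnorm_eq0 mc); apply: filterS => x /eqP.
by rewrite subr_eq0 => /eqP.
Qed.

(** Induction on an integer above D: while w is not constant, it has a zero,
    whose removal lowers D by 1 and leaves D nonnegative. *)
Lemma inner_blaschke w D : inner w ->
  \sum_(k < N) k%:R * sqn w k%:Z @[N --> \oo] --> D ->
  exists (c : R[i]) (s : seq R[i]), [/\ D = (size s)%:R, nc c = 1,
    (forall a, a \in s -> nc a < 1) &
    {ae nu, forall x, w x =
       c * \prod_(a <- s) ((z x - a) / (1 - a^*%C * z x))}].
Proof.
move: w D; have const w D : inner w -> (forall k : nat, fcoef w k.+1 = 0) ->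
  \sum_(k < N) k%:R * sqn w k%:Z @[N --> \oo] --> D ->
  exists (c : R[i]) (s : seq R[i]), [/\ D = (size s)%:R, nc c = 1,
    (forall a, a \in s -> nc a < 1) &
    {ae nu, forall x, w x =
       c * \prod_(a <- s) ((z x - a) / (1 - a^*%C * z x))}].
  move=> iw w0 wD; have [c1 wc] := inner_const iw w0.
  exists (fcoef w 0), [::]; split => //.
    apply: (cvg_unique _ wD) => //=; rewrite -cvg_shiftS/=.
    rewrite [X in X @ _](_ : _ = fun=> 0); first exact: cvg_cst.
    have H (k : nat) : k%:R * sqn w k%:Z = 0.
      by case: k => [|k]; rewrite ?mul0r// w0 Normc.normc0 expr0n mulr0.
    by apply/funext => N; rewrite big1// => k _; exact: H.
  by apply: filterS wc => x ->; rewrite big_nil mulr1.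
move=> w D; have [m] : exists m : nat, D <= m%:R.
  by exists (Num.truncn D).+1; rewrite ltW// truncnS_gt.
elim: m w D => [|m ih] w D Dm iw wD.
  have [w0|[alpha a1 wa]] := inner_zero iw; first exact: const.
  have [g [_ gD _]] := inner_divide iw wD a1 wa.
  have : 0 <= D - 1.
    apply: (ler_cvg_to (cvg_cst 0) gD); apply: nearW => N.
    by rewrite sumr_ge0// => k _; rewrite mulr_ge0// sqr_ge0.
  by rewrite subr_ge0 => D1; have := le_trans D1 Dm; rewrite ler10.
have [w0|[alpha a1 wa]] := inner_zero iw; first exact: const.
have [g [ig gD wg]] := inner_divide iw wD a1 wa.
have [|c [s [Ds c1 sa gs]]] := ih g (D - 1) _ ig gD.
  by rewrite lerBlDr natr1.
exists c, (alpha :: s); split => //.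
- by rewrite /= -natr1 -Ds subrK.
- by move=> a; rewrite inE => /orP[/eqP ->|/sa].
- apply: filterS gs => x gx; rewrite wg gx big_cons; ring.
Qed.

End inner.

(** * Sums over the integers *)

Section two_sided_sums.
Context {R : realType}.
Implicit Types (b : int -> R) (e : R).

Lemma nneseries_lim_EFin (u : nat -> R) (l : R) :
  \sum_(k < N) u k @[N --> \oo] --> l ->
  (\sum_(0 <= k <oo) (u k)%:E = l%:E)%E.
Proof.
move=> ul; apply/cvg_lim => //.
rewrite [X in X @ _](_ : _ = EFin \o (fun N => \sum_(k < N) u k)).
  by apply/cvg_EFin => //; exact: nearW.
by apply/funext => N /=; rewrite sumEFin big_mkord.
Qed.

Lemma esum_half (a : int -> \bar R) (i : nat -> int) (u : nat -> R) (l : R) :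
  injective i -> (forall n, a (i n) = (u n)%:E) -> (forall n, 0 <= u n) ->
  (forall k, ~ range i k -> a k = 0%E) ->
  \sum_(k < N) u k @[N --> \oo] --> l ->
  (\esum_(k in [set: int]) a k = l%:E)%E.
Proof.
move=> iinj au u0 a0 ul.
rewrite -(nneseries_lim_EFin ul) nneseries_esumT; last first.
  by move=> n; rewrite lee_fin.
transitivity (\esum_(k in range i) a k)%E.
  rewrite [RHS]esum_mkcond; apply: eq_esum => k _.
  by case: ifPn => // /negP; rewrite inE => /a0.
rewrite esum_image//; last by move=> m n _ _; exact: iinj.
by apply: eq_esum => n _; rewrite au.
Qed.

Lemma zsum_split b P Q : (forall k, 0 <= b k) ->
  \sum_(k < N) k%:R * b k%:Z @[N --> \oo] --> P ->
  \sum_(k < N) k.+1%:R * b (Negz k) @[N --> \oo] --> Q ->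
  zsum (fun k => k%:~R * b k) = P - Q.
Proof.
move=> b0 bP bQ; rewrite /zsum.
have neg n : (Negz n)%:~R * b (Negz n) = - (n.+1%:R * b (Negz n)).
  by rewrite -mulNr; congr (_ * _); rewrite NegzE rmorphN.
set a : int -> \bar R := EFin \o _.
have -> : (\esum_(k in [set: int]) a^\+ k = P%:E)%E.
  apply: (@esum_half _ Posz (fun k => k%:R * b k%:Z)) => //.
  - by move=> m n [].
  - move=> n; rewrite funeposE; apply/max_idPl.
    by rewrite lee_fin mulr_ge0.
  - by move=> n; rewrite mulr_ge0.
  - move=> [n|n] kn; first by exfalso; apply: kn; exists n.
    rewrite funeposE; apply/max_idPr.
    by rewrite /a/= neg lee_fin oppr_le0 mulr_ge0.
have -> : (\esum_(k in [set: int]) a^\- k = Q%:E)%E.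
  apply: (@esum_half _ Negz (fun k => k.+1%:R * b (Negz k))) => //.
  - by move=> m n [].
  - move=> n; rewrite funenegE /a/= neg -?EFinN ?opprK; apply/max_idPl.
    by rewrite lee_fin mulr_ge0.
  - by move=> n; rewrite mulr_ge0.
  - move=> [n|n] kn; last by exfalso; apply: kn; exists n.
    rewrite funenegE; apply/max_idPr.
    by rewrite -EFinN lee_fin oppr_le0 mulr_ge0.
by rewrite -EFinB.
Qed.

Lemma zsum_bound b e : (forall k, 0 <= b k) ->
  (forall N, bisum (fun k => `|k|%:R * b k) N <= e) ->
  exists P Q, [/\ 0 <= P, 0 <= Q & P + Q <= e] /\
  [/\ \sum_(k < N) k%:R * b k%:Z @[N --> \oo] --> P,
    \sum_(k < N) k.+1%:R * b (Negz k) @[N --> \oo] --> Q &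
    zsum (fun k => k%:~R * b k) = P - Q].
Proof.
move=> b0 be.
have cv (u : nat -> R) : (forall n, 0 <= u n) ->
    (forall N, \sum_(k < N) u k <= e) ->
    exists l : R, \sum_(k < N) u k @[N --> \oo] --> l.
  move=> u0 ue; exists (limn (series u)).
  rewrite [X in X @ _ --> _](_ : _ = series u).
    apply: nondecreasing_is_cvgn.
      by apply: nondecreasing_series => n _ _; exact: u0.
    by exists e => _ [N _ <-]; rewrite /series/= big_mkord.
  by apply/funext => N; rewrite /series/= big_mkord.
have p0 (k : nat) : 0 <= k%:R * b k%:Z by rewrite mulr_ge0.
have q0 (k : nat) : 0 <= k.+1%:R * b (Negz k) by rewrite mulr_ge0.
have [|P hP] := cv (fun k => k%:R * b k%:Z) p0.
  by move=> N; apply: le_trans (be N); rewrite lerDl sumr_ge0// => k _; exact: q0.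
have [|Q hQ] := cv (fun k => k.+1%:R * b (Negz k)) q0.
  by move=> N; apply: le_trans (be N); rewrite lerDr sumr_ge0// => k _; exact: p0.
exists P, Q; split; split => //.
- apply: (ler_cvg_to (cvg_cst 0) hP); apply: nearW => N.
  by rewrite sumr_ge0.
- apply: (ler_cvg_to (cvg_cst 0) hQ); apply: nearW => N.
  by rewrite sumr_ge0.
- apply: (ler_cvg_to (cvgD hP hQ) (cvg_cst e)); exact: nearW.
- exact: zsum_split.
Qed.

Lemma nonneg_series0 (u : nat -> R) : (forall n, 0 <= u n) ->
  \sum_(k < N) u k @[N --> \oo] --> (0 : R) -> forall n, u n = 0.
Proof.
move=> u0 ul n; apply/eqP; rewrite eq_le u0 andbT.
apply: (ler_cvg_to (cvg_cst (u n)) ul); near=> N.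
have nN : (n < N)%N by near: N; exact: nbhs_infty_gt.
by rewrite (bigD1 (Ordinal nN))//= lerDl sumr_ge0.
Unshelve. all: by end_near. Qed.

End two_sided_sums.

(** * Densities *)

Section density.
Context {R : realType} {d : measure_display} {T : measurableType d}.
Variables (m : {sigma_finite_measure set T -> \bar R})
          (nu : probability T R) (rho : T -> R).
Hypothesis mrho : measurable_fun setT rho.
Hypothesis rho0 : forall x, 0 <= rho x.
Hypothesis nuE : forall A, measurable A -> nu A = (\int[m]_(x in A) (rho x)%:E)%E.

Lemma density_null (A : set T) : measurable A -> m A = 0%E -> nu A = 0%E.
Proof.
move=> mA A0; rewrite nuE//; apply: null_set_integral => //.
by apply: measurable_funTS; exact/measurable_EFinP.
Qed.

(** The function rho is almost everywhere the Radon-Nikodym derivative of nu. *)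
Lemma ge0_integral_density (f : T -> \bar R) :
  (forall x, (0 <= f x)%E) -> measurable_fun setT f ->
  (\int[nu]_x f x = \int[m]_x (f x * (rho x)%:E))%E.
Proof.
move=> f0 mf.
have mrE : measurable_fun setT (EFin \o rho) by exact/measurable_EFinP.
have dom : nu `<< m.
  by apply/null_content_dominatesP => A mA A0; exact: density_null.
rewrite -(Radon_Nikodym_SigmaFinite.change_of_variables dom)//.
have mRN : measurable_fun setT (Radon_Nikodym_SigmaFinite.f nu m).
  exact: measurable_int (Radon_Nikodym_SigmaFinite.f_integrable dom).
apply: ae_eq_integral => //.
- exact: emeasurable_funM.
- exact: emeasurable_funM.
- apply: ae_eqe_mul2l; apply: integral_ae_eq => //.
    exact: Radon_Nikodym_SigmaFinite.f_integrable.
  move=> E _ mE.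
  by rewrite -(Radon_Nikodym_SigmaFinite.f_integral dom)//; exact: nuE.
Qed.

Lemma ge0_integral_density2 (K : T * T -> \bar R) :
  (forall p, (0 <= K p)%E) -> measurable_fun setT K ->
  (\int[nu \x nu]_p K p =
   \int[m \x m]_p (K p * (rho p.2)%:E * (rho p.1)%:E))%E.
Proof.
move=> K0 mK.
have mKx x : measurable_fun setT (fun y => K (x, y)) by exact: measurableT_comp.
have mrE : measurable_fun setT (EFin \o rho) by exact/measurable_EFinP.
have mr1 : measurable_fun setT (fun p : T * T => (rho p.1)%:E).
  exact: (measurableT_comp mrE measurable_fst).
have mr2 : measurable_fun setT (fun p : T * T => (rho p.2)%:E).
  exact: (measurableT_comp mrE measurable_snd).
rewrite (@fubini_tonelli1 _ _ T T R nu nu K mK K0).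
rewrite (@fubini_tonelli1 _ _ T T R m m)//; last 2 first.
- by apply: emeasurable_funM => //; exact: emeasurable_funM.
- by move=> p; rewrite !mule_ge0// lee_fin.
rewrite ge0_integral_density//; last 2 first.
- by move=> x; apply: integral_ge0.
- exact: (measurable_fun_fubini_tonelli_F K).
apply: eq_integral => x _; rewrite /fubini_F ge0_integral_density//.
rewrite -ge0_integralZr//.
- exact: emeasurable_funM.
- by move=> y _; rewrite mule_ge0// lee_fin.
- by rewrite lee_fin.
Qed.

(** As rho is positive, a set of integral 0 for rho is of measure 0 for m. *)
Lemma density_ae (P : T -> Prop) : (forall x, 0 < rho x) ->
  {ae nu, forall x, P x} -> {ae m, forall x, P x}.
Proof.
move=> rhop [N [mN N0 PN]]; exists N; split => //.
have mrE : measurable_fun N (EFin \o rho).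
  by apply: measurable_funTS; exact/measurable_EFinP.
have : (\int[m]_(x in N) `|(EFin \o rho) x| = 0)%E.
  rewrite -[RHS]N0 nuE//; apply: eq_integral => x _ /=.
  by rewrite ger0_norm.
move/(ae_eq_integral_abs m mN mrE) => [M [mM M0 NM]].
apply: (subset_measure0 mN mM _ M0) => x Nx; apply: NM => /(_ Nx)/=.
by move=> [] /eqP; rewrite gt_eqF.
Qed.

End density.

(** * The Cauchy distribution *)

Section cauchy_distribution.
Context {R : realType}.
Local Notation leb := (@completed_lebesgue_measure R).
Local Notation L := (lebesgueType R).

(** The density of the image of the normalised arc length by [stereo_inv]. *)
Definition cauchy_pdf (x : R) : R := (pi * (1 + x ^+ 2))^-1.

Lemma cauchy_pdf_gt0 x : 0 < cauchy_pdf x.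
Proof. by rewrite invr_gt0 mulr_gt0 ?pi_gt0// ltr_wpDr ?sqr_ge0. Qed.

Lemma borel_lebesgue (A : set R) :
  measurable (A : set (measurableTypeR R)) -> measurable (A : set L).
Proof. exact: sub_caratheodory. Qed.

Lemma measurable_id_lebesgue :
  measurable_fun [set: L] (idfun : L -> measurableTypeR R).
Proof. by move=> _ A mA; rewrite setTI; exact: borel_lebesgue. Qed.

Lemma measurable_borel_lebesgue (f : R -> R) :
  measurable_fun [set: measurableTypeR R] f -> measurable_fun [set: L] f.
Proof.
move=> mf; exact: (measurableT_comp mf measurable_id_lebesgue).
Qed.

Lemma ge0_integral_borel (D : set R) (f : R -> \bar R) :
  measurable (D : set (measurableTypeR R)) ->
  measurable_fun (D : set (measurableTypeR R)) f ->
  (forall x, D x -> (0 <= f x)%E) ->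
  (\int[leb]_(x in D) f x = \int[@lebesgue_measure R]_(x in D) f x)%E.
Proof.
move=> mD mf f0; apply/esym.
apply: (ge0_integral_pushforward measurable_id_lebesgue leb mD mf).
by move=> x; rewrite inE; exact: f0.
Qed.

Lemma continuous_cauchy_pdf : continuous cauchy_pdf.
Proof.
move=> x; apply: cvgV.
  by rewrite gt_eqF// mulr_gt0 ?pi_gt0// ltr_wpDr ?sqr_ge0.
apply: cvgM; first exact: cvg_cst.
by apply: cvgD; [exact: cvg_cst|exact: exprn_continuous].
Qed.

Lemma measurable_cauchy_pdf : measurable_fun [set: measurableTypeR R] cauchy_pdf.
Proof. exact: continuous_measurable_fun continuous_cauchy_pdf. Qed.

Let mpdf : measurable_fun [set: L] cauchy_pdf.
Proof. exact: measurable_borel_lebesgue measurable_cauchy_pdf. Qed.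

Lemma integral_cauchy_pdf (a b : R) : a < b ->
  (\int[leb]_(x in `]a, b]) (cauchy_pdf x)%:E = ((atan b - atan a) / pi)%:E)%E.
Proof.
move=> ab; rewrite ge0_integral_borel//; first last.
- by move=> x _; rewrite lee_fin ltW// cauchy_pdf_gt0.
- by apply: measurable_funTS; apply/measurable_EFinP; exact: measurable_cauchy_pdf.
rewrite integral_itv_obnd_cbnd//; last first.
  by apply: measurable_funTS; apply/measurable_EFinP; exact: measurable_cauchy_pdf.
rewrite (@continuous_FTC2 _ _ (pi^-1 \*: (@atan R)))//.
- by rewrite -EFinB /= -scalerBr /GRing.scale/= mulrC.
- exact/continuous_subspaceT/continuous_cauchy_pdf.
- split.
  + by move=> x _; exact: ex_derive.
  + apply: cvgZr; apply: cvg_at_right_filter; exact: continuous_atan.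
  + apply: cvgZr; apply: cvg_at_left_filter; exact: continuous_atan.
- by move=> x _; rewrite derive1E derive_val /cauchy_pdf invfM.
Qed.

Definition cauchy_prob (A : set L) : \bar R :=
  (\int[leb]_(x in A) (cauchy_pdf x)%:E)%E.

Let cauchy0 : cauchy_prob set0 = 0%E.
Proof. by rewrite /cauchy_prob integral_set0. Qed.

Let cauchy_ge0 A : (0 <= cauchy_prob A)%E.
Proof. by apply: integral_ge0 => x _; rewrite lee_fin ltW// cauchy_pdf_gt0. Qed.

Let cauchy_sigma_additive : semi_sigma_additive cauchy_prob.
Proof.
move=> /= F mF tF mUF; rewrite /cauchy_prob; apply: cvg_toP.
  apply: ereal_nondecreasing_is_cvgn => m n mn.
  apply: lee_sum_nneg_natr => // k _ _; exact: cauchy_ge0.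
rewrite (ge0_integral_bigcup leb mF _ _ tF).
- exact: erefl.
- by apply: measurable_funTS; exact/measurable_EFinP.
- by move=> x _; rewrite lee_fin ltW// cauchy_pdf_gt0.
Qed.

HB.instance Definition _ := isMeasure.Build _ _ _ cauchy_prob
  cauchy0 cauchy_ge0 cauchy_sigma_additive.

Let cauchy_setT : cauchy_prob [set: L] = 1%E.
Proof.
have tT : \bigcup_n `](- n%:R : R), n%:R]%classic = [set: R].
  exact: bigcup_itvT.
have cv : cauchy_prob `](- n%:R : R), n%:R]%classic @[n --> \oo] -->
    cauchy_prob [set: L].
  rewrite -tT; apply: nondecreasing_cvg_mu => //.
  - by move=> n; apply: borel_lebesgue; exact: measurable_itv.
  - by rewrite tT.
  - move=> m n mn; apply/subsetPset => x /=; rewrite !in_itv/= => /andP[xm mx].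
    by rewrite (le_lt_trans _ xm) ?lerN2 ?ler_nat//= (le_trans mx)// ler_nat.
apply: (cvg_unique _ cv) => //.
have E : \forall n \near \oo, (2 * atan (n%:R : R) / pi)%:E =
    cauchy_prob `](- n%:R : R), n%:R]%classic.
  near=> n; rewrite [RHS]integral_cauchy_pdf.
    by rewrite atanN opprK mulr_natl.
  by rewrite gtrN// ltr0n; near: n; exact: nbhs_infty_gt.
apply: cvg_trans (near_eq_cvg E) _.
apply/cvg_EFin; first exact: nearW.
rewrite [X in _ --> X](_ : 1 = 2 * (pi / 2) / pi); last first.
  have E1 (p : R) : p != 0 -> 1 = 2 * (p / 2) / p by move=> p0; field.
  by apply: E1; rewrite gt_eqF ?pi_gt0.
apply: cvgM; last exact: cvg_cst.
apply: cvgM; first exact: cvg_cst.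
exact: (cvg_comp _ _ (@cvgr_idn R) (@cvgy_atan R)).
Unshelve. all: by end_near. Qed.

HB.instance Definition _ :=
  @Measure_isProbability.Build _ _ R cauchy_prob cauchy_setT.

Lemma ge0_integral_cauchy2 (K : L * L -> \bar R) :
  (forall p, (0 <= K p)%E) -> measurable_fun setT K ->
  (\int[cauchy_prob \x cauchy_prob]_p K p =
   \int[leb \x leb]_p (K p * (cauchy_pdf p.2)%:E * (cauchy_pdf p.1)%:E))%E.
Proof.
move=> K0 mK; apply: (@ge0_integral_density2 _ _ _ leb cauchy_prob cauchy_pdf) => //.
by move=> x; rewrite ltW ?cauchy_pdf_gt0.
Qed.

Lemma cauchy_ae (P : L -> Prop) :
  {ae cauchy_prob, forall x, P x} -> {ae leb, forall x, P x}.
Proof.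
apply: (@density_ae _ _ _ leb cauchy_prob cauchy_pdf) => //.
  by move=> x; rewrite ltW ?cauchy_pdf_gt0.
exact: cauchy_pdf_gt0.
Qed.

Lemma cauchy_null (A : set L) : measurable A -> leb A = 0%E ->
  cauchy_prob A = 0%E.
Proof.
by apply: (@density_null _ _ _ leb cauchy_prob cauchy_pdf).
Qed.

End cauchy_distribution.

(** * Stereographic projection in terms of the angle *)

Section stereographic_angle.
Context {R : realType}.
Local Notation leb := (@completed_lebesgue_measure R).
Local Notation L := (lebesgueType R).

(** At the pole t = pi / 2 the value is 0, by division by zero. *)
Definition angle_pt (t : R) : R := stereo_inv (expi t).

Lemma angle_ptE t : angle_pt t = cos t / (1 - sin t).
Proof. by []. Qed.

(** Half-angle formulas, with t = 2 s - pi / 2. *)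
Lemma angle_pt_tan s : angle_pt (s *+ 2 - pi / 2) = tan s.
Proof.
rewrite angle_ptE cosBpihalf sinBpihalf opprK sin_mulr2n cos_mulr2n addrC subrK.
rewrite /tan; have [->|c0] := eqVneq (cos s) 0.
  by rewrite mul0r mul0rn mul0r invr0 mulr0.
by field.
Qed.

Lemma pi_half_lt : (0 : R) < pi / 2.
Proof. by rewrite divr_gt0 ?pi_gt0. Qed.

(** The half angle t / 2 + pi / 4 leaves the interval ]- pi / 2, pi / 2[, in
    which the arctangent inverts the tangent, when t reaches the pole pi / 2;
    hence one formula before the pole and one after it. *)
Lemma atan_angle_pt_l t : 0 <= t -> t < pi / 2 ->
  2 * atan (angle_pt t) = t + pi / 2.
Proof.
move=> t0 tp; have p0 := pi_half_lt; pose s := (t + pi / 2) / 2.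
have ts : t = s *+ 2 - pi / 2 by rewrite /s; field.
rewrite {1}ts angle_pt_tan tanK; first by rewrite /s; field.
by rewrite in_itv/= /s; apply/andP; split; lra.
Qed.

Lemma atan_angle_pt_r t : pi / 2 < t -> t <= 2 * pi ->
  2 * atan (angle_pt t) = t - 3 * (pi / 2).
Proof.
move=> tp t2; have p0 := pi_half_lt; pose s := (t - 3 * (pi / 2)) / 2.
have ts : t = (s + pi) *+ 2 - pi / 2 by rewrite /s; field.
rewrite {1}ts angle_pt_tan tanDpi tanK; first by rewrite /s; field.
by rewrite in_itv/= /s; apply/andP; split; lra.
Qed.

Lemma expi_neqi t : 0 <= t -> t <= 2 * pi -> t != pi / 2 -> expi t != 'i%C :> R[i].
Proof.
move=> t0 t2 tp; have p0 := pi_half_lt; apply/eqP => -[c0 s1].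
have : angle_pt t = 0 by rewrite angle_ptE c0 mul0r.
move: tp; rewrite neq_lt => /orP[tp|tp] x0.
  have := atan_angle_pt_l t0 tp; rewrite x0 atan0 mulr0; lra.
have := atan_angle_pt_r tp t2; rewrite x0 atan0 mulr0 => E.
have tE : t = pi / 2 + pi by lra.
by move: s1; rewrite tE sinDpi sin_pihalf; lra.
Qed.

Lemma stereo_angle_pt t : 0 <= t -> t <= 2 * pi -> t != pi / 2 ->
  stereo (angle_pt t) = expi t.
Proof.
move=> t0 t2 tp; apply: stereo_invK; last exact: expi_neqi.
by rewrite /= cos2Dsin2 sqrtr1.
Qed.

Lemma measurable_angle_pt : measurable_fun [set: measurableTypeR R] angle_pt.
Proof.
have -> : angle_pt = fun t => cos t * (1 - sin t)^-1 by apply/funext.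
apply: measurable_funM.
  exact: continuous_measurable_fun (@continuous_cos R).
apply: measurable_inv_fun; apply: measurable_funB => //.
exact: continuous_measurable_fun (@continuous_sin R).
Qed.

Let D : set R := `[0, 2 * pi]%classic.

Let mD : measurable (D : set L).
Proof. by apply: borel_lebesgue; exact: measurable_itv. Qed.

Lemma leb_itvoc (x y : R) : x <= y -> leb `]x, y]%classic = (y - x)%:E.
Proof.
move=> xy; transitivity (@lebesgue_measure R `]x, y]%classic); first by [].
rewrite lebesgue_measure_itv/= lte_fin; case: ltP => // yx.
by rewrite (_ : y = x) ?subrr//; apply/eqP; rewrite eq_le xy yx.
Qed.

Lemma leb_null_setD (A N : set L) : measurable A -> measurable N ->
  leb N = 0%E -> leb (A `\` N) = leb A.
Proof.
move=> mA mN N0; rewrite [RHS](@measureDI _ _ _ leb A N)//.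
rewrite [X in (_ + X)%E](_ : _ = 0%E) ?adde0//.
apply: (subset_measure0 _ mN _ N0); first exact: measurableI.
by move=> x [].
Qed.

Lemma leb_set1 r : leb [set r] = 0%E.
Proof. exact: (@lebesgue_measure_set1 R r). Qed.

Lemma measurable_leb_set1 r : measurable ([set r] : set L).
Proof. exact: borel_lebesgue. Qed.

Lemma measurable_leb_itv (i : interval R) : measurable ([set` i] : set L).
Proof. by apply: borel_lebesgue; exact: measurable_itv. Qed.

(** The cut at 0 raises an end point of the first interval by what the cut at
    2 pi takes off the corresponding end point of the second one. *)
Let cut_lengths (x : R) : Num.max (x - pi / 2) 0 +
  Num.min (x + 3 * (pi / 2)) (2 * pi) = x + 3 * (pi / 2).
Proof.
pose y := x - pi / 2; have -> : x + 3 * (pi / 2) = y + 2 * pi.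
  by rewrite /y; field.
by rewrite -/y -[X in Num.min _ X]add0r -addr_minl addrA addr_max_min addr0.
Qed.

(** By the two formulas for the arctangent of [angle_pt t], the preimage is a
    union of two intervals, one before the pole and one after it. *)
Lemma leb_angle_pt a b : a < b ->
  leb (angle_pt @^-1` `]a, b] `&` D) = (2 * atan b - 2 * atan a)%:E.
Proof.
move=> ab; have p0 := pi_half_lt.
have atab : 2 * atan a < 2 * atan b by rewrite ltr_pM2l// lt_atan.
(* The intervals before and after the pole, cut off at 0 and at 2 pi; they
   describe the preimage outside of the set N of the points 0 and pi / 2. *)
pose A1 : set R := `]Num.max (2 * atan a - pi / 2) 0,
  Num.max (2 * atan b - pi / 2) 0]%classic.
pose A2 : set R := `]Num.min (2 * atan a + 3 * (pi / 2)) (2 * pi),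
  Num.min (2 * atan b + 3 * (pi / 2)) (2 * pi)]%classic.
have ba : 2 * atan b < pi by have := atan_ltpi2 b; lra.
have aa : - pi < 2 * atan a by have := atan_gtNpi2 a; lra.
pose N : set R := [set 0] `|` [set pi / 2].
have m1 : measurable (A1 : set L) by exact: measurable_leb_itv.
have m2 : measurable (A2 : set L) by exact: measurable_leb_itv.
have mN : measurable (N : set L).
  by apply: measurableU; exact: measurable_leb_set1.
have N0 : leb N = 0%E.
  apply/eqP; rewrite eq_le measure_ge0 andbT.
  have : (leb N <= leb [set 0%R] + leb [set (pi / 2)%R])%E.
    by apply: measureU2; exact: measurable_leb_set1.
  by rewrite [X in (X + _)%E]leb_set1 [X in (_ + X)%E]leb_set1 adde0.
have mP : measurable (angle_pt @^-1` `]a, b] `&` D : set L).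
  apply: measurableI => //.
  have := measurable_borel_lebesgue measurable_angle_pt measurableT.
  by move=> /(_ _ (measurable_itv `]a, b])); rewrite setTI.
have inv (t : R) : a < angle_pt t <= b =
    (2 * atan a < 2 * atan (angle_pt t) <= 2 * atan b).
  have ai : {mono (@atan R) : x y / x <= y} by exact: le_mono (@lt_atan R).
  by rewrite ltr_pM2l// ler_pM2l// ai (leW_mono ai).
have E : (angle_pt @^-1` `]a, b] `&` D) `\` N = (A1 `|` A2) `\` N.
  apply/seteqP; split => t /= [].
    rewrite /D/= !in_itv/= inv => -[ht /andP[t0 t2]] tN.
    split=> //; have t0' : 0 < t.
      rewrite lt_neqAle t0 andbT eq_sym; apply/eqP => te; apply: tN; by left.
    have : t != pi / 2 by apply/eqP => te; apply: tN; right.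
    rewrite neq_lt => /orP[tp|tp]; [left|right].
      rewrite (atan_angle_pt_l t0 tp) in ht.
      rewrite /A1/= in_itv/= gt_max le_max t0'/= andbT.
      move: ht => /andP[h1 h2]; apply/andP; split; first by lra.
      by apply/orP; left; lra.
    rewrite (atan_angle_pt_r tp t2) in ht; move: ht => /andP[h1 h2].
    rewrite /A2/= in_itv/= gt_min le_min t2 andbT.
    by apply/andP; split; [apply/orP; left; lra|lra].
  move=> h tN; split => //; move: h => [].
    rewrite /A1/= in_itv/= gt_max le_max => /andP[/andP[h1 t0]] /orP[h2|]; last first.
      by rewrite leNgt t0.
    rewrite /D/= !in_itv/= inv atan_angle_pt_l; [|lra|lra].
    by split; apply/andP; split; lra.
  rewrite /A2/= in_itv/= gt_min le_min => /andP[/orP[h1|h1]] /andP[h2 h3]; last lra.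
  rewrite /D/= !in_itv/= inv atan_angle_pt_r; [|lra|lra].
  by split; apply/andP; split; lra.
rewrite -(leb_null_setD mP mN N0) [X in leb X]E leb_null_setD//; last exact: measurableU.
rewrite measureU//; last first.
  rewrite -subset0 => t /= []; rewrite /A1 /A2/= !in_itv/=.
  rewrite gt_max le_max gt_min le_min.
  move=> /andP[/andP[h1 t0]] /orP[h2|]; last by rewrite leNgt t0.
  by move=> /andP[/orP[h3|h3]] /andP[h4 h5]; lra.
rewrite [X in (X + _)%E]leb_itvoc; last by rewrite le_max2// lerD2r ltW.
rewrite [X in (_ + X)%E]leb_itvoc; last by rewrite le_min2// lerD2r ltW.
rewrite -EFinD; congr (_%:E).
rewrite addrACA -opprD !cut_lengths; ring.
Qed.

Let lam := mrestr leb mD.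

Let two_pi : {nonneg R} := NngNum (mulr_ge0 (ler0n R 2) (pi_ge0 R)).

Let image_measure := measure_function_pushforward__canonical__measure_function_Measure.

(** Measures on the Borel sets that agree, and are finite, on half-open
    intervals. *)
Let image_borel (A : set R) : measurable (A : set (measurableTypeR R)) ->
  leb (angle_pt @^-1` A `&` D) = ((2 * pi)%:E * cauchy_prob A)%E.
Proof.
pose m1 := image_measure lam (measurable_borel_lebesgue measurable_angle_pt :
  measurable_fun [set: L] (angle_pt : L -> measurableTypeR R)).
pose m2 := mscale two_pi (image_measure cauchy_prob (@measurable_id_lebesgue R)).
move=> mA; apply: (@measure_unique _ _ (measurableTypeR R)
  (R.-ocitv.-measurable) (fun n => `](- n%:R : R), n%:R]%classic) _ _ _ _ m1 m2) => //.
- exact: ocitvI.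
- by move=> n; exact: is_ocitv.
- exact: bigcup_itvT.
- move=> _ [[a b] _ <-].
  have [ab|ba] := ltP a b; last first.
    by rewrite set_itv_ge ?measure0//= bnd_simp -leNgt.
  rewrite [LHS](leb_angle_pt ab).
  rewrite -[RHS]/((2 * pi)%:E * cauchy_prob `]a, b]%classic)%E.
  rewrite /cauchy_prob (integral_cauchy_pdf ab) -EFinM; congr (_%:E).
  by rewrite mulrACA mulrC mulrA mulfK ?gt_eqF ?pi_gt0// mulrC mulrBr.
- move=> n; apply: le_lt_trans (_ : leb D < +oo)%E.
    have mP : measurable (angle_pt @^-1` `](- n%:R), n%:R] `&` D : set L).
      apply: measurableI => //.
      have := measurable_borel_lebesgue measurable_angle_pt measurableT.
      by move=> /(_ _ (measurable_itv `](- n%:R), n%:R])); rewrite setTI.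
    apply: (@le_measure _ _ _ leb).
    - exact: mem_set.
    - exact: mem_set.
    - by move=> x [].
  rewrite [X in (X < _)%E](_ : _ = @lebesgue_measure R D)//.
  by rewrite lebesgue_measure_itv/=; case: ifP; rewrite ?ltry// -EFinB ltry.
Qed.

(** A Lebesgue measurable set is the union of a Borel set and a part of a Borel
    null set, and the preimage of the latter is null by [image_borel]. *)
Lemma leb_angle_preimage (A : set L) : measurable A ->
  measurable (angle_pt @^-1` A `&` D : set L) /\
  leb (angle_pt @^-1` A `&` D) = ((2 * pi)%:E * cauchy_prob A)%E.
Proof.
have mpre B : measurable (B : set (measurableTypeR R)) ->
    measurable (angle_pt @^-1` B `&` D : set L).
  move=> mB; apply: measurableI => //.
  have := measurable_borel_lebesgue measurable_angle_pt measurableT.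
  by move=> /(_ _ mB); rewrite setTI.
move=> mA; have : (completed_algebra_gen (@lebesgue_measure R)).-sigma.-measurable A.
  by rewrite completed_caratheodory_measurable.
rewrite g_sigma_completed_algebra_genE => -[B mB [N [M [mM M0 NM]]] AE].
have leM : measurable (M : set L) by exact: borel_lebesgue.
have pM0 : leb (angle_pt @^-1` M `&` D) = 0%E.
  by rewrite image_borel// cauchy_null// mule0.
have negN : leb.-negligible (angle_pt @^-1` N `&` D).
  exists (angle_pt @^-1` M `&` D); split => //; first exact: mpre.
  by move=> x [/NM ? ?].
have mN : measurable (angle_pt @^-1` N `&` D : set L).
  exact: completed_lebesgue_measure_is_complete.
have PE : angle_pt @^-1` A `&` D =
    (angle_pt @^-1` B `&` D) `|` (angle_pt @^-1` N `&` D).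
  by rewrite -AE preimage_setU setIUl.
split; first by rewrite PE; apply: measurableU => //; exact: mpre.
have negN' : leb.-negligible N by exists M.
have mN' : measurable (N : set L) by exact: completed_lebesgue_measure_is_complete.
have N0 : cauchy_prob N = 0%E.
  by apply: cauchy_null => //; exact: (measure_negligible mN' negN').
have pN0 : leb (angle_pt @^-1` N `&` D) = 0%E by exact: measure_negligible.
have e1 : leb ((angle_pt @^-1` B `&` D) `|` (angle_pt @^-1` N `&` D)) =
    leb (angle_pt @^-1` B `&` D).
  by apply: measureU0 => //; exact: mpre.
have e2 : cauchy_prob (B `|` N) = cauchy_prob B.
  by apply: measureU0 => //; exact: borel_lebesgue.
by rewrite PE e1 image_borel// -AE e2.
Qed.

(** A modification of [angle_pt] off [0, 2 pi] which is measurable on the whole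
    line for Lebesgue measurable sets, and thus can push measures forward. *)
Definition clipped_pt (t : L) : L := if t \in D then angle_pt t else 0.

Let measurable_clipped_pt : measurable_fun [set: L] clipped_pt.
Proof.
move=> _ A mA; rewrite setTI.
have [mAD _] := leb_angle_preimage mA.
rewrite (_ : _ @^-1` _ = (angle_pt @^-1` A `&` D) `|`
    (if 0 \in A then ~` D else set0)).
  by apply: measurableU => //; case: ifP => // _; exact: measurableC.
apply/seteqP; split => t; rewrite /preimage/= /clipped_pt.
  case: ifPn => [/set_mem tD At|/negP tD At]; [by left|right].
  by rewrite mem_set//= => tD'; apply: tD; rewrite inE.
move=> [[At tD]|]; first by rewrite mem_set.
case: ifPn => // /set_mem A0 /= tD; rewrite ifN//.
by apply/negP => /set_mem.
Qed.

Lemma ge0_integral_angle (h : L -> \bar R) : measurable_fun setT h ->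
  (forall x, (0 <= h x)%E) ->
  (\int[leb]_(t in `[0%R, (2 * pi)%R]) h (angle_pt t) =
   (2 * pi)%:E * \int[cauchy_prob]_x h x)%E.
Proof.
move=> mh h0.
have cD t : D t -> clipped_pt t = angle_pt t.
  by move=> tD; rewrite /clipped_pt mem_set.
transitivity (\int[leb]_(t in D) (h \o clipped_pt) t)%E.
  by apply: eq_integral => t /set_mem tD; rewrite /= cD.
transitivity (\int[lam]_(t in D) (h \o clipped_pt) t)%E.
  apply: eq_measure_integral => A mA AD.
  exact: (esym (congr1 leb (setIidl AD))).
have mc : measurable_fun setT (h \o clipped_pt) by exact: measurableT_comp.
transitivity (\int[lam]_t (h \o clipped_pt) t)%E.
  rewrite [RHS](@ge0_negligible_integral _ _ _ lam setT (~` D) (h \o clipped_pt))//.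
  - by rewrite setTD setCK.
  - exact: measurableC.
  - by move=> x _; exact: h0.
  - by rewrite -[LHS]/(leb (~` D `&` D)) setICl measure0.
rewrite -(@ge0_integral_pushforward _ _ _ _ _ _ measurable_clipped_pt lam setT h)//.
rewrite -(@ge0_integral_mscale _ _ _ cauchy_prob setT measurableT two_pi)//.
apply: (@eq_measure_integral _ _ _ setT _ (image_measure lam measurable_clipped_pt)).
move=> A mA _; have [_ AE] := leb_angle_preimage mA.
rewrite -[RHS]/((2 * pi)%:E * cauchy_prob A)%E -AE.
rewrite -[LHS]/(leb (clipped_pt @^-1` A `&` D)).
congr (leb _); apply/seteqP; split => t [].
  by rewrite /preimage/= => At tD; split => //; rewrite -cD.
by rewrite /preimage/= => At tD; split => //; rewrite cD.
Qed.

Lemma measurable_comp_angle (h : L -> R) : measurable_fun setT h ->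
  measurable_fun (D : set L) (h \o angle_pt).
Proof.
move=> mh; apply: (@eq_measurable_fun _ _ _ _ _ (h \o clipped_pt)).
  by move=> t tD; rewrite /= /clipped_pt tD.
by apply: measurable_funTS; exact: measurableT_comp.
Qed.

Lemma Rintegral_angle (h : L -> R) : measurable_fun setT h ->
  cauchy_prob.-integrable setT (EFin \o h) ->
  \int[leb]_(t in `[0, 2 * pi]) h (angle_pt t) =
  2 * pi * \int[cauchy_prob]_x h x.
Proof.
move=> mh ih.
have mhE : measurable_fun setT (EFin \o h) by exact/measurable_EFinP.
rewrite /Rintegral -[X in _ = X * _]/(fine (2 * pi)%:E) -fineM//; last first.
  exact: integrable_fin_num.
congr fine.
rewrite integralE [in RHS]integralE.
have ip := integrable_fin_num measurableT (integrable_funepos measurableT ih).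
have im := integrable_fin_num measurableT (integrable_funeneg measurableT ih).
rewrite muleBr//; last by rewrite fin_num_adde_defr.
rewrite -(ge0_integral_angle (measurable_funepos mhE))//.
rewrite -(ge0_integral_angle (measurable_funeneg mhE))//.
by congr (_ - _)%E; apply: eq_integral => x _; rewrite ?funeposE ?funenegE.
Qed.

Lemma cintegral_angle (f : L -> R[i]) : bmeas f ->
  cintegral `[0, 2 * pi]%classic (f \o angle_pt) =
  (2 * pi)%:C%C * cint cauchy_prob f.
Proof.
move=> mf; have [[f1 f2] _] := mf.
apply: eqC_ReIm; rewrite ?cReM ?cImM/= !mul0r ?subr0 ?addr0.
  by rewrite -Rintegral_angle//; exact: bmeas_Re_integrable.
by rewrite -Rintegral_angle//; exact: bmeas_Im_integrable.
Qed.

End stereographic_angle.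

(** * Transport to the Cauchy distribution *)

Lemma eq_Rintegral_off_null {R : realType} {d : measure_display}
  {T : measurableType d} (mu : {measure set T -> \bar R}) (D M : set T)
  (f g : T -> R) : measurable D ->
  measurable_fun D f -> measurable_fun D g -> measurable M -> mu M = 0%E ->
  (forall t, D t -> ~ M t -> f t = g t) ->
  \int[mu]_(t in D) f t = \int[mu]_(t in D) g t.
Proof.
move=> mD mf mg mM M0 fg; congr fine; apply: ae_eq_integral => //.
- exact/measurable_EFinP.
- exact/measurable_EFinP.
- exists M; split => // t /= H; apply: contrapT => Mt; apply: H => tD.
  by rewrite /= fg.
Qed.

Section line.
Context {R : realType}.
Local Notation leb := (@completed_lebesgue_measure R).
Local Notation L := (lebesgueType R).
Local Notation nu := (@cauchy_prob R).
Local Notation z := (@stereo R : L -> R[i]).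
Implicit Types (u v : R -> R[i]) (k : int).

Let D : set R := `[0, 2 * pi]%classic.

Let mD : measurable (D : set L). Proof. exact: measurable_leb_itv. Qed.

Lemma pi2_gt0 : (0 : R) < 2 * pi. Proof. by rewrite mulr_gt0 ?pi_gt0. Qed.

Lemma expiD (s t : R) : expi (s + t) = expi s * expi t.
Proof. by rewrite /expi cosD sinD; apply: eqC_ReIm => //=; rewrite addrC mulrC. Qed.

Lemma nc_expi (t : R) : nc (expi t) = 1.
Proof. by rewrite /= cos2Dsin2 sqrtr1. Qed.

Lemma expi0 : expi 0 = 1 :> R[i].
Proof. by rewrite /expi cos0 sin0. Qed.

Lemma expiN (t : R) : expi (- t) = (expi t)^-1.
Proof.
have e0 := unimod_neq0 (nc_expi t).
by apply: (mulfI e0); rewrite mulfV// -expiD subrr expi0.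
Qed.

Lemma expi_expz (t : R) k : expi t ^ k = expi (k%:~R * t).
Proof.
have H n : expi t ^+ n = expi (n%:R * t).
  elim: n => [|n ih]; first by rewrite mul0r expi0.
  by rewrite exprS ih -expiD -natr1 mulrDl mul1r addrC.
case: k => n; first exact: H.
by rewrite -[_ ^ _]/((expi t ^+ n.+1)^-1) H -expiN -mulNr NegzE rmorphN.
Qed.

Lemma continuous_measurable_leb (f : R -> R) (A : set R) :
  continuous f -> measurable_fun (A : set L) f.
Proof.
move=> cf; apply: measurable_funTS; apply: measurable_borel_lebesgue.
exact: continuous_measurable_fun.
Qed.

Lemma bounded_circle_integrable (f : R -> R) : measurable_fun (D : set L) f ->
  (forall t, `|f t| <= 1) -> leb.-integrable D (EFin \o f).
Proof.
move=> mf f1; apply: measurable_bounded_integrable => //.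
  rewrite [X in (X < _)%E](_ : _ = @lebesgue_measure R D)//.
  by rewrite lebesgue_measure_itv/=; case: ifP; rewrite ?ltry// -EFinB ltry.
exists 1; split; first by rewrite num_real.
by move=> y y1 t _; apply: le_trans (f1 t) (ltW y1).
Qed.

Lemma integral_circle_FTC (f F : R -> R) : continuous f ->
  (forall t, `|f t| <= 1) -> (forall t : R, is_derive t (1 : R) F (f t)) ->
  \int[leb]_(t in D) f t = F (2 * pi) - F 0.
Proof.
move=> cf f1 dF.
have cF : continuous F.
  move=> t; apply: differentiable_continuous; apply/derivable1_diffP.
  exact: ex_derive.
rewrite /Rintegral.
have mf : measurable_fun [set: measurableTypeR R] (EFin \o f).
  by apply/measurable_EFinP; exact: continuous_measurable_fun.
have fi : leb.-integrable ((idfun : L -> measurableTypeR R) @^-1` D) ((EFin \o f) \o (idfun : L -> measurableTypeR R)).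
  by apply: bounded_circle_integrable => //; exact: continuous_measurable_leb.
(* The completed measure agrees with the Lebesgue measure on Borel sets. *)
have := integral_pushforward (@measurable_id_lebesgue R) mf fi (measurable_itv _).
rewrite -[X in _ = X -> _]/(\int[leb]_(t in D) (f t)%:E)%E => <-.
rewrite -[X in fine X]/(\int[@lebesgue_measure R]_(t in D) (f t)%:E)%E.
rewrite (@continuous_FTC2 _ _ F _ _ pi2_gt0)//.
- exact: continuous_subspaceT.
- split.
  + by move=> x _; exact: ex_derive.
  + by apply: cvg_at_right_filter; exact: cF.
  + by apply: cvg_at_left_filter; exact: cF.
- by move=> x _; rewrite derive1E derive_val.
Qed.

Lemma is_derive_scale (n t : R) : is_derive t (1 : R) (fun t : R => n * t) n.
Proof.
have := is_deriveZ n (is_derive_id t (1 : R)).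
by rewrite /GRing.scale/= mulr1.
Qed.

Lemma cintegral_expi (n : nat) :
  cintegral D (fun t => expi (n.+1%:R * t)) = 0.
Proof.
have n0 : n.+1%:R != 0 :> R by rewrite pnatr_eq0.
have c1 : continuous (fun t : R => cos (n.+1%:R * t)).
  move=> t; apply: continuous_comp; first exact: mulrl_continuous.
  exact: continuous_cos.
have c2 : continuous (fun t : R => sin (n.+1%:R * t)).
  move=> t; apply: continuous_comp; first exact: mulrl_continuous.
  exact: continuous_sin.
have per : n.+1%:R * (2 * pi) = 0 + pi *+ 2 *+ n.+1 :> R.
  by rewrite add0r -(mulr_natl (pi *+ 2)) -(mulr_natl pi).
have d1 (t : R) : is_derive t (1 : R)
    (fun t : R => n.+1%:R^-1 * sin (n.+1%:R * t)) (cos (n.+1%:R * t)).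
  have := is_deriveZ n.+1%:R^-1 (is_derive1_comp
    (is_derive_sin (n.+1%:R * t)) (is_derive_scale n.+1%:R t)).
  by rewrite /GRing.scale/= mulrCA mulVf// mulr1.
have d2 (t : R) : is_derive t (1 : R)
    (fun t : R => - n.+1%:R^-1 * cos (n.+1%:R * t)) (sin (n.+1%:R * t)).
  have := is_deriveZ (- n.+1%:R^-1) (is_derive1_comp
    (is_derive_cos (n.+1%:R * t)) (is_derive_scale n.+1%:R t)).
  by rewrite /GRing.scale/= !mulNr mulrN opprK mulrCA mulVf// mulr1.
rewrite /cintegral; apply: eqC_ReIm => /=.
  apply: etrans (integral_circle_FTC c1 (fun t => cos_max _) d1) _.
  by rewrite mulr0 sin0 mulr0 subr0 per (periodicn (@sinD2pi R)) sin0 mulr0.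
apply: etrans (integral_circle_FTC c2 (fun t => sin_max _) d2) _.
by rewrite mulr0 cos0 mulr1 per (periodicn (@cosD2pi R)) cos0 mulr1 subrr.
Qed.

Lemma ae_eq_cintegral_circle (f g : R -> R[i]) (M : set L) :
  measurable_fun (D : set L) (fun t => complex.Re (f t)) ->
  measurable_fun (D : set L) (fun t => complex.Im (f t)) ->
  measurable_fun (D : set L) (fun t => complex.Re (g t)) ->
  measurable_fun (D : set L) (fun t => complex.Im (g t)) ->
  measurable M -> leb M = 0%E -> (forall t, D t -> ~ M t -> f t = g t) ->
  cintegral D f = cintegral D g.
Proof.
move=> f1 f2 g1 g2 mM M0 fg; apply: eqC_ReIm => /=.
  by apply: (eq_Rintegral_off_null mD f1 g1 mM M0) => t tD tM; rewrite fg.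
by apply: (eq_Rintegral_off_null mD f2 g2 mM M0) => t tD tM; rewrite fg.
Qed.

Lemma cmeas_stereo : cmeas z.
Proof.
have c1 : continuous (fun x : R => x ^+ 2 + 1).
  move=> x; apply: cvgD; [exact: exprn_continuous|exact: cvg_cst].
have c10 (x : R) : x ^+ 2 + 1 != 0 by rewrite gt_eqF// ltr_wpDl// sqr_ge0.
split => /=.
  apply: continuous_measurable_leb => x; apply: cvgM.
    exact: mulrl_continuous.
  by apply: cvgV => //; exact: c1.
apply: continuous_measurable_leb => x; apply: cvgM.
  by apply: cvgB; [exact: exprn_continuous|exact: cvg_cst].
by apply: cvgV => //; exact: c1.
Qed.

Lemma stereo_inj : injective z.
Proof. exact: can_inj (@stereoK R). Qed.

Lemma stereo_angle_expz k t : D t -> t <> pi / 2 ->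
  stereo (angle_pt t) ^ k = expi (k%:~R * t).
Proof.
rewrite /D/= in_itv/= => /andP[t0 t2] /eqP tp.
by rewrite stereo_angle_pt// expi_expz.
Qed.

Lemma continuous_expi_measurable (r : R) :
  measurable_fun (D : set L) (fun t => cos (r * t)) /\
  measurable_fun (D : set L) (fun t => sin (r * t)).
Proof.
split; apply: continuous_measurable_leb => t.
  apply: continuous_comp; first exact: mulrl_continuous.
  exact: continuous_cos.
apply: continuous_comp; first exact: mulrl_continuous.
exact: continuous_sin.
Qed.

(** Off the pole, [stereo (angle_pt t)] is [expi t], whose powers have mean 0. *)
Lemma cint_stereo_exp (n : nat) : cint nu (fun x => z x ^+ n.+1) = 0.
Proof.
have bz : bmeas z.
  by apply: bmeas_unimod; [exact: cmeas_stereo|exact: normc_stereo].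
have bzn : bmeas (fun x => z x ^+ n.+1) by exact: bmeasX.
have [[m1 m2] _] := bzn.
have := cintegral_angle bzn.
rewrite (@ae_eq_cintegral_circle _ (fun t => expi (n.+1%:R * t)) [set pi / 2]).
- rewrite cintegral_expi => /esym/eqP; rewrite mulf_eq0 => /orP[|/eqP//].
  by move=> /eqP[] /eqP; rewrite gt_eqF// pi2_gt0.
- exact: (measurable_comp_angle m1).
- exact: (measurable_comp_angle m2).
- by have [] := continuous_expi_measurable n.+1%:R.
- by have [] := continuous_expi_measurable n.+1%:R.
- exact: measurable_leb_set1.
- exact: leb_set1.
- by move=> t tD tp; exact: (stereo_angle_expz n.+1%:Z tD tp).
Qed.

Lemma fourier_coefE u k : bmeas (u : L -> R[i]) ->
  fourier_coef (u \o stereo_inv) k = fcoef nu z u k.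
Proof.
move=> bu; have bf : bmeas (fun x : L => u x * z x ^ (- k)).
  exact: (bmeasM bu (bmeas_expz (- k) cmeas_stereo (@normc_stereo R))).
have [[m1 m2] _] := bf; have [[u1 u2] _] := bu.
have au1 := measurable_comp_angle u1; have au2 := measurable_comp_angle u2.
have [e1 e2] := continuous_expi_measurable (- k%:~R).
rewrite /fourier_coef /fcoef.
have -> : cint nu (fun x : L => u x * z x ^ (- k)) =
    ((2 * pi)^-1)%:C%C * cintegral D ((fun x : L => u x * z x ^ (- k)) \o angle_pt).
  rewrite cintegral_angle// mulrA -rmorphM/= mulVf ?rmorph1 ?mul1r//.
  by rewrite gt_eqF// pi2_gt0.
congr (_ * _).
apply: (@ae_eq_cintegral_circle _ _ [set pi / 2]).
- under eq_fun do rewrite cReM /= -mulNr.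
  by apply: measurable_funB; apply: measurable_funM.
- under eq_fun do rewrite cImM /= -mulNr.
  by apply: measurable_funD; apply: measurable_funM.
- exact: (measurable_comp_angle m1).
- exact: (measurable_comp_angle m2).
- exact: measurable_leb_set1.
- exact: leb_set1.
- move=> t tD tp /=; rewrite -mulNr -rmorphN.
  by rewrite (stereo_angle_expz (- k) tD tp).
Qed.

Lemma fourier_coef_ae u v k : cmeas (u : L -> R[i]) -> cmeas (v : L -> R[i]) ->
  ae_equal u v ->
  fourier_coef (u \o stereo_inv) k = fourier_coef (v \o stereo_inv) k.
Proof.
move=> [u1 u2] [v1 v2] [N [mN N0 uv]].
have au1 := measurable_comp_angle u1; have au2 := measurable_comp_angle u2.
have av1 := measurable_comp_angle v1; have av2 := measurable_comp_angle v2.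
have [e1 e2] := continuous_expi_measurable (- k%:~R).
have [mM M0] := leb_angle_preimage mN.
rewrite /fourier_coef; congr (_ * _).
apply: (ae_eq_cintegral_circle _ _ _ _ mM).
- under eq_fun do rewrite cReM /= -mulNr.
  by apply: measurable_funB; apply: measurable_funM.
- under eq_fun do rewrite cImM /= -mulNr.
  by apply: measurable_funD; apply: measurable_funM.
- under eq_fun do rewrite cReM /= -mulNr.
  by apply: measurable_funB; apply: measurable_funM.
- under eq_fun do rewrite cImM /= -mulNr.
  by apply: measurable_funD; apply: measurable_funM.
- by rewrite M0 cauchy_null ?mule0.
- move=> t tD tM; congr (_ * _).
  apply: contrapT => uvt; apply: tM; split => //; apply: uv => /=.
  exact: uvt.
Qed.

Lemma deg_ae u v : cmeas (u : L -> R[i]) -> cmeas (v : L -> R[i]) ->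
  ae_equal u v -> deg u = deg v.
Proof.
move=> mu mv uv; rewrite /deg /deg_circle; congr zsum; apply/funext => k.
by rewrite (fourier_coef_ae k mu mv uv).
Qed.

Let measurable_quotient u : cmeas (u : L -> R[i]) ->
  measurable_fun setT (fun p : L * L => (nc (u p.1 - u p.2) ^+ 2 / `|p.1 - p.2 : R| ^+ 2)%:E).
Proof.
move=> mu; apply/measurable_EFinP; apply: measurable_funM.
  exact: (cmeas_nc2 (cmeas_diff mu)).
apply: measurable_inv_fun; apply: measurable_funX.
apply: measurableT_comp => //.
have mid : measurable_fun [set: L] (idfun : L -> R) by exact: measurable_id_lebesgue.
apply: measurable_funB.
  exact: (measurableT_comp (f := idfun : L -> R) mid measurable_fst).
exact: (measurableT_comp (f := idfun : L -> R) mid measurable_snd).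
Qed.

(** The pairs with one coordinate in a given null set form a null set. *)
Lemma sqnorm_Hhalf_ae u v : cmeas (u : L -> R[i]) -> cmeas (v : L -> R[i]) ->
  ae_equal u v -> sqnorm_Hhalf u = sqnorm_Hhalf v.
Proof.
move=> mu mv [N [mN N0 uv]]; rewrite /sqnorm_Hhalf; congr (_ * _)%E.
apply: ae_eq_integral => //; try exact: measurable_quotient.
exists ((N `*` setT) `|` (setT `*` N)); split.
- by apply: measurableU; apply: measurableX.
- apply/eqP; rewrite eq_le measure_ge0 andbT.
  have mNT : measurable (N `*` [set: L]) by exact: measurableX.
  have mTN : measurable ([set: L] `*` N) by exact: measurableX.
  have e1 : (leb \x leb)%E (N `*` [set: L]) = 0%E.
    by rewrite product_measure1E// [X in (X * _)%E]N0 mul0e.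
  have e2 : (leb \x leb)%E ([set: L] `*` N) = 0%E.
    by rewrite product_measure1E// [X in (_ * X)%E]N0 mule0.
  apply: le_trans (@measureU2 _ _ _ (leb \x leb)%E _ _ mNT mTN) _.
  rewrite [X in (X + _ <= _)%E](_ : _ = 0%E); last exact: e1.
  by rewrite [X in (_ + X <= _)%E](_ : _ = 0%E) ?adde0//; exact: e2.
move=> [x y] /= H; apply: contrapT => /not_orP[h1 h2]; apply: H => _.
have ux t : ~ N t -> u t = v t by move=> Nt; apply: contrapT => /uv.
rewrite ux ?(ux y)//; first by move=> Ny; apply: h2.
by move=> Nx; apply: h1.
Qed.

Lemma stereo_dist (x y : R) : nc (z x - z y) ^+ 2 =
  4 * (x - y) ^+ 2 / ((1 + x ^+ 2) * (1 + y ^+ 2)).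
Proof.
have h (t : R) : 1 + t ^+ 2 != 0 by rewrite gt_eqF// ltr_wpDr// sqr_ge0.
by rewrite nc_sq /=; field; rewrite !h.
Qed.

(** Conformal invariance: by [stereo_dist], the factors 1 / (1 + x^2) from the
    chordal distance are those of the densities. *)
Lemma sqnorm_HhalfE u : cmeas (u : L -> R[i]) -> sqnorm_Hhalf u = energy nu z u.
Proof.
move=> mu.
pose K (p : L * L) := (nc (u p.1 - u p.2) ^+ 2 / nc (z p.1 - z p.2) ^+ 2)%:E.
pose H (p : L * L) := (nc (u p.1 - u p.2) ^+ 2 / `|p.1 - p.2 : R| ^+ 2)%:E.
have K0 p : (0 <= K p)%E by rewrite lee_fin divr_ge0// sqr_ge0.
have H0 p : (0 <= H p)%E by rewrite lee_fin divr_ge0// sqr_ge0.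
have mK : measurable_fun setT K by exact: (measurable_energy cmeas_stereo mu).
have mH : measurable_fun setT H by exact: measurable_quotient.
pose c : R := (4 * pi ^+ 2)^-1.
have c0 : (0 <= c%:E)%E by rewrite lee_fin invr_ge0 mulr_ge0// sqr_ge0.
have KH p : (c%:E * H p = K p * (cauchy_pdf p.2)%:E * (cauchy_pdf p.1)%:E)%E.
  case: p => x y; rewrite /K /H /= -!EFinM; congr (_%:E).
  rewrite stereo_dist real_normK ?num_real// /cauchy_pdf /c.
  have h (t : R) : 1 + t ^+ 2 != 0 by rewrite gt_eqF// ltr_wpDr// sqr_ge0.
  have [->|xy] := eqVneq x y; first by rewrite subrr Normc.normc0 expr0n/= !mul0r mulr0.
  have xy0 : x - y != 0 by rewrite subr_eq0.
  have p0 : (pi : R) != 0 by rewrite gt_eqF ?pi_gt0.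
  move: (pi : R) p0 => q q0; field.
  by rewrite q0 xy0 !h.
rewrite /energy (ge0_integral_cauchy2 K0 mK).
rewrite /sqnorm_Hhalf -(ge0_integralZl (leb \x leb)%E measurableT mH (fun p _ => H0 p) c0).
by apply: eq_integral => p _; rewrite KH.
Qed.

(** The results on inner functions are about functions whose modulus is one
    everywhere; the exceptional values are replaced by 1. *)
Lemma unimodular_representative u : Hhalf_circle u ->
  exists v : R -> R[i], [/\ cmeas (v : L -> R[i]), cmeas (u : L -> R[i]),
    ae_equal u v & forall x, nc (v x) = 1].
Proof.
move=> [mu u1 _]; pose v x := if nc (u x) ^+ 2 == 1 then u x else 1.
have [muR muI] := mu; have mnc : measurable_fun [set: L] (fun x : L => nc (u x) ^+ 2).
  exact: (@cmeas_nc2 _ _ L u).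
have mb : measurable_fun [set: L] (fun x : L => nc (u x) ^+ 2 == 1).
  by apply: measurable_fun_eqr.
exists v; split.
- split.
    rewrite (_ : (fun x => _) =
      fun x => if nc (u x) ^+ 2 == 1 then complex.Re (u x) else 1).
      exact: measurable_fun_ifT.
    by apply/funext => x; rewrite /v; case: ifP.
  rewrite (_ : (fun x => _) =
    fun x => if nc (u x) ^+ 2 == 1 then complex.Im (u x) else 0).
    exact: measurable_fun_ifT.
  by apply/funext => x; rewrite /v; case: ifP.
- exact: mu.
- have [N [mN N0 uN]] := u1; exists N; split => [||x /= h].
  + exact: mN.
  + exact: N0.
  + by apply: uN => /= ux; apply: h; rewrite /v ux expr1n eqxx.
- move=> x; rewrite /v; case: ifPn => [|_]; last by rewrite Normc.normc1.
  by rewrite sqrf_eq1 => /orP[/eqP//|/eqP E]; have := nc_ge0 (u x);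
    rewrite E oppr_ge0 ler10.
Qed.

End line.

(** * The Cayley transform *)

Section moebius.
Context {R : realType}.
Local Notation I := ('i%C : R[i]).

(** The holomorphic extension of [stereo_inv] to the unit disc, which it maps
    onto the upper half-plane. *)
Definition cayley (a : R[i]) : R[i] := I * (I + a) / (I - a).

Lemma unimod_expi (c : R[i]) : nc c = 1 -> exists t : R, expi t = c.
Proof.
move=> c1; have := nc_sq c; rewrite c1 expr1n; case: c {c1} => a b /= ab.
have a1 : -1 <= a <= 1.
  by rewrite -ler_norml -(@ler_pXn2r _ 2)// ?nnegrE// expr1n real_normK ?num_real// ab lerDl sqr_ge0.
have sb : Num.sqrt (1 - a ^+ 2) = `|b|.
  by rewrite (_ : 1 - a ^+ 2 = b ^+ 2) ?sqrtr_sqr// ab; ring.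
have ai : a \in `[-1, 1] by rewrite in_itv.
have [b0|b0] := leP 0 b.
  exists (acos a); rewrite /expi acosK// sin_acos// sb ger0_norm//.
exists (- acos a); rewrite /expi cosN sinN acosK// sin_acos// sb ltr0_norm//.
by rewrite opprK.
Qed.

Lemma I_sub_neq0 (a : R[i]) : nc a < 1 -> I - a != 0.
Proof.
move=> a1; rewrite -nc_eq0 gt_eqF//.
have i1 : nc I = 1 by rewrite /= expr0n expr1n add0r sqrtr1.
have : nc I <= nc (I - a) + nc a by apply: le_trans (ncD _ _); rewrite subrK.
by rewrite i1 -lerBlDr; apply: lt_le_trans; rewrite subr_gt0.
Qed.

Lemma cayley_upper (a : R[i]) : nc a < 1 -> upper_half_plane (cayley a).
Proof.
move=> a1; have := I_sub_neq0 a1; rewrite /upper_half_plane/= /cayley.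
have : nc a ^+ 2 < 1 by rewrite expr_lt1// nc_ge0.
rewrite nc_sq -nc_eq0 -sqrf_eq0 nc_sq.
case: a {a1} => p q /= pq d0.
have d1 : 0 < (0 - p) ^+ 2 + (1 - q) ^+ 2.
  by rewrite lt_neqAle eq_sym d0 addr_ge0 ?sqr_ge0.
rewrite [X in 0 < X](_ : _ = (1 - (p ^+ 2 + q ^+ 2)) / ((0 - p) ^+ 2 + (1 - q) ^+ 2)).
  by rewrite divr_gt0// subr_gt0.
by field; rewrite -[- p]sub0r.
Qed.

(** As stereo x = i (x - i) / (x + i), the numerator and the denominator on the
    left become constants times x - cayley a and x - (cayley a)^* after
    multiplication by x + i. *)
Lemma moebius_stereo (a : R[i]) (x : R) : nc a < 1 ->
  (stereo x - a) / (1 - a^*%C * stereo x) =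
  ((I - a) / (1 - I * a^*%C)) *
  ((x%:C%C - cayley a) / (x%:C%C - (cayley a)^*%C)).
Proof.
move=> a1; have n0 := I_sub_neq0 a1.
have II : I * I = -1 by apply/eqP; rewrite eq_complex /=;
  apply/andP; split; apply/eqP; ring.
have IJ : I^*%C = - I by apply/eqP; rewrite eq_complex /= oppr0 !eqxx.
have I0 : I != 0 by rewrite -nc_eq0 /= expr0n expr1n add0r sqrtr1 oner_neq0.
have m0 : 1 - I * a^*%C != 0.
  have : I * (I - a)^*%C != 0 by rewrite mulf_neq0// conjc_eq0.
  rewrite conjB IJ mulrBr mulrN II opprK; done.
have xI : x%:C%C + I != 0.
  by rewrite eq_complex /= add0r oner_eq0 andbF.
have up := cayley_upper a1.
have real_neq (b : R[i]) : complex.Im b != 0 -> x%:C%C - b != 0.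
  by rewrite subr_eq0; apply: contra => /eqP <-.
have d1 : x%:C%C - cayley a != 0 by apply: real_neq; rewrite gt_eqF.
have d2 : x%:C%C - (cayley a)^*%C != 0.
  apply: real_neq; move: up; rewrite /upper_half_plane/=.
  by case: (cayley a) => p q /= q0; rewrite oppr_eq0 gt_eqF.
have sE : stereo x = I * (x%:C%C - I) / (x%:C%C + I).
  apply: (mulIf xI); rewrite divfK//.
  have h : x ^+ 2 + 1 != 0 by rewrite gt_eqF// ltr_wpDl// sqr_ge0.
  by apply/eqP; rewrite eq_complex /=; apply/andP; split; apply/eqP; field.
have cJ : (cayley a)^*%C = (a^*%C - I) / (1 - I * a^*%C).
  rewrite /cayley !conjM conjc_inv conjB conjD IJ.
  have e : - I - a^*%C != 0 by rewrite -IJ -conjB conjc_eq0.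
  apply: (mulIf m0); rewrite divfK//; apply: (mulIf e).
  rewrite mulrAC divfK//.
  have -> : - I * (- I + a^*%C) * (1 - I * a^*%C) =
    I * I - I * a^*%C - (I * I) * I * a^*%C + (I * I) * a^*%C * a^*%C by ring.
  have -> : (a^*%C - I) * (- I - a^*%C) = I * I - a^*%C * a^*%C by ring.
  by rewrite II; ring.
have num : stereo x - a = (I - a) * (x%:C%C - cayley a) / (x%:C%C + I).
  have -> : (I - a) * (x%:C%C - cayley a) = (I - a) * x%:C%C - I * (I + a).
    by rewrite mulrBr (mulrC (I - a) (cayley a)) divfK.
  rewrite sE; apply: (mulIf xI); rewrite mulrBl !divfK//; ring.
have den : 1 - a^*%C * stereo x =
    (1 - I * a^*%C) * (x%:C%C - (cayley a)^*%C) / (x%:C%C + I).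
  have -> : (1 - I * a^*%C) * (x%:C%C - (cayley a)^*%C) =
      (1 - I * a^*%C) * x%:C%C - (a^*%C - I).
    by rewrite cJ mulrBr (mulrC (1 - I * a^*%C) (_ / _)) divfK.
  rewrite sE; apply: (mulIf xI); rewrite mulrBl mulrA !divfK// mul1r.
  have -> : x%:C%C + I - a^*%C * (I * (x%:C%C - I)) =
    x%:C%C + I - I * a^*%C * x%:C%C + (I * I) * a^*%C by ring.
  by rewrite II; ring.
rewrite num den; field.
by rewrite m0 d2 xI.
Qed.

Lemma nc_moebius_factor (a : R[i]) : nc a < 1 ->
  nc ((I - a) / (1 - I * a^*%C)) = 1.
Proof.
move=> a1; have n0 := I_sub_neq0 a1.
have i1 : nc I = 1 by rewrite /= expr0n expr1n add0r sqrtr1.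
have -> : 1 - I * a^*%C = I * (I - a)^*%C.
  rewrite conjB mulrBr mulcJ i1 expr1n //.
by rewrite ncM ncV ncM i1 mul1r ncJ mulfV// nc_eq0.
Qed.

(** The factors of modulus one from [moebius_stereo] are absorbed by theta. *)
Lemma blaschke_psi (c : R[i]) (s : seq R[i]) : nc c = 1 ->
  (forall a, a \in s -> nc a < 1) ->
  exists theta (alpha : 'I_(size s) -> R[i]),
    (forall k, upper_half_plane (alpha k)) /\
    forall x, c * \prod_(a <- s) ((stereo x - a) / (1 - a^*%C * stereo x)) =
      psi theta alpha x.
Proof.
move=> c1 sa.
have C1 : nc (c * \prod_(a <- s) ((I - a) / (1 - I * a^*%C))) = 1.
  rewrite ncM c1 mul1r.
  rewrite (big_morph _ (@ncM R) (@Normc.normc1 R)) big_seq big1// => a /sa.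
  exact: nc_moebius_factor.
have [theta thE] := unimod_expi C1.
exists theta, (fun k => cayley s`_k); split.
  by move=> k; apply: cayley_upper; apply: sa; exact: mem_nth.
move=> x; rewrite /psi thE -mulrA; congr (_ * _).
rewrite -(big_mkord xpredT (fun k => (x%:C%C - cayley s`_k) /
  (x%:C%C - (cayley s`_k)^*%C))).
rewrite -(big_nth 0 xpredT (fun a => (x%:C%C - cayley a) /
  (x%:C%C - (cayley a)^*%C))).
rewrite -big_split/= big_seq [RHS]big_seq; apply: eq_bigr => a /sa a1.
exact: moebius_stereo.
Qed.

End moebius.

(** * Degree and energy *)

Lemma ae_imply2 {R : realType} {d : measure_display} {T : measurableType d}
  (mu : {measure set T -> \bar R}) (A B C : T -> Prop) :
  (forall x, A x -> B x -> C x) -> {ae mu, forall x, A x} ->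
  {ae mu, forall x, B x} -> {ae mu, forall x, C x}.
Proof. by move=> ABC; apply: filterS2. Qed.

Section degree_energy.
Context {R : realType}.
Local Notation leb := (@completed_lebesgue_measure R).
Local Notation L := (lebesgueType R).
Local Notation nu := (@cauchy_prob R).
Local Notation z := (@stereo R : L -> R[i]).
Implicit Types u v : R -> R[i].

Local Notation c v k := (fcoef nu z v k).
Local Notation fc := (@cint_stereo_exp R).

Lemma inner_psi v (D : R) : inner nu z v ->
  \sum_(k < N) k%:R * nc (c v k%:Z) ^+ 2 @[N --> \oo] --> D ->
  exists d : nat, d%:R = D /\ exists (theta : R) (alpha : 'I_d -> R[i]),
    (forall k, upper_half_plane (alpha k)) /\ ae_equal v (psi theta alpha).
Proof.
move=> iv vD.
have [b [s [Ds b1 sa vs]]] := inner_blaschke (@cmeas_stereo R)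
  (@normc_stereo R) (@stereo_inj R) fc iv vD.
exists (size s); split => //.
have [theta [alpha [up ps]]] := blaschke_psi b1 sa.
exists theta, alpha; split => //.
have vs' := cauchy_ae vs.
by apply: (ae_imply2 (mu := leb) _ vs' vs') => x -> _; exact: ps.
Qed.

Lemma unimod_inner v : cmeas (v : L -> R[i]) -> (forall x, nc (v x) = 1) ->
  (energy nu z v < +oo)%E -> (forall n : nat, c v (Negz n) = 0) ->
  inner nu z v.
Proof. by move=> mv v1 Ev v0; split => //; split => //; exact: bmeas_unimod. Qed.

Lemma energyJ v : energy nu z (fun x => (v x)^*%C) = energy nu z v.
Proof. by apply: eq_integral => p _; rewrite -conjB ncJ. Qed.

(** Let P and Q be the sums of |k| |c_k|^2 over k > 0 and over k < 0: the energy
    is at least P + Q and deg v = P - Q.  Equality forces Q = 0 or P = 0, so that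
    v or its conjugate is inner. *)
Lemma energy_deg_unimodular v : cmeas (v : L -> R[i]) -> (forall x, nc (v x) = 1) ->
  (energy nu z v < +oo)%E ->
  ((`|deg v|)%:E <= energy nu z v)%E /\
  (energy nu z v = (`|deg v|)%:E ->
   exists d : nat, d%:R = `|deg v| /\
   exists (theta : R) (alpha : 'I_d -> R[i]),
     (forall k, upper_half_plane (alpha k)) /\
     (ae_equal v (psi theta alpha) \/
      ae_equal (fun x => (v x)^*%C) (psi theta alpha))).
Proof.
move=> mv v1 Ev; have bv := bmeas_unimod mv v1.
have mz := @cmeas_stereo R; have z1 := @normc_stereo R.
have E0 := energy_ge0 nu z v.
have Efin : energy nu z v \is a fin_num by rewrite ge0_fin_numE.
pose b k := nc (c v k) ^+ 2.
have b0 k : 0 <= b k by exact: sqr_ge0.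
have [P [Q [[P0 Q0 PQ] [hP hQ zE]]]] := zsum_bound b0
  (fun N => bisum_energy_le mz z1 (@stereo_inj R) fc N bv Ev).
have degE : deg v = P - Q.
  rewrite -zE /deg /deg_circle; congr zsum; apply/funext => k.
  by rewrite fourier_coefE.
split.
  rewrite -[leRHS](fineK Efin) lee_fin degE; apply: le_trans PQ.
  by rewrite ler_norml; apply/andP; split; lra.
rewrite -(fineK Efin) => -[EE].
have PQ' : P + Q <= `|P - Q| by rewrite -degE -EE.
have [QP|PltQ] := leP Q P.
  have Qz : Q = 0 by move: PQ'; rewrite ger0_norm ?subr_ge0//; lra.
  have q0 n : n.+1%:R * b (Negz n) = 0.
    apply: (@nonneg_series0 _ (fun k => k.+1%:R * b (Negz k))).
      by move=> k; rewrite mulr_ge0.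
    by move: hQ; rewrite Qz.
  have iv : inner nu z v.
    apply: (unimod_inner mv v1 Ev) => n; apply/eqP.
    have /eqP := q0 n; rewrite mulf_eq0 pnatr_eq0/= sqrf_eq0 nc_eq0; exact.
  have [d [dP [theta [alpha [up ae]]]]] := inner_psi iv hP.
  exists d; split; first by rewrite dP degE Qz subr0 ger0_norm.
  by exists theta, alpha; split => //; left.
have Pz : P = 0 by move: PQ'; rewrite ltr0_norm ?subr_lt0//; lra.
have p0 n : n%:R * b n%:Z = 0.
  apply: (@nonneg_series0 _ (fun k => k%:R * b k%:Z)).
    by move=> k; rewrite mulr_ge0.
  by move: hP; rewrite Pz.
pose w x := (v x)^*%C.
have wE (k : int) : c w k = (c v (- k))^*%C by exact: fcoefJ.
have iw : inner nu z w.
  apply: unimod_inner.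
  - exact: cmeasJ.
  - by move=> x; rewrite ncJ.
  - by rewrite energyJ.
  move=> n; rewrite wE; apply/eqP; rewrite conjc_eq0.
  have /eqP := p0 n.+1; rewrite /b mulf_eq0 pnatr_eq0 orFb.
  by rewrite sqrf_eq0 nc_eq0.
have hw : \sum_(k < N) k%:R * nc (c w k%:Z) ^+ 2 @[N --> \oo] --> Q.
  rewrite -cvg_shiftS/=.
  rewrite [X in X @ _](_ : _ = fun N => \sum_(k < N) k.+1%:R * b (Negz k))//.
  apply/funext => N; rewrite big_ord_recl mul0r add0r; apply: eq_bigr => k _.
  by rewrite -[LHS]/(k.+1%:R * nc (c w k.+1%:Z) ^+ 2) wE ncJ.
have [d [dQ [theta [alpha [up ae]]]]] := inner_psi iw hw.
exists d; split; first by rewrite dQ degE Pz sub0r normrN ger0_norm.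
by exists theta, alpha; split => //; right.
Qed.

End degree_energy.

Theorem theorem1p2 (R : realType) (u : R -> R[i]) (hu : Hhalf_circle u) :
  ((`|deg u|)%:E <= sqnorm_Hhalf u)%E /\
  (sqnorm_Hhalf u = (`|deg u|)%:E ->
   exists d : nat, d%:R = `|deg u| /\
   exists (theta : R) (alpha : 'I_d -> R[i]),
     (forall k, upper_half_plane (alpha k)) /\
     (ae_equal u (psi theta alpha) \/
      ae_equal (fun x => (u x)^*%C) (psi theta alpha))).
Proof.
have [v [mv mu uv v1]] := unimodular_representative hu.
have [_ _] := hu.
rewrite (sqnorm_Hhalf_ae mu mv uv) (deg_ae mu mv uv) (sqnorm_HhalfE mv) => Ev.
have [le eq] := energy_deg_unimodular mv v1 Ev; split => // /eq.
move=> [d [dE [theta [alpha [up ae]]]]]; exists d; split => //.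
exists theta, alpha; split => //.
case: ae => ae; [left|right]; apply: (ae_imply2 _ uv ae) => x /= -> //.
Qed.
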